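(* Let $\mathbf k$ be an algebraically closed field and $V$ an $\mathbb N$-graded vertex $\mathbf k$-algebra with an $\mathrm{Aut}\,\mathcal O$-action which satisfies the strong identity condition, with strong identity elements $\mathfrak 1_d\in\mathfrak A_d$, $d\in\mathbb N$. Let $(\mathscr C\to S,P_\bullet,t_\bullet)$, $S=\mathrm{Spec}\,R[[q]]$, be a smoothing family with special fibre $\mathscr C_0$, normalization $\widetilde{\mathscr C}_0$ of $\mathscr C_0$, trivial extension $\widetilde{\mathscr C}=\widetilde{\mathscr C}_0\times_{\mathrm{Spec} R} S$, and coordinates $s_\pm$ at $Q_\pm$. Let $M^\bullet=(M^1,\dots,M^n)$ be admissible $V$-modules such that the sheaf $\mathbb V(V;(M^\bullet\otimes\mathfrak A)[[q]])_{(\widetilde{\mathscr C},P_\bullet\sqcup Q_\pm,t_\bullet\sqcup s_\pm)}$ is coherent over $S$. Set $\mathfrak 1=\sum_{d\ge0}\mathfrak 1_dq^d\in\mathfrak A[[q]]$ and let $\alpha\colon M^\bullet[[q]]\to(M^\bullet\otimes\mathfrak A)[[q]]$ be the ($q$-adically continuous, linear) map induced by $u\mapsto u\otimes\mathfrak 1$. Then there is a commutative diagram $$\begin{array}{ccc}\mathbb V(V;M^\bullet[[q]])_{(\mathscr C,P_\bullet,t_\bullet)}&\xrightarrow{\ [\alpha]\ }&\mathbb V(V;M^\bullet\otimes\mathfrak A)_{(\widetilde{\mathscr C}_0,P_\bullet\sqcup Q_\pm,t_\bullet\sqcup s_\pm)}[[q]]\\ \downarrow&&\downarrow\\ \mathbb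 V(V;M^\bullet)_{(\mathscr C_0,P_\bullet,t_\bullet)}&\xrightarrow{\ [\alpha_0]\ }&\mathbb V(V;M^\bullet\otimes\mathfrak A)_{(\widetilde{\mathscr C}_0,P_\bullet\sqcup Q_\pm,t_\bullet\sqcup s_\pm)}\end{array}$$ whose vertical maps (setting $q=0$) are surjective, where $[\alpha]$ and $[\alpha_0]$ are induced by $\alpha$ and by $\alpha_0\colon M^\bullet\to M^\bullet\otimes\mathfrak A$, $w\mapsto w\otimes\mathfrak 1_0$.
   Context: **Vertex algebras.** A vertex $\mathbf k$-algebra is a $\mathbf k$-module $V$ with $\mathbf 1\in V$ and a linear map $Y(\cdot,z)\colon V\to\mathrm{End}(V)[[z,z^{-1}]]$, $Y(a,z)=\sum_{n\in\mathbb Z}a_{(n)}z^{-1-n}$, such that $a_{(n)}b=0$ for $n\gg0$; $\mathbf 1_{(n)}a=\delta_{n,-1}a$; $a_{(-1)}\mathbf 1=a$ and $a_{(n)}\mathbf 1=0$ for $n\ge0$; and the Jacobi identity holds, equivalently for all $r,s\in\mathbb Z$: $[a_{(r)},b_{(s)}]=\sum_{j\ge0}\binom rj(a_{(j)}b)_{(r+s-j)}$ and $(a_{(r)}b)_{(s)}=\sum_{j\ge0}(-1)^j\binom rj\big(a_{(r-j)}b_{(s+j)}-(-1)^rb_{(r+s-j)}a_{(j)}\big)$. Put $T^{(n)}a=a_{(-1-n)}\mathbf 1$, $e^{zT}=\sum_nz^nT^{(n)}$. $V$ is $\mathbb N$-graded if $V=\bigoplus_{s\ge0}V_s$, $\mathbf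 1\in V_0$, and $a_{(n)}$ has degree $\deg a-1-n$. An admissible $V$-module is $W=\bigoplus_{s\ge0}W_s$ with modes $a^W_{(n)}$ of degree $\deg a-1-n$, $a^W_{(n)}w=0$ for $n\gg0$, $\mathbf 1^W_{(n)}=\delta_{n,-1}\mathrm{id}$, and the same two formulas on $W$. **$\mathrm{Aut}\,\mathcal O$-actions and Möbius structure.** $\mathrm{Aut}\,\mathcal O$ is the group (functor) of continuous automorphisms $\rho(t)=a_1t+a_2t^2+\cdots$ ($a_1$ a unit) of $\mathbf k[[t]]$. An action on $V$ is a representation $\Pi\colon\mathrm{Aut}\,\mathcal O\to GL_{\mathbf k}(V)$ such that, with $\Pi(\rho_z)=e^{-zT}\Pi(\rho)e^{\rho(z)T}$ and $G_pV=\bigoplus_{s\le p}V_s$: (i) coefficients of $\Pi(\rho_z)$ preserve $G_\bullet V$; (ii) $\Pi(\rho_z)a-(\rho'(z))^{-\Delta}a\in G_{\Delta-1}V[[z]]$ for $a\in V_\Delta$; (iii) $\Pi(t\mapsto xt)a=x^{-\deg a}a$; (iv) $\Pi(\rho)Y(\Pi(\rho_z)^{-1}a,\rho(z))\Pi(\rho)^{-1}=Y(a,z)$. $V$ carries a compatible Möbius structure: operators $L_{\pm1}^{(n)},L_0^{(n)}$ with $L_i^{(0)}=1$, $L_{-1}^{(n)}=T^{(n)}$, $L_0^{(n)}|_{V_s}=\binom{-2s}n$, $L_1^{(n)}$ of degree $-n$, $L_1^{(m)}L_1^{(n)}=\binom{m+n}nL_1^{(m+n)}$, $L_1^{(m)}L_{-1}^{(n)}=\sum_{i=0}^{\min(m,n)}\sum_{j=0}^i\binom{-m-n+2i}{j}(-1)^iL_{-1}^{(n-i)}L_0^{(i-j)}L_1^{(m-i)}$,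 $L_1^{(n)}\mathbf 1=\delta_{n,0}\mathbf 1$, $e^{zL_1}Y(a,z_0)e^{-zL_1}=Y\big(e^{z(1-zz_0)L_1}(1-zz_0)^{-2L_0}a,\frac{z_0}{1-zz_0}\big)$ (with $e^{zL_1}=\sum z^nL_1^{(n)}$, $(1+z)^{-2L_0}=\sum z^nL_0^{(n)}$), and $\Pi(\gamma)a=(-1)^{\deg a}\sum_iL_1^{(i)}a$ for $\gamma(z)=\frac1{1+z}-1$. **Enveloping and mode transition algebras.** $\mathfrak L(V)^{\mathsf f}=V\otimes\mathbf k[t,t^{-1}]/(\mathrm{Im}\sum_{0\le i\le k}T^{(i)}\otimes\partial_t^{(k-i)})_{k>0}$, $a_{[m]}$ the class of $a\otimes t^m$, $[a_{[n]},b_{[m]}]=\sum_j\binom nj(a_{(j)}b)_{[n+m-j]}$, $\deg a_{[m]}=\deg a-1-m$. With $U$ its universal enveloping algebra, $\widehat U=\bigoplus_d\varprojlim_mU_d/\sum_{j\le-m}U_{d-j}U_j$, and $\mathscr U$ is the quotient of $\widehat U$ by the closed two-sided ideal generated by $\mathbf 1_{[m]}-\delta_{m,-1}$ and $(a_{(r)}b)_{[s]}-\sum_j(-1)^j\binom rj(a_{[r-j]}b_{[s+j]}-(-1)^rb_{[r+s-j]}a_{[j]})$. $\mathsf A_{n,m}=\mathscr U_{n-m}/(\text{image/closure of }\sum_{j\le-m-1}\mathscr U_{n-m-j}\mathscr U_j)$, $\mathsf A_d=\mathsf A_{d,d}$. $\mathfrak A=\bigoplus_{n,m\ge0}\mathfrak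 A_{n,-m}$, $\mathfrak A_{n,-m}=\mathsf A_{n,0}\otimes_{\mathsf A_0}\mathsf A_{0,m}$, $\mathfrak A_d=\mathfrak A_{d,-d}$; $\mathscr U$ acts on the left of the first factor and on the right of the second. The star product $\mathfrak A_{n,-d}\otimes\mathfrak A_{d,-m}\to\mathfrak A_{n,-m}$ is $(x\otimes y)\star(x'\otimes y')=x\cdot(yx')\otimes y'$ with $yx'\in\mathsf A_0$ the product. $\mathfrak 1_d\in\mathfrak A_d$ is a strong identity element if $\mathfrak a\star\mathfrak 1_d=\mathfrak a$ for $\mathfrak a\in\mathfrak A_{m,-d}$ and $\mathfrak 1_d\star\mathfrak b=\mathfrak b$ for $\mathfrak b\in\mathfrak A_{d,-m}$, all $m\ge0$; $V$ satisfies the strong identity condition if such elements exist for all $d\ge0$ ($\mathfrak 1_0=1\otimes1$). $\theta$ is the anti-automorphism of $\mathscr U$ with $\theta(a_{[j]})=(-1)^{\deg a}\sum_{i\ge0}(L_1^{(i)}a)_{[2\deg a-j-i-2]}$. Placed at $Q_\pm$, $\mathfrak A$ is acted on by $x$ at $Q_+$ via left multiplication on the first factor and by $x$ at $Q_-$ via $b\mapsto b\cdot\theta(x)$ on the second. **Smoothing family.** $R$ is a $\mathbf k$-algebra with $S_0=\mathrm{Spec}\,R$ smooth over $\mathbf k$; $\mathscr C_0\to S_0$ is a semistable curve with one node given by a section $Q$ and $n$ disjoint smooth sections $P_\bullet$, $\mathscr C_0\setminus P_\bullet$ affine over $S_0$; $\widetilde{\mathscr C}_0$ is its normalization, a smooth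 curve with sections $P_\bullet\sqcup(Q_+,Q_-)$, and $s_\pm$ are formal coordinates at $Q_\pm$. These determine a flat family $\mathscr C\to S=\mathrm{Spec}\,R[[q]]$ with sections $P_\bullet$, smooth general fibre and special fibre $\mathscr C_0$, given near the node by $s_+s_-=q$. **Chiral Lie algebras.** For a smooth family $\mathcal C\to S$, $\mathcal V_{\mathcal C/S}=(V\otimes\pi_*\mathcal O_{\mathscr{A}ut})^{\mathrm{Aut}\,\mathcal O}$ where $\pi\colon\mathscr{A}ut\to\mathcal C$ is the torsor of formal coordinates; locally $\simeq_tV\otimes\mathcal O$, glued by $(P,t,a)\sim(P,\rho(t),\Pi(\rho)^{-1}a)$. $\mathcal L_{\mathcal C\setminus P_\bullet}(V)$ is the space of sections over the complement of the marked sections of $(\mathcal V_{\mathcal C/S}\otimes\omega_{\mathcal C/S})/\mathrm{Im}\,\nabla$, $\mathrm{Im}\,\nabla$ generated by images of $a\otimes f\,dt\mapsto\sum_{i\le k}T^{(i)}a\otimes\partial_t^{(k-i)}f\,dt$, $k>0$. Expanding $\sigma$ at a marked section in its coordinate and sending $a\otimes t^m\,dt$ to $a_{[m]}$ gives $\sigma_P$, acting on the module there. $\mathcal L_{\mathscr C\setminus P_\bullet}(V)$ is the subspace of $\mathcal L_{\widetilde{\mathscr C}\setminus P_\bullet\sqcup Q_\pm}(V)$ generated by those $\sigma$ with $\sigma_{Q_+}=\sum_{i,j\ge0}\alpha_{i,j}a_{[\deg a+i-j-1]}q^j$ and $\sigma_{Q_-}=-\sum_{i,j\ge0}\alpha_{i,j}\theta(a_{[\deg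 a+i-j-1]})q^i$ for homogeneous $a\in V$, $\alpha_{i,j}\in R$; for the special fibre set $q=0$. **Coinvariants.** $\mathbb V(V;N)$ is the quotient of $N$ by the span of $\sigma\cdot N$, $\sigma$ in the chiral Lie algebra of the punctured curve, $\sigma$ acting by the sum of its actions at all marked sections. Here $N=M^\bullet\otimes R$ for $\mathscr C_0$, $N=(M^\bullet\otimes R)[[q]]$ (written $M^\bullet[[q]]$) for $\mathscr C$, and similarly with $M^\bullet\otimes\mathfrak A$ for $\widetilde{\mathscr C}_0$, $\widetilde{\mathscr C}$, with $M^\bullet=M^1\otimes\cdots\otimes M^n$. Under the coherence hypothesis, $\mathbb V(V;(M^\bullet\otimes\mathfrak A)[[q]])_{\widetilde{\mathscr C}}$ is identified with $\mathbb V(V;M^\bullet\otimes\mathfrak A)_{\widetilde{\mathscr C}_0}[[q]]$. *)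

(* Defs.v *)
From HB Require Import structures.
From mathcomp Require Import all_boot all_order all_algebra.
From mathcomp Require Import boolp zify.
Set Implicit Arguments. Unset Strict Implicit. Unset Printing Implicit Defensive.
Import Order.TTheory GRing.Theory Num.Theory.
Local Open Scope ring_scope.

Section Quotient.
Variables (T : Type) (E : T -> T -> Prop).

Record quo := Quo { quo_class : T -> Prop; quo_ex : exists x, quo_class = E x }.

Definition qpi (x : T) : quo := Quo (ex_intro _ x erefl).
Definition qrep (q : quo) : T := projT1 (cid (quo_ex q)).

Lemma quo_inj (p q : quo) : quo_class p = quo_class q -> p = q.
Proof.
by case: p q => [P hP] [Q hQ] /= e; case: _ / e hQ => hQ; congr Quo; exact: Prop_irrelevance.
Qed.

Lemma qrepK (q : quo) : qpi (qrep q) = q.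
Proof. by apply: quo_inj => /=; rewrite -(projT2 (cid (quo_ex q))). Qed.

Hypotheses (Er : forall x, E x x) (Es : forall x y, E x y -> E y x)
  (Et : forall x y z, E x y -> E y z -> E x z).

Lemma qpi_eq x y : qpi x = qpi y <-> E x y.
Proof.
split=> [[->]|h]; first exact: Er.
apply: quo_inj => /=; apply: funext => z; apply: propext; split=> h'.
  exact: Et (Es h) h'.
exact: Et h h'.
Qed.

Lemma qrep_pi x : E (qrep (qpi x)) x.
Proof. by apply/qpi_eq; rewrite qrepK. Qed.

End Quotient.

HB.instance Definition _ (T : Type) (E : T -> T -> Prop) := gen_eqMixin (quo E).
HB.instance Definition _ (T : Type) (E : T -> T -> Prop) := gen_choiceMixin (quo E).

Inductive lexp (R X : Type) : Type :=
  | LGen of X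
  | LZero
  | LAdd of lexp R X & lexp R X
  | LOpp of lexp R X
  | LScale of R & lexp R X.
Arguments LGen {R X}. Arguments LZero {R X}.

Section PresentedModule.
Variables (R : pzRingType) (X : Type) (rel : lexp R X -> lexp R X -> Prop).

Inductive leqv : lexp R X -> lexp R X -> Prop :=
  | leqv_rel e f : rel e f -> leqv e f
  | leqv_refl e : leqv e e
  | leqv_sym e f : leqv e f -> leqv f e
  | leqv_trans e f g : leqv e f -> leqv f g -> leqv e g
  | leqv_add e e' f f' : leqv e e' -> leqv f f' -> leqv (LAdd e f) (LAdd e' f')
  | leqv_opp e e' : leqv e e' -> leqv (LOpp e) (LOpp e')
  | leqv_scale a e e' : leqv e e' -> leqv (LScale a e) (LScale a e')
  | leqv_addA e f g : leqv (LAdd e (LAdd f g)) (LAdd (LAdd e f) g)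
  | leqv_addC e f : leqv (LAdd e f) (LAdd f e)
  | leqv_add0 e : leqv (LAdd LZero e) e
  | leqv_addN e : leqv (LAdd (LOpp e) e) LZero
  | leqv_scaleA a b e : leqv (LScale a (LScale b e)) (LScale (a * b) e)
  | leqv_scale1 e : leqv (LScale 1 e) e
  | leqv_scaleDr a e f : leqv (LScale a (LAdd e f)) (LAdd (LScale a e) (LScale a f))
  | leqv_scaleDl e a b : leqv (LScale (a + b) e) (LAdd (LScale a e) (LScale b e)).

(* The R-module with generators X and relations rel. *)
Definition pmod := quo leqv.
HB.instance Definition _ := Choice.on pmod.

Definition pgen (x : X) : pmod := qpi leqv (LGen x).
Definition pmod0 : pmod := qpi leqv LZero.
Definition pmod_add (p q : pmod) : pmod := qpi leqv (LAdd (qrep p) (qrep q)).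
Definition pmod_opp (p : pmod) : pmod := qpi leqv (LOpp (qrep p)).
Definition pmod_scale (a : R) (p : pmod) : pmod := qpi leqv (LScale a (qrep p)).

Lemma pmod_eq e f : qpi leqv e = qpi leqv f <-> leqv e f.
Proof. by apply: qpi_eq; [exact: leqv_refl | exact: leqv_sym | exact: leqv_trans]. Qed.

Lemma pmod_rep e : leqv (qrep (qpi leqv e)) e.
Proof. by apply/pmod_eq; rewrite qrepK. Qed.

Lemma pmod_addE e f : pmod_add (qpi leqv e) (qpi leqv f) = qpi leqv (LAdd e f).
Proof. by apply/pmod_eq/leqv_add; exact: pmod_rep. Qed.

Lemma pmod_oppE e : pmod_opp (qpi leqv e) = qpi leqv (LOpp e).
Proof. by apply/pmod_eq/leqv_opp; exact: pmod_rep. Qed.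

Lemma pmod_scaleE a e : pmod_scale a (qpi leqv e) = qpi leqv (LScale a e).
Proof. by apply/pmod_eq/leqv_scale; exact: pmod_rep. Qed.

Lemma pmod_addA : associative pmod_add.
Proof.
move=> p q r; rewrite -(qrepK p) -(qrepK q) -(qrepK r) !pmod_addE.
by apply/pmod_eq/leqv_addA.
Qed.

Lemma pmod_addC : commutative pmod_add.
Proof. by move=> p q; apply/pmod_eq/leqv_addC. Qed.

Lemma pmod_add0 : left_id pmod0 pmod_add.
Proof. by move=> p; rewrite -(qrepK p) pmod_addE; apply/pmod_eq/leqv_add0. Qed.

Lemma pmod_addN : left_inverse pmod0 pmod_opp pmod_add.
Proof. by move=> p; rewrite -(qrepK p) pmod_oppE pmod_addE; apply/pmod_eq/leqv_addN. Qed.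

HB.instance Definition _ :=
  GRing.isZmodule.Build pmod pmod_addA pmod_addC pmod_add0 pmod_addN.

Lemma pmod_scaleA a b p : pmod_scale a (pmod_scale b p) = pmod_scale (a * b) p.
Proof. by rewrite -(qrepK p) !pmod_scaleE; apply/pmod_eq/leqv_scaleA. Qed.

Lemma pmod_scale1 : left_id 1 pmod_scale.
Proof. by move=> p; rewrite -(qrepK p) pmod_scaleE; apply/pmod_eq/leqv_scale1. Qed.

Lemma pmod_scaleDr : right_distributive pmod_scale +%R.
Proof.
move=> a p q; rewrite /+%R /= -(qrepK p) -(qrepK q) !(pmod_addE, pmod_scaleE).
by apply/pmod_eq/leqv_scaleDr.
Qed.

Lemma pmod_scaleDl p : {morph pmod_scale^~ p : a b / a + b}.
Proof.
move=> a b; rewrite [X in _ = X]/+%R /= -(qrepK p) !(pmod_addE, pmod_scaleE).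
by apply/pmod_eq/leqv_scaleDl.
Qed.

HB.instance Definition _ :=
  GRing.Zmodule_isLmodule.Build R pmod pmod_scaleA pmod_scale1 pmod_scaleDr pmod_scaleDl.

Section Lift.
Variables (Y : lmodType R) (g : X -> Y).

Fixpoint leval (e : lexp R X) : Y :=
  match e with
  | LGen x => g x
  | LZero => 0
  | LAdd e f => leval e + leval f
  | LOpp e => - leval e
  | LScale a e => a *: leval e
  end.

(* The linear map extending g, meaningful when g respects rel. *)
Definition plift (p : pmod) : Y := leval (qrep p).

Hypothesis hg : forall e f, rel e f -> leval e = leval f.

Lemma leval_leqv e f : leqv e f -> leval e = leval f.
Proof.
elim=> {e f} //=.
- by move=> e f g' _ -> _ ->.
- by move=> e e' f f' _ -> _ ->.
- by move=> e e' _ ->.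
- by move=> a e e' _ ->.
- by move=> e f g'; rewrite addrA.
- by move=> e f; rewrite addrC.
- by move=> e; rewrite add0r.
- by move=> e; rewrite addNr.
- by move=> a b e; rewrite scalerA.
- by move=> e; rewrite scale1r.
- by move=> a e f; rewrite scalerDr.
- by move=> e a b; rewrite scalerDl.
Qed.

Lemma plift_pi e : plift (qpi leqv e) = leval e.
Proof. exact/leval_leqv/pmod_rep. Qed.

Lemma plift_gen x : plift (pgen x) = g x.
Proof. exact: plift_pi. Qed.

Lemma plift_linear : linear plift.
Proof.
move=> a p q; rewrite -(qrepK p) -(qrepK q) /+%R /*:%R /=.
by rewrite pmod_scaleE pmod_addE !plift_pi.
Qed.

End Lift.
End PresentedModule.

Section QuotientModule.
Variables (R : pzRingType) (M : lmodType R) (N : M -> Prop).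

Inductive lspan : M -> Prop :=
  | lspan_in x : N x -> lspan x
  | lspan0 : lspan 0
  | lspanD x y : lspan x -> lspan y -> lspan (x + y)
  | lspanZ a x : lspan x -> lspan (a *: x).

Definition leqmod (x y : M) := lspan (x - y).

Lemma leqmod_refl x : leqmod x x.
Proof. by rewrite /leqmod subrr; exact: lspan0. Qed.

Lemma leqmod_sym x y : leqmod x y -> leqmod y x.
Proof. by move=> h; rewrite /leqmod -opprB -scaleN1r; exact: lspanZ. Qed.

Lemma leqmod_trans x y z : leqmod x y -> leqmod y z -> leqmod x z.
Proof. by move=> h h'; rewrite /leqmod -(subrKA y); exact: lspanD. Qed.

(* M modulo the submodule spanned by N. *)
Definition lquot := quo leqmod.
HB.instance Definition _ := Choice.on lquot.

Definition lcls (x : M) : lquot := qpi leqmod x.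

Lemma lcls_eq x y : lcls x = lcls y <-> lspan (x - y).
Proof. exact: (qpi_eq leqmod_refl leqmod_sym leqmod_trans). Qed.

Lemma lrep_cls x : leqmod (qrep (lcls x)) x.
Proof. by apply/lcls_eq; rewrite /lcls qrepK. Qed.

Definition lquot_add (p q : lquot) : lquot := lcls (qrep p + qrep q).
Definition lquot_opp (p : lquot) : lquot := lcls (- qrep p).
Definition lquot_scale (a : R) (p : lquot) : lquot := lcls (a *: qrep p).

Lemma lquot_addE x y : lquot_add (lcls x) (lcls y) = lcls (x + y).
Proof.
apply/lcls_eq; rewrite opprD addrACA.
by apply: lspanD; exact: lrep_cls.
Qed.

Lemma lquot_oppE x : lquot_opp (lcls x) = lcls (- x).
Proof. by apply/lcls_eq; rewrite opprK addrC; apply: leqmod_sym; exact: lrep_cls. Qed.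

Lemma lquot_scaleE a x : lquot_scale a (lcls x) = lcls (a *: x).
Proof. by apply/lcls_eq; rewrite -scalerBr; apply: lspanZ; exact: lrep_cls. Qed.

Lemma lquot_addA : associative lquot_add.
Proof.
by move=> p q r; rewrite -(qrepK p) -(qrepK q) -(qrepK r) -!/(lcls _) !lquot_addE addrA.
Qed.

Lemma lquot_addC : commutative lquot_add.
Proof. by move=> p q; rewrite /lquot_add addrC. Qed.

Lemma lquot_add0 : left_id (lcls 0) lquot_add.
Proof. by move=> p; rewrite -(qrepK p) -!/(lcls _) lquot_addE add0r. Qed.

Lemma lquot_addN : left_inverse (lcls 0) lquot_opp lquot_add.
Proof. by move=> p; rewrite -(qrepK p) -!/(lcls _) lquot_oppE lquot_addE addNr. Qed.

HB.instance Definition _ :=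
  GRing.isZmodule.Build lquot lquot_addA lquot_addC lquot_add0 lquot_addN.

Lemma lquot_scaleA a b p : lquot_scale a (lquot_scale b p) = lquot_scale (a * b) p.
Proof. by rewrite -(qrepK p) -!/(lcls _) !lquot_scaleE scalerA. Qed.

Lemma lquot_scale1 : left_id 1 lquot_scale.
Proof. by move=> p; rewrite -(qrepK p) -!/(lcls _) lquot_scaleE scale1r. Qed.

Lemma lquot_scaleDr : right_distributive lquot_scale +%R.
Proof.
move=> a p q; rewrite /+%R /= -(qrepK p) -(qrepK q) -!/(lcls _).
by rewrite !(lquot_addE, lquot_scaleE) scalerDr.
Qed.

Lemma lquot_scaleDl p : {morph lquot_scale^~ p : a b / a + b}.
Proof.
move=> a b; rewrite [X in _ = X]/+%R /= -(qrepK p) -!/(lcls _).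
by rewrite !(lquot_addE, lquot_scaleE) scalerDl.
Qed.

HB.instance Definition _ :=
  GRing.Zmodule_isLmodule.Build R lquot lquot_scaleA lquot_scale1 lquot_scaleDr lquot_scaleDl.

Lemma lcls_linear : linear lcls.
Proof. by move=> a x y; rewrite /+%R /*:%R /= lquot_scaleE lquot_addE. Qed.

End QuotientModule.

Inductive aexp (R X : Type) : Type :=
  | AGen of X
  | AZero
  | AOne
  | AAdd of aexp R X & aexp R X
  | AOpp of aexp R X
  | AMul of aexp R X & aexp R X
  | AScale of R & aexp R X.
Arguments AGen {R X}. Arguments AZero {R X}. Arguments AOne {R X}.

Section PresentedAlgebra.
Variables (R : comPzRingType) (X : Type) (rel : aexp R X -> aexp R X -> Prop).

Inductive aeqv : aexp R X -> aexp R X -> Prop :=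
  | aeqv_rel e f : rel e f -> aeqv e f
  | aeqv_refl e : aeqv e e
  | aeqv_sym e f : aeqv e f -> aeqv f e
  | aeqv_trans e f g : aeqv e f -> aeqv f g -> aeqv e g
  | aeqv_add e e' f f' : aeqv e e' -> aeqv f f' -> aeqv (AAdd e f) (AAdd e' f')
  | aeqv_opp e e' : aeqv e e' -> aeqv (AOpp e) (AOpp e')
  | aeqv_mul e e' f f' : aeqv e e' -> aeqv f f' -> aeqv (AMul e f) (AMul e' f')
  | aeqv_scale a e e' : aeqv e e' -> aeqv (AScale a e) (AScale a e')
  | aeqv_addA e f g : aeqv (AAdd e (AAdd f g)) (AAdd (AAdd e f) g)
  | aeqv_addC e f : aeqv (AAdd e f) (AAdd f e)
  | aeqv_add0 e : aeqv (AAdd AZero e) e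
  | aeqv_addN e : aeqv (AAdd (AOpp e) e) AZero
  | aeqv_mulA e f g : aeqv (AMul e (AMul f g)) (AMul (AMul e f) g)
  | aeqv_mul1e e : aeqv (AMul AOne e) e
  | aeqv_mule1 e : aeqv (AMul e AOne) e
  | aeqv_mulDl e f g : aeqv (AMul (AAdd e f) g) (AAdd (AMul e g) (AMul f g))
  | aeqv_mulDr e f g : aeqv (AMul e (AAdd f g)) (AAdd (AMul e f) (AMul e g))
  | aeqv_scaleA a b e : aeqv (AScale a (AScale b e)) (AScale (a * b) e)
  | aeqv_scale1 e : aeqv (AScale 1 e) e
  | aeqv_scaleDr a e f : aeqv (AScale a (AAdd e f)) (AAdd (AScale a e) (AScale a f))
  | aeqv_scaleDl e a b : aeqv (AScale (a + b) e) (AAdd (AScale a e) (AScale b e))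
  | aeqv_scaleAl a e f : aeqv (AScale a (AMul e f)) (AMul (AScale a e) f)
  | aeqv_scaleAr a e f : aeqv (AScale a (AMul e f)) (AMul e (AScale a f)).

(* The associative unital R-algebra with generators X and relations rel. *)
Definition palg := quo aeqv.
HB.instance Definition _ := Choice.on palg.

Definition agen (x : X) : palg := qpi aeqv (AGen x).
Definition palg_add (p q : palg) : palg := qpi aeqv (AAdd (qrep p) (qrep q)).
Definition palg_opp (p : palg) : palg := qpi aeqv (AOpp (qrep p)).
Definition palg_mul (p q : palg) : palg := qpi aeqv (AMul (qrep p) (qrep q)).
Definition palg_scale (a : R) (p : palg) : palg := qpi aeqv (AScale a (qrep p)).

Lemma palg_eq e f : qpi aeqv e = qpi aeqv f <-> aeqv e f.
Proof. by apply: qpi_eq; [exact: aeqv_refl | exact: aeqv_sym | exact: aeqv_trans]. Qed.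

Lemma palg_rep e : aeqv (qrep (qpi aeqv e)) e.
Proof. by apply/palg_eq; rewrite qrepK. Qed.

Lemma palg_addE e f : palg_add (qpi aeqv e) (qpi aeqv f) = qpi aeqv (AAdd e f).
Proof. by apply/palg_eq/aeqv_add; exact: palg_rep. Qed.

Lemma palg_oppE e : palg_opp (qpi aeqv e) = qpi aeqv (AOpp e).
Proof. by apply/palg_eq/aeqv_opp; exact: palg_rep. Qed.

Lemma palg_mulE e f : palg_mul (qpi aeqv e) (qpi aeqv f) = qpi aeqv (AMul e f).
Proof. by apply/palg_eq/aeqv_mul; exact: palg_rep. Qed.

Lemma palg_scaleE a e : palg_scale a (qpi aeqv e) = qpi aeqv (AScale a e).
Proof. by apply/palg_eq/aeqv_scale; exact: palg_rep. Qed.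

Lemma palg_addA : associative palg_add.
Proof.
move=> p q r; rewrite -(qrepK p) -(qrepK q) -(qrepK r) !palg_addE.
by apply/palg_eq/aeqv_addA.
Qed.

Lemma palg_addC : commutative palg_add.
Proof. by move=> p q; apply/palg_eq/aeqv_addC. Qed.

Lemma palg_add0 : left_id (qpi aeqv AZero) palg_add.
Proof. by move=> p; rewrite -(qrepK p) palg_addE; apply/palg_eq/aeqv_add0. Qed.

Lemma palg_addN : left_inverse (qpi aeqv AZero) palg_opp palg_add.
Proof. by move=> p; rewrite -(qrepK p) palg_oppE palg_addE; apply/palg_eq/aeqv_addN. Qed.

HB.instance Definition _ :=
  GRing.isZmodule.Build palg palg_addA palg_addC palg_add0 palg_addN.

Lemma palg_mulA : associative palg_mul.
Proof.
move=> p q r; rewrite -(qrepK p) -(qrepK q) -(qrepK r) !palg_mulE.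
by apply/palg_eq/aeqv_mulA.
Qed.

Lemma palg_mul1 : left_id (qpi aeqv AOne) palg_mul.
Proof. by move=> p; rewrite -(qrepK p) palg_mulE; apply/palg_eq/aeqv_mul1e. Qed.

Lemma palg_mulr1 : right_id (qpi aeqv AOne) palg_mul.
Proof. by move=> p; rewrite -(qrepK p) palg_mulE; apply/palg_eq/aeqv_mule1. Qed.

Lemma palg_mulDl : left_distributive palg_mul +%R.
Proof.
move=> p q r; rewrite /+%R /= -(qrepK p) -(qrepK q) -(qrepK r) !(palg_mulE, palg_addE).
by apply/palg_eq/aeqv_mulDl.
Qed.

Lemma palg_mulDr : right_distributive palg_mul +%R.
Proof.
move=> p q r; rewrite /+%R /= -(qrepK p) -(qrepK q) -(qrepK r) !(palg_mulE, palg_addE).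
by apply/palg_eq/aeqv_mulDr.
Qed.

HB.instance Definition _ := GRing.Zmodule_isPzRing.Build palg
  palg_mulA palg_mul1 palg_mulr1 palg_mulDl palg_mulDr.

Lemma palg_scaleA a b p : palg_scale a (palg_scale b p) = palg_scale (a * b) p.
Proof. by rewrite -(qrepK p) !palg_scaleE; apply/palg_eq/aeqv_scaleA. Qed.

Lemma palg_scale1 : left_id 1 palg_scale.
Proof. by move=> p; rewrite -(qrepK p) palg_scaleE; apply/palg_eq/aeqv_scale1. Qed.

Lemma palg_scaleDr : right_distributive palg_scale +%R.
Proof.
move=> a p q; rewrite /+%R /= -(qrepK p) -(qrepK q) !(palg_addE, palg_scaleE).
by apply/palg_eq/aeqv_scaleDr.
Qed.

Lemma palg_scaleDl p : {morph palg_scale^~ p : a b / a + b}.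
Proof.
move=> a b; rewrite [X in _ = X]/+%R /= -(qrepK p) !(palg_addE, palg_scaleE).
by apply/palg_eq/aeqv_scaleDl.
Qed.

HB.instance Definition _ :=
  GRing.Zmodule_isLmodule.Build R palg palg_scaleA palg_scale1 palg_scaleDr palg_scaleDl.

Lemma palg_scaleAl a (p q : palg) : a *: (p * q) = (a *: p) * q.
Proof.
rewrite -(qrepK p) -(qrepK q) /*:%R /*%R /= !(palg_mulE, palg_scaleE).
by apply/palg_eq/aeqv_scaleAl.
Qed.

Lemma palg_scaleAr a (p q : palg) : a *: (p * q) = p * (a *: q).
Proof.
rewrite -(qrepK p) -(qrepK q) /*:%R /*%R /= !(palg_mulE, palg_scaleE).
by apply/palg_eq/aeqv_scaleAr.
Qed.

End PresentedAlgebra.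

Definition fps (A : Type) := nat -> A.
HB.instance Definition _ (A : Type) := gen_eqMixin (fps A).
HB.instance Definition _ (A : Type) := gen_choiceMixin (fps A).

Section SeriesZmod.
Variable N : zmodType.
Implicit Types u v w : fps N.

Definition fps_zero : fps N := fun _ => 0.
Definition fps_opp u : fps N := fun n => - u n.
Definition fps_add u v : fps N := fun n => u n + v n.

Lemma fps_addA : associative fps_add.
Proof. by move=> u v w; apply: funext => n; exact: addrA. Qed.
Lemma fps_addC : commutative fps_add.
Proof. by move=> u v; apply: funext => n; exact: addrC. Qed.
Lemma fps_add0 : left_id fps_zero fps_add.
Proof. by move=> u; apply: funext => n; exact: add0r. Qed.
Lemma fps_addN : left_inverse fps_zero fps_opp fps_add.
Proof. by move=> u; apply: funext => n; exact: addNr. Qed.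

HB.instance Definition _ :=
  GRing.isZmodule.Build (fps N) fps_addA fps_addC fps_add0 fps_addN.

End SeriesZmod.

Definition conv (A : pzRingType) (N : lmodType A) (f : fps A) (u : fps N) : fps N :=
  fun n => \sum_(i < n.+1) f i *: u (n - i)%N.

Lemma conv_rev (A : pzRingType) (N : lmodType A) (f : fps A) (u : fps N) n :
  conv f u n = \sum_(k < n.+1) f (n - k)%N *: u k.
Proof.
rewrite /conv (reindex_inj rev_ord_inj) /=.
by apply: eq_bigr => i _; rewrite subSS subKn // -ltnS.
Qed.

Lemma convA (A : pzRingType) (N : lmodType A) (f g : fps A) (u : fps N) :
  conv f (conv g u) = conv (conv f (g : fps A^o) : fps A) u.
Proof.
apply: funext => n; rewrite [RHS]conv_rev.
pose c j k := f j *: (g (n - j - k)%N *: u k).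
transitivity (\sum_(j < n.+1) \sum_(k < n.+1 | (k <= n - j)%N) c j k).
  apply: eq_bigr => /= j _; rewrite conv_rev scaler_sumr.
  by rewrite (big_ord_narrow_leq (leq_subr _ _)).
rewrite (exchange_big_dep predT) //=; apply: eq_bigr => k _.
transitivity (\sum_(j < n.+1 | (j <= n - k)%N) c j k).
  apply: eq_bigl => j; rewrite -ltnS -(ltnS j) -!subSn ?leq_ord //.
  by rewrite -subn_gt0 -(subn_gt0 j) -!subnDA addnC.
rewrite (big_ord_narrow_leq (leq_subr _ _)) /conv scaler_suml.
by apply: eq_bigr => j _; rewrite /c -!subnDA addnC scalerA.
Qed.

Section SeriesRing.
Variable A : comPzRingType.
Implicit Types f g h : fps A.

Definition fps_one : fps A := fun n => (n == 0)%:R.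
Definition fps_mul f g : fps A := fun n => \sum_(i < n.+1) f i * g (n - i)%N.

Lemma fps_mulA : associative fps_mul.
Proof. by move=> f g h; exact: (@convA A A^o). Qed.

Lemma fps_mulC : commutative fps_mul.
Proof.
move=> f g; apply: funext => n; rewrite /fps_mul (reindex_inj rev_ord_inj) /=.
by apply: eq_bigr => i _; rewrite subSS mulrC subKn // -ltnS.
Qed.

Lemma conv1 (N : lmodType A) (u : fps N) : conv fps_one u = u.
Proof.
apply: funext => n; rewrite /conv big_ord_recl /= subn0 scale1r big1 ?addr0 //.
by move=> i _; rewrite scale0r.
Qed.

Lemma fps_mul1 : left_id fps_one fps_mul.
Proof. by move=> f; exact: (@conv1 A^o). Qed.

Lemma fps_mulDl : left_distributive fps_mul +%R.
Proof.
move=> f g h; apply: funext => n.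
rewrite -[RHS]/(fps_mul f h n + fps_mul g h n) /fps_mul -big_split.
by apply: eq_bigr => i _; exact: mulrDl.
Qed.

HB.instance Definition _ := GRing.Zmodule_isComPzRing.Build (fps A)
  fps_mulA fps_mulC fps_mul1 fps_mulDl.

Lemma fps_mulE f g n : (f * g) n = \sum_(i < n.+1) f i * g (n - i)%N.
Proof. by []. Qed.

Definition fps_const (a : A) : fps A := fun n => if n == 0 then a else 0.

Lemma fps_const_zmod : zmod_morphism fps_const.
Proof. by move=> a b; apply: funext => -[|n] //; exact: esym (subr0 0). Qed.

Lemma fps_const_monoid : monoid_morphism fps_const.
Proof.
split; first by apply: funext => -[|n].
move=> a b; apply: funext => -[|n]; rewrite fps_mulE big_ord_recl /fps_const /=.
  by rewrite big_ord0 addr0.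
by rewrite mulr0 add0r big1 // => i _; rewrite mul0r.
Qed.

HB.instance Definition _ := GRing.isZmodMorphism.Build A (fps A) fps_const fps_const_zmod.
HB.instance Definition _ := GRing.isMonoidMorphism.Build A (fps A) fps_const fps_const_monoid.

Definition fps_at0 (f : fps A) : A := f 0%N.

Lemma fps_at0_zmod : zmod_morphism fps_at0. Proof. by []. Qed.

Lemma fps_at0_monoid : monoid_morphism fps_at0.
Proof. by split=> // f g; rewrite /fps_at0 fps_mulE big_ord_recl big_ord0 addr0. Qed.

HB.instance Definition _ := GRing.isZmodMorphism.Build (fps A) A fps_at0 fps_at0_zmod.
HB.instance Definition _ := GRing.isMonoidMorphism.Build (fps A) A fps_at0 fps_at0_monoid.

Definition fps_Xn (k : nat) : fps A := fun n => (n == k)%:R.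

Lemma fps_XnE k f n : (fps_Xn k * f) n = if (n < k)%N then 0 else f (n - k)%N.
Proof.
rewrite fps_mulE; case: ltnP => h.
  rewrite big1 // => i _; rewrite /fps_Xn (_ : (i == k :> nat) = false) ?mul0r //.
  by apply/eqP => e; move: (ltn_ord i); rewrite e ltnS leqNgt h.
rewrite (bigD1 (Ordinal (h : k < n.+1)%N)) //= /fps_Xn eqxx mul1r big1 ?addr0 // => i.
by rewrite -val_eqE /= => /negbTE ->; rewrite mul0r.
Qed.

Lemma fps_XnD k l : fps_Xn k * fps_Xn l = fps_Xn (k + l).
Proof.
apply: funext => n; rewrite fps_XnE; case: ltnP => h; rewrite /fps_Xn.
  by rewrite (_ : (n == (k + l)%N) = false) //; apply/eqP => e; move: h; rewrite e ltnNge leq_addr.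
by congr (_%:R); congr nat_of_bool; rewrite -(eqn_add2l k) subnKC.
Qed.

Lemma fps_Xn_inj k : injective ( *%R (fps_Xn k)).
Proof.
move=> f g e; apply: funext => n; move/(congr1 (fun h : fps A => h (n + k)%N)): e.
by rewrite !fps_XnE ltnNge leq_addl /= addnK.
Qed.

End SeriesRing.

Section SeriesModule.
Variables (A : comPzRingType) (N : lmodType A).

(* N[[q]] as an A[[q]]-module; the two letters share the carrier nat -> N. *)
Definition qser := fps N.
HB.instance Definition _ := GRing.Zmodule.on qser.

Definition qser_scale (f : fps A) (u : qser) : qser := conv f u.

Lemma qser_scaleA f g u : qser_scale f (qser_scale g u) = qser_scale (f * g) u.
Proof. exact: convA. Qed.

Lemma qser_scale1 : left_id 1 qser_scale.
Proof. by move=> u; exact: conv1. Qed.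

Lemma qser_scaleDr : right_distributive qser_scale +%R.
Proof.
move=> a u v; apply: funext => n.
rewrite -[RHS]/(conv a u n + conv a v n) /qser_scale /conv -big_split.
by apply: eq_bigr => i _; exact: scalerDr.
Qed.

Lemma qser_scaleDl u : {morph qser_scale^~ u : f g / f + g}.
Proof.
move=> f g; apply: funext => n.
rewrite -[RHS]/(conv f u n + conv g u n) /qser_scale /conv -big_split.
by apply: eq_bigr => i _; exact: scalerDl.
Qed.

HB.instance Definition _ := GRing.Zmodule_isLmodule.Build (fps A) qser
  qser_scaleA qser_scale1 qser_scaleDr qser_scaleDl.

End SeriesModule.

(* binom(n, j) for an integer n. *)
Definition binz (n : int) (j : nat) : int :=
  match n with
  | Posz m => Posz 'C(m, j)
  | Negz m => (-1) ^+ j * Posz 'C(m + j, j)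
  end.

Section Laurent.
Variable A : comPzRingType.

Record laur := Laur {
  lcoef :> int -> A;
  lbounded : exists N : nat, forall n : int, n < - N%:Z -> lcoef n = 0 }.

HB.instance Definition _ := gen_eqMixin laur.
HB.instance Definition _ := gen_choiceMixin laur.

Lemma laurP (f g : laur) : lcoef f =1 lcoef g -> f = g.
Proof.
case: f g => [f hf] [g hg] /= /funext e; case: _ / e hg => hg.
by congr Laur; exact: Prop_irrelevance.
Qed.

Definition lfrom_coef (N : nat) (F : fps A) (n : int) : A :=
  match n + N%:Z with Posz m => F m | Negz _ => 0 end.

Lemma lfrom_bounded N F : exists N0 : nat, forall n : int, n < - N0%:Z -> lfrom_coef N F n = 0.
Proof.
exists N => n h; rewrite /lfrom_coef.
by case e : (n + _) => [m|m] //; lia.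
Qed.

(* s^-N * F(s) *)
Definition lfrom (N : nat) (F : fps A) : laur := Laur (lfrom_bounded N F).

Definition lbnd (f : laur) : nat := projT1 (cid (lbounded f)).
Definition lshift (f : laur) (N : nat) : fps A := fun i => f (i%:Z - N%:Z).

Lemma lshiftK (f : laur) N : (lbnd f <= N)%N -> lfrom N (lshift f N) = f.
Proof.
move=> le; apply: laurP => n; rewrite /= /lfrom_coef /lshift.
have := projT2 (cid (lbounded f)); rewrite -/(lbnd f) => h.
case e : (n + _) => [m|m]; first by rewrite -e addrK.
by rewrite h //; lia.
Qed.

Lemma lfrom_shift N F k : lfrom (N + k) (fps_Xn A k * F) = lfrom N F.
Proof.
apply: laurP => n; rewrite /= /lfrom_coef.
case e1 : (n + (N + k)%N%:Z) => [m|m]; case e2 : (n + N%:Z) => [m'|m'] //.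
- by rewrite fps_XnE; case: ltnP => h; [lia | congr F; lia].
- by rewrite fps_XnE; case: ltnP => h //; lia.
- by exfalso; lia.
Qed.

Lemma lfrom_inj N : injective (lfrom N).
Proof.
move=> F G e; apply: funext => n; move: (congr1 (fun f : laur => f (n%:Z - N%:Z)) e).
by rewrite /= /lfrom_coef subrK.
Qed.

Definition laur_mul (f g : laur) : laur :=
  lfrom (lbnd f + lbnd g) (lshift f (lbnd f) * lshift g (lbnd g)).

Lemma laur_mulE N M F G : laur_mul (lfrom N F) (lfrom M G) = lfrom (N + M) (F * G).
Proof.
rewrite /laur_mul; set f := lfrom N F; set g := lfrom M G.
have ef := lshiftK (leqnn (lbnd f)); have eg := lshiftK (leqnn (lbnd g)).
move: (lbnd f) (lshift f _) ef => n F' ef; move: (lbnd g) (lshift g _) eg => m G' eg.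
have hF : fps_Xn A N * F' = fps_Xn A n * F.
  by apply: (@lfrom_inj (n + N)); rewrite lfrom_shift addnC lfrom_shift.
have hG : fps_Xn A M * G' = fps_Xn A m * G.
  by apply: (@lfrom_inj (m + M)); rewrite lfrom_shift addnC lfrom_shift.
rewrite -(lfrom_shift (n + m) _ (N + M)) -(lfrom_shift (N + M) _ (n + m)) addnC; congr lfrom.
by rewrite -!fps_XnD mulrACA hF hG mulrACA.
Qed.

Lemma laur_bound2 (f g : laur) : exists N F G, f = lfrom N F /\ g = lfrom N G.
Proof.
exists (maxn (lbnd f) (lbnd g)), (lshift f (maxn (lbnd f) (lbnd g))),
  (lshift g (maxn (lbnd f) (lbnd g))).
by rewrite !lshiftK ?leq_maxl ?leq_maxr.
Qed.

Lemma laur_add_bounded (f g : laur) :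
  exists N : nat, forall n : int, n < - N%:Z -> f n + g n = 0.
Proof.
have [N [F [G [-> ->]]]] := laur_bound2 f g; exists N => n h /=; rewrite /lfrom_coef.
by case e : (n + _) => [m|m]; [lia | rewrite addr0].
Qed.

Lemma laur_opp_bounded (f : laur) : exists N : nat, forall n : int, n < - N%:Z -> - f n = 0.
Proof. by case: (lbounded f) => N h; exists N => n /h ->; rewrite oppr0. Qed.

Definition laur_add (f g : laur) : laur := Laur (laur_add_bounded f g).
Definition laur_opp (f : laur) : laur := Laur (laur_opp_bounded f).
Definition laur_zero : laur := lfrom 0 0.
Definition laur_one : laur := lfrom 0 1.

Lemma laur_addA : associative laur_add.
Proof. by move=> f g h; apply: laurP => n; exact: addrA. Qed.
Lemma laur_addC : commutative laur_add.
Proof. by move=> f g; apply: laurP => n; exact: addrC. Qed.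
Lemma laur_add0 : left_id laur_zero laur_add.
Proof.
move=> f; apply: laurP => n; rewrite /= /lfrom_coef.
by case: (n + _) => m; rewrite add0r.
Qed.
Lemma laur_addN : left_inverse laur_zero laur_opp laur_add.
Proof.
move=> f; apply: laurP => n; rewrite /= /lfrom_coef addNr.
by case: (n + _).
Qed.

HB.instance Definition _ :=
  GRing.isZmodule.Build laur laur_addA laur_addC laur_add0 laur_addN.

Lemma lfromD N F G : lfrom N (F + G) = lfrom N F + lfrom N G.
Proof.
apply: laurP => n; rewrite /= /lfrom_coef.
by case: (n + _) => // m; rewrite addr0.
Qed.

Lemma laur_rep (f : laur) : exists N F, f = lfrom N F.
Proof. by exists (lbnd f), (lshift f (lbnd f)); rewrite lshiftK. Qed.

Lemma laur_mulA : associative laur_mul.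
Proof.
move=> f g h; have [N [F ->]] := laur_rep f; have [M [G ->]] := laur_rep g.
by have [K [H ->]] := laur_rep h; rewrite !laur_mulE addnA mulrA.
Qed.

Lemma laur_mulC : commutative laur_mul.
Proof.
move=> f g; have [N [F ->]] := laur_rep f; have [M [G ->]] := laur_rep g.
by rewrite !laur_mulE addnC mulrC.
Qed.

Lemma laur_mul1 : left_id laur_one laur_mul.
Proof. by move=> f; have [N [F ->]] := laur_rep f; rewrite laur_mulE mul1r. Qed.

Lemma laur_mulDl : left_distributive laur_mul +%R.
Proof.
move=> f g h; have [N [F [G [-> ->]]]] := laur_bound2 f g.
by have [M [H ->]] := laur_rep h; rewrite -lfromD !laur_mulE -lfromD mulrDl.
Qed.

HB.instance Definition _ := GRing.Zmodule_isComPzRing.Build laur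
  laur_mulA laur_mulC laur_mul1 laur_mulDl.

Definition laur_of (F : fps A) : laur := lfrom 0 F.

Lemma laur_of_zmod : zmod_morphism laur_of.
Proof.
move=> F G; apply: laurP => n; rewrite /= /lfrom_coef.
by case: (n + _) => // m; rewrite subr0.
Qed.

Lemma laur_of_monoid : monoid_morphism laur_of.
Proof. by split=> // F G; rewrite /laur_of [RHS]laur_mulE. Qed.

HB.instance Definition _ := GRing.isZmodMorphism.Build (fps A) laur laur_of laur_of_zmod.
HB.instance Definition _ := GRing.isMonoidMorphism.Build (fps A) laur laur_of laur_of_monoid.

Lemma lhasse_bounded (k : nat) (f : laur) : exists N : nat, forall n : int,
  n < - N%:Z -> f (n + k%:Z) *~ binz (n + k%:Z) k = 0.
Proof.
case: (lbounded f) => N h; exists (N + k)%N => n hn.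
by rewrite h ?mul0rz //; lia.
Qed.

(* The divided derivative of order k. *)
Definition lhasse (k : nat) (f : laur) : laur := Laur (lhasse_bounded k f).
Definition fhasse (k : nat) (F : fps A) : fps A := fun n => F (n + k)%N *+ 'C(n + k, k).

Lemma lmono_bounded (e : int) (F : fps A) : exists N : nat, forall n : int,
  n < - N%:Z -> (if n - e is Posz m then F m else 0) = 0.
Proof. by exists `|e|%N => n h; case e1 : (n - e) => [m|m] //; lia. Qed.

(* s^e * F(s) *)
Definition lmono (e : int) (F : fps A) : laur := Laur (lmono_bounded e F).

End Laurent.

Record calg (A : comPzRingType) := CAlg {
  calg_ring :> comPzRingType;
  calg_str : {rmorphism A -> calg_ring} }.

Record ahom (A : comPzRingType) (B C : calg A) := AHom {
  ahom_fun :> {rmorphism B -> C};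
  ahom_str : forall a, ahom_fun (calg_str B a) = calg_str C a }.

Definition calg_id (A : comPzRingType) : calg A := CAlg (idfun : {rmorphism A -> A}).
Definition calg_fps (A : comPzRingType) : calg A :=
  CAlg (@fps_const A : {rmorphism A -> fps A}).
Definition calg_laur (A : comPzRingType) : calg A :=
  CAlg (@laur_of A \o @fps_const A : {rmorphism A -> laur A}).
(* Restriction of scalars along the structure map of R. *)
Definition calg_res (k : comPzRingType) (R : calg k) (B : calg R) : calg k :=
  CAlg (calg_str B \o calg_str R : {rmorphism k -> B}).
(* An A-algebra seen as an A[[q]]-algebra via q |-> 0. *)
Definition calg_q0 (A : comPzRingType) (B : calg A) : calg (fps A) :=
  CAlg (calg_str B \o @fps_at0 A : {rmorphism fps A -> B}).

Definition str_hom (A : comPzRingType) (B : calg A) : ahom (calg_id A) B :=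
  @AHom A (calg_id A) B (calg_str B) (fun _ => erefl).
Definition id_hom (A : comPzRingType) (B : calg A) : ahom B B :=
  @AHom A B B (idfun : {rmorphism B -> B}) (fun _ => erefl).
Lemma q0_hom_str (A : comPzRingType) (B C : calg A) (f : ahom B C) :
  forall a, f (calg_str (calg_q0 B) a) = calg_str (calg_q0 C) a.
Proof. by move=> a; exact: ahom_str. Qed.
Definition q0_hom (A : comPzRingType) (B C : calg A) (f : ahom B C) :
  ahom (calg_q0 B) (calg_q0 C) :=
  @AHom _ (calg_q0 B) (calg_q0 C) f (q0_hom_str f).

Section BaseChange.
Variables (A : comPzRingType) (V : lmodType A) (B : calg A).

Inductive bc_rel : lexp B V -> lexp B V -> Prop :=
  | bc_relD x y : bc_rel (LGen (x + y)) (LAdd (LGen x) (LGen y))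
  | bc_relZ a x : bc_rel (LGen (a *: x)) (LScale (calg_str B a) (LGen x)).

(* The B-module V (x)_A B, with pure tensors bc_pure v = v (x) 1. *)
Definition bc := pmod bc_rel.
HB.instance Definition _ := GRing.Lmodule.on bc.
Definition bc_pure (v : V) : bc := pgen bc_rel v.
Definition bc_sum (l : seq (B * V)) : bc := \sum_(x <- l) x.1 *: bc_pure x.2.

(* B-(bi)linear extensions of A-(bi)linear operations on V. *)
Definition bc_map (f : V -> V) : bc -> bc := @plift _ _ bc_rel bc (fun v => bc_pure (f v)).
Definition bc_map2 (f : V -> V -> V) (x y : bc) : bc :=
  @plift _ _ bc_rel bc (fun v => bc_map (f v) y) x.

Lemma bc_pureP a x y : bc_pure (a *: x + y) = calg_str B a *: bc_pure x + bc_pure y.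
Proof.
have h z : bc_pure (a *: z) = calg_str B a *: bc_pure z.
  by rewrite [RHS]pmod_scaleE; apply/pmod_eq/leqv_rel; exact: bc_relZ.
by rewrite -h [RHS]pmod_addE; apply/pmod_eq/leqv_rel; exact: bc_relD.
Qed.

Lemma bc_lift_compat (Y : lmodType B) (g : V -> Y) :
  (forall a x y, g (a *: x + y) = calg_str B a *: g x + g y) ->
  forall e f, bc_rel e f -> leval g e = leval g f.
Proof.
move=> hg; have hD x y : g (x + y) = g x + g y.
  by rewrite -{1}[x]scale1r hg rmorph1 scale1r.
have g0 : g 0 = 0 by apply: (addrI (g 0)); rewrite -hD !addr0.
by move=> e f [x y|a x] //=; rewrite -[a *: x]addr0 hg g0 addr0.
Qed.

Lemma bc_mapE (f : V -> V) v : linear f -> bc_map f (bc_pure v) = bc_pure (f v).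
Proof.
move=> hf; rewrite /bc_map plift_gen //; apply: bc_lift_compat => a x y.
by rewrite hf bc_pureP.
Qed.

Lemma bc_map_linear (f : V -> V) : linear f -> linear (bc_map f).
Proof.
move=> hf; apply: plift_linear; apply: bc_lift_compat => a x y.
by rewrite hf bc_pureP.
Qed.

Lemma bc_map2E (f : V -> V -> V) v w : (forall x, linear (f x)) -> (forall y, linear (f^~ y)) ->
  bc_map2 f (bc_pure v) (bc_pure w) = bc_pure (f v w).
Proof.
move=> hr hl; rewrite /bc_map2 plift_gen ?bc_mapE //; apply: bc_lift_compat => a x y.
have hE e : bc_map (f (a *: x + y)) (qpi _ e) =
    calg_str B a *: bc_map (f x) (qpi _ e) + bc_map (f y) (qpi _ e).
  have hc z := bc_lift_compat (fun c u u' => etrans (congr1 bc_pure (hr z c u u'))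
                                                    (bc_pureP c (f z u) (f z u'))).
  rewrite /bc_map !plift_pi; [|exact: hc..].
  elim: e => /= [z||e -> e' ->|e ->|c e ->].
  - by rewrite (hl z) bc_pureP.
  - by rewrite scaler0 addr0.
  - by rewrite scalerDr addrACA.
  - by rewrite opprD scalerN.
  - by rewrite scalerDr !scalerA mulrC.
by rewrite -(qrepK (bc_pure w)) hE.
Qed.

End BaseChange.

Section Tensor.
Variables (k : comPzRingType) (B : calg k) (I : eqType) (M : I -> lmodType k).

Inductive tens_rel : lexp B (forall i, M i) -> lexp B (forall i, M i) -> Prop :=
  | tens_relD w i (x y : M i) : tens_rel (LGen (dfwith w (x + y)))
      (LAdd (LGen (dfwith w x)) (LGen (dfwith w y)))
  | tens_relZ w i a (x : M i) : tens_rel (LGen (dfwith w (a *: x)))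
      (LScale (calg_str B a) (LGen (dfwith w x))).

(* The B-module (\bigotimes_{i : I} M i) (x)_k B. *)
Definition tens := pmod tens_rel.
HB.instance Definition _ := GRing.Lmodule.on tens.
Definition tens_pure (w : forall i, M i) : tens := pgen tens_rel w.

(* The B-linear extension of an endomorphism of the factor i. *)
Definition tens_at (i : I) (f : M i -> M i) : tens -> tens :=
  @plift _ _ tens_rel tens (fun w => tens_pure (dfwith w (f (w i)))).

Lemma dfwith_dfwith (w : forall i, M i) i (x y : M i) : dfwith (dfwith w x) y = dfwith w y.
Proof.
apply: functional_extensionality_dep => j.
by have [e|/eqP ne] := eqVneq i j; [case: j / e; rewrite !dfwith_in | rewrite !dfwith_out //; apply/eqP].
Qed.

Lemma dfwithC (w : forall i, M i) i j (x : M i) (y : M j) : i != j ->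
  dfwith (dfwith w x) y = dfwith (dfwith w y) x.
Proof.
move=> ne; apply: functional_extensionality_dep => l.
have [e|nj] := eqVneq j l.
  by case: l / e; rewrite dfwith_in dfwith_out // dfwith_in.
have [e|ni] := eqVneq i l; last by rewrite !dfwith_out.
by case: l / e nj => nj; rewrite dfwith_out // !dfwith_in.
Qed.

Lemma tens_pureP w i a (x y : M i) : tens_pure (dfwith w (a *: x + y)) =
  calg_str B a *: tens_pure (dfwith w x) + tens_pure (dfwith w y).
Proof.
have h : tens_pure (dfwith w (a *: x)) = calg_str B a *: tens_pure (dfwith w x).
  by rewrite [RHS]pmod_scaleE; apply/pmod_eq/leqv_rel; exact: tens_relZ.
by rewrite -h [RHS]pmod_addE; apply/pmod_eq/leqv_rel; exact: tens_relD.
Qed.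

Lemma tens_lift_compat (Y : lmodType B) (g : (forall i, M i) -> Y) :
  (forall w i a (x y : M i), g (dfwith w (a *: x + y)) =
     calg_str B a *: g (dfwith w x) + g (dfwith w y)) ->
  forall e f, tens_rel e f -> leval g e = leval g f.
Proof.
move=> hg; have hD w i (x y : M i) : g (dfwith w (x + y)) = g (dfwith w x) + g (dfwith w y).
  by rewrite -{1}[x]scale1r hg rmorph1 scale1r.
have g0 w i : g (dfwith w (0 : M i)) = 0.
  by apply: (addrI (g (dfwith w (0 : M i)))); rewrite -hD !addr0.
by move=> e f [w i x y|w i a x] //=; rewrite -[a *: x]addr0 hg g0 addr0.
Qed.

Lemma tens_at_compat i (f : M i -> M i) : linear f ->
  forall w j a (x y : M j), let g w := tens_pure (dfwith w (f (w i))) in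
  g (dfwith w (a *: x + y)) = calg_str B a *: g (dfwith w x) + g (dfwith w y).
Proof.
move=> hf w j a x y /=; have [e|ne] := eqVneq i j.
  by case: j / e x y => x y; rewrite !dfwith_in !dfwith_dfwith hf tens_pureP.
have hj (z : M j) : tens_pure (dfwith (dfwith w z) (f (dfwith w z i))) =
    tens_pure (dfwith (dfwith w (f (w i))) z).
  by rewrite [dfwith w z i]dfwith_out 1?eq_sym // dfwithC 1?eq_sym.
by rewrite !hj tens_pureP.
Qed.

Lemma tens_atE i (f : M i -> M i) w : linear f ->
  tens_at f (tens_pure w) = tens_pure (dfwith w (f (w i))).
Proof. by move=> hf; apply: plift_gen; apply: tens_lift_compat; exact: tens_at_compat. Qed.

Lemma tens_at_linear i (f : M i -> M i) : linear f -> linear (tens_at f).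
Proof. by move=> hf; apply: plift_linear; apply: tens_lift_compat; exact: tens_at_compat. Qed.

End Tensor.

(* N is a finitely generated module whose finite families have finitely generated
   modules of relations. *)
Definition coherent (A : comPzRingType) (N : lmodType A) : Prop :=
  (exists n (g : 'I_n -> N), forall x, exists c : 'I_n -> A, x = \sum_i c i *: g i) /\
  (forall n (g : 'I_n -> N), exists m (r : 'I_m -> 'I_n -> A),
     (forall j, \sum_i r j i *: g i = 0) /\
     (forall c : 'I_n -> A, \sum_i c i *: g i = 0 ->
        exists d : 'I_m -> A, forall i, c i = \sum_j d j * r j i)).

(* The series \sum_j f j has finitely many nonzero terms and its sum is y. *)
Definition fin_sum (N : zmodType) (f : nat -> N) (y : N) : Prop :=
  exists J0, (forall j, (J0 <= j)%N -> f j = 0) /\ \sum_(j < J0) f j = y.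

Definition sgz_pow (n : int) : int := (-1) ^+ `|n|%N.

Definition bilinear_modes (k : fieldType) (V W : lmodType k) (md : V -> int -> W -> W) :=
  (forall c a b n w, md (c *: a + b) n w = c *: md a n w + md b n w) /\
  (forall c a n v w, md a n (c *: v + w) = c *: md a n v + md a n w).

Definition commutator_formula (k : fieldType) (V W : lmodType k)
    (mdV : V -> int -> V -> V) (md : V -> int -> W -> W) :=
  forall a b r s w, fin_sum
    (fun j => md (mdV a j%:Z b) (r + s - j%:Z) w *~ binz r j)
    (md a r (md b s w) - md b s (md a r w)).

Definition associator_formula (k : fieldType) (V W : lmodType k)
    (mdV : V -> int -> V -> V) (md : V -> int -> W -> W) :=
  forall a b r s w, fin_sum
    (fun j => (md a (r - j%:Z) (md b (s + j%:Z) w)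
               - md b (r + s - j%:Z) (md a j%:Z w) *~ sgz_pow r) *~ ((-1) ^+ j * binz r j))
    (md (mdV a r b) s w).

(* va_md a n b is a_(n) b. *)
Record vertex_algebra (k : fieldType) (V : lmodType k) := VertexAlgebra {
  va_vac : V;
  va_md : V -> int -> V -> V;
  va_bilin : bilinear_modes va_md;
  va_trunc : forall a b, exists N : int, forall n, N <= n -> va_md a n b = 0;
  va_vacl : forall n a, va_md va_vac n a = if n == -1 then a else 0;
  va_vacr : forall a, va_md a (-1) va_vac = a;
  va_vacr0 : forall a (n : nat), va_md a n%:Z va_vac = 0;
  va_comm : commutator_formula va_md va_md;
  va_assoc : associator_formula va_md va_md }.

Record grading (k : fieldType) (V : lmodType k) (gr : nat -> V -> Prop) : Prop := Grading {
  gr0 : forall s, gr s 0;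
  grD : forall s c x y, gr s x -> gr s y -> gr s (c *: x + y);
  gr_span : forall x, exists n (c : nat -> V), (forall s, gr s (c s)) /\ x = \sum_(s < n) c s;
  gr_free : forall n (c : nat -> V), (forall s, gr s (c s)) -> \sum_(s < n) c s = 0 ->
    forall s, (s < n)%N -> c s = 0 }.

(* The homogeneous part of degree d, which is zero for d < 0. *)
Definition grz (k : fieldType) (V : lmodType k) (gr : nat -> V -> Prop) (d : int) (x : V) :=
  match d with Posz s => gr s x | Negz _ => x = 0 end.

Record graded_va (k : fieldType) (V : lmodType k) := GradedVA {
  gva :> vertex_algebra V;
  gva_gr : nat -> V -> Prop;
  gva_grading : grading gva_gr;
  gva_vac : gva_gr 0 (va_vac gva);
  gva_deg : forall s t a b n, gva_gr s a -> gva_gr t b ->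
    grz gva_gr (s%:Z + t%:Z - 1 - n) (va_md gva a n b) }.

Record adm_module (k : fieldType) (V : lmodType k) (A : graded_va V) (W : lmodType k) :=
  AdmModule {
  am_md : V -> int -> W -> W;
  am_gr : nat -> W -> Prop;
  am_bilin : bilinear_modes am_md;
  am_grading : grading am_gr;
  am_deg : forall s t a w n, gva_gr A s a -> am_gr t w ->
    grz am_gr (s%:Z + t%:Z - 1 - n) (am_md a n w);
  am_trunc : forall a w, exists N : int, forall n, N <= n -> am_md a n w = 0;
  am_vac : forall n w, am_md (va_vac A) n w = if n == -1 then w else 0;
  am_comm : commutator_formula (va_md A) am_md;
  am_assoc : associator_formula (va_md A) am_md }.

Definition va_T (k : fieldType) (V : lmodType k) (A : vertex_algebra V) (n : nat) (a : V) : V :=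
  va_md A a (-1 - n%:Z) (va_vac A).

(* A point of Aut O over B is the series rho(t) = a_1 t + a_2 t^2 + ... that is the image
   of t; f |-> f o rho is the corresponding automorphism of B[[t]]. *)
Definition is_autO (B : comPzRingType) (rho : fps B) : Prop :=
  rho 0%N = 0 /\ exists b, rho 1%N * b = 1.

Definition fps_comp (B : comPzRingType) (mu rho : fps B) : fps B :=
  fun n => \sum_(i < n.+1) mu i * (rho ^+ i) n.

(* h^e for an integer e, given an inverse h' of h. *)
Definition fps_powz (B : comPzRingType) (h h' : fps B) (e : int) : fps B :=
  match e with Posz m => h ^+ m | Negz m => h' ^+ m.+1 end.

Section AutO.
Variables (k : fieldType) (V : lmodType k) (A : graded_va V).
Variable act : forall B : calg k, fps B -> bc V B -> bc V B.

Definition bc_T (B : calg k) (n : nat) : bc V B -> bc V B := bc_map (va_T A n).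

(* The coefficient of z^r in e^{-zT} Pi(rho) e^{rho(z)T} v. *)
Definition autO_z (B : calg k) (rho : fps B) (r : nat) (v : bc V B) : bc V B :=
  \sum_(p < r.+1) (-1) ^+ p *: bc_T p (act rho
     (\sum_(n < (r - p).+1) (rho ^+ n) (r - p)%N *: bc_T n v)).

(* The coefficient of z^r in the inverse e^{-rho(z)T} Pi(mu) e^{zT} v, mu = rho^{-1}. *)
Definition autO_z_inv (B : calg k) (rho mu : fps B) (r : nat) (v : bc V B) : bc V B :=
  \sum_(p < r.+1) \sum_(n < (r - p).+1)
     ((-1) ^+ n * (rho ^+ n) (r - p)%N) *: bc_T n (act mu (bc_T p v)).

(* (\bigoplus_{s < p} V_s) (x) B *)
Definition bc_lt (B : calg k) (p : nat) : bc V B -> Prop :=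
  lspan (fun x => exists s a, [/\ (s < p)%N, gva_gr A s a & x = bc_pure B a]).

Record is_autO_action : Prop := IsAutOAction {
  ao_linear : forall (B : calg k) (rho : fps B), is_autO rho -> linear (act rho);
  ao_natural : forall (B C : calg k) (f : ahom B C) (rho : fps B) (v : V) l,
    is_autO rho -> act rho (bc_pure B v) = bc_sum l ->
    act (fun i => f (rho i)) (bc_pure C v) = bc_sum [seq (f x.1, x.2) | x <- l];
  ao_id : forall (B : calg k) (v : bc V B), act (fps_Xn B 1) v = v;
  (* The composite of the automorphisms given by mu, then rho, is given by mu(rho(t)). *)
  ao_mul : forall (B : calg k) (rho mu : fps B) v, is_autO rho -> is_autO mu ->
    act rho (act mu v) = act (fps_comp mu rho) v;
  ao_filtered : forall (B : calg k) (rho : fps B) r p v, is_autO rho ->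
    bc_lt p v -> bc_lt p (autO_z rho r v);
  ao_leading : forall (B : calg k) (rho D : fps B) r s a, is_autO rho -> gva_gr A s a ->
    D * fhasse 1 rho ^+ s = 1 ->
    bc_lt s (autO_z rho r (bc_pure B a) - D r *: bc_pure B a);
  ao_scaling : forall (B : calg k) (x y : B) s a, x * y = 1 -> gva_gr A s a ->
    act (fun i => if i == 1%N then x else 0) (bc_pure B a) = y ^+ s *: bc_pure B a;
  (* Coefficient of z^(-1-n) in Pi(rho) Y(Pi(rho_z)^-1 a, rho(z)) Pi(rho)^-1 w = Y(a, z) w;
     rho(z) = z h(z), so rho(z)^(-1-l) z^r contributes h^(-1-l)_j with l = n + r + j. *)
  ao_vertex : forall (B : calg k) (rho mu h h' : fps B) a w n,
    is_autO rho -> is_autO mu ->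
    fps_comp rho mu = fps_Xn B 1 -> fps_comp mu rho = fps_Xn B 1 ->
    rho = fps_Xn B 1 * h -> h * h' = 1 ->
    exists L0, forall L, (L0 <= L)%N ->
      act rho (\sum_(r < L) \sum_(j < L)
        let l := n + r%:Z + j%:Z in
        fps_powz h h' (-1 - l) j *:
          bc_map2 (fun x y => va_md A x l y) (autO_z_inv rho mu r a) (act mu w))
      = bc_map2 (fun x y => va_md A x n y) a w }.

Record moebius := Moebius {
  mo_L1 : nat -> V -> V;
  mo_L0 : nat -> V -> V;
  mo_L1_linear : forall n, linear (mo_L1 n);
  mo_L0_linear : forall n, linear (mo_L0 n);
  mo_L1_0 : forall a, mo_L1 0 a = a;
  mo_L0E : forall n s a, gva_gr A s a -> mo_L0 n a = a *~ binz (- (2 * s)%N%:Z) n;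
  mo_L1_deg : forall n s a, gva_gr A s a -> grz (gva_gr A) (s%:Z - n%:Z) (mo_L1 n a);
  mo_L1_L1 : forall m n a, mo_L1 m (mo_L1 n a) = mo_L1 (m + n) a *+ 'C(m + n, n);
  mo_L1_T : forall m n a, mo_L1 m (va_T A n a) =
    \sum_(i < (minn m n).+1) \sum_(j < i.+1)
      va_T A (n - i) (mo_L0 (i - j) (mo_L1 (m - i) a))
        *~ ((-1) ^+ i * binz (- (m + n)%N%:Z + (2 * i)%N%:Z) j);
  mo_L1_vac : forall n, mo_L1 n (va_vac A) = if n == 0%N then va_vac A else 0;
  (* Coefficient of z^n z_0^(-1-m) in
     e^{zL_1} Y(a,z_0) e^{-zL_1} = Y(e^{z(1-zz_0)L_1} (1-zz_0)^{-2L_0} a, z_0/(1-zz_0)). *)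
  mo_L1_vertex : forall n m s a w, gva_gr A s a ->
    \sum_(j < n.+1) mo_L1 (n - j) (va_md A a m (mo_L1 j w)) *~ (-1) ^+ j =
    \sum_(j < n.+1) va_md A (mo_L1 (n - j) a) (m + j%:Z) w
      *~ ((-1) ^+ j * binz (n%:Z + m + 1 - (2 * s)%N%:Z) j);
  (* gamma(t) = 1/(1+t) - 1 *)
  mo_gamma : forall s a, gva_gr A s a ->
    act ((fun i => if i == 0%N then 0 else (-1) ^+ i) : fps (calg_id k))
        (bc_pure (calg_id k) a)
    = bc_pure (calg_id k) ((-1) ^+ s *: \sum_(i < s.+1) mo_L1 i a) }.

End AutO.

Section Enveloping.
Variables (k : fieldType) (V : lmodType k) (A : graded_va V).

(* V (x) k[t, t^-1], with generators a (x) t^m. *)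
Inductive loop_rel : lexp k (V * int) -> lexp k (V * int) -> Prop :=
  | loop_relE c a b m :
      loop_rel (LGen (c *: a + b, m)) (LAdd (LScale c (LGen (a, m))) (LGen (b, m))).
Definition loop := pmod loop_rel.
HB.instance Definition _ := GRing.Lmodule.on loop.
Definition loop_gen (a : V) (m : int) : loop := pgen loop_rel (a, m).

Definition loop_der (x : loop) : Prop := exists p a m, (0 < p)%N /\
  x = \sum_(i < p.+1) loop_gen (va_T A i a) (m - (p - i)%N%:Z) *~ binz m (p - i).

Definition lieV := lquot loop_der.
HB.instance Definition _ := GRing.Lmodule.on lieV.
Definition lie_gen (a : V) (m : int) : lieV := lcls loop_der (loop_gen a m).

(* The bracket is given on the spanning elements a_[n]. *)
Inductive env_rel : aexp k lieV -> aexp k lieV -> Prop :=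
  | env_linear c (x y : lieV) :
      env_rel (AGen (c *: x + y)) (AAdd (AScale c (AGen x)) (AGen y))
  | env_bracket a b n m x :
      fin_sum (fun j => lie_gen (va_md A a j%:Z b) (n + m - j%:Z) *~ binz n j) x ->
      env_rel (AAdd (AMul (AGen (lie_gen a n)) (AGen (lie_gen b m)))
                    (AOpp (AMul (AGen (lie_gen b m)) (AGen (lie_gen a n)))))
              (AGen x).
Definition env := palg env_rel.
HB.instance Definition _ := GRing.PzRing.on env.
HB.instance Definition _ := GRing.Lmodule.on env.
Definition env_gen (a : V) (m : int) : env := agen env_rel (lie_gen a m).

Lemma env_scaleAl c (x y : env) : c *: (x * y) = (c *: x) * y.
Proof. exact: palg_scaleAl. Qed.
Lemma env_scaleAr c (x y : env) : c *: (x * y) = x * (c *: y).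
Proof. exact: palg_scaleAr. Qed.

(* U_d *)
Inductive env_deg : int -> env -> Prop :=
  | env_deg_gen s a m : gva_gr A s a -> env_deg (s%:Z - 1 - m) (env_gen a m)
  | env_deg1 : env_deg 0 1
  | env_degM d e x y : env_deg d x -> env_deg e y -> env_deg (d + e) (x * y)
  | env_deg0 d : env_deg d 0
  | env_degD d c x y : env_deg d x -> env_deg d y -> env_deg d (c *: x + y).

(* The span of the U_(d-j) U_j, j <= -m. *)
Inductive env_nbhd (m : nat) (d : int) : env -> Prop :=
  | env_nbhdM j x y : j <= - m%:Z -> env_deg (d - j) x -> env_deg j y -> env_nbhd m d (x * y)
  | env_nbhd0 : env_nbhd m d 0
  | env_nbhdD c x y : env_nbhd m d x -> env_nbhd m d y -> env_nbhd m d (c *: x + y).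

Lemma env_degZ d c x : env_deg d x -> env_deg d (c *: x).
Proof. by move=> h; rewrite -[_ *: _]addr0; apply: env_degD => //; exact: env_deg0. Qed.

Lemma env_degDD d x y : env_deg d x -> env_deg d y -> env_deg d (x + y).
Proof. by move=> h h'; rewrite -[x]scale1r; exact: env_degD. Qed.

Lemma env_degN d x : env_deg d x -> env_deg d (- x).
Proof. by move=> h; rewrite -scaleN1r; exact: env_degZ. Qed.

Lemma env_nbhdDD m d x y : env_nbhd m d x -> env_nbhd m d y -> env_nbhd m d (x + y).
Proof. by move=> h h'; rewrite -[x]scale1r; exact: env_nbhdD. Qed.

Lemma env_nbhdN m d x : env_nbhd m d x -> env_nbhd m d (- x).
Proof. by move=> h; rewrite -scaleN1r -[_ *: _]addr0; apply: env_nbhdD => //; exact: env_nbhd0. Qed.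

Lemma env_nbhd_mull m d e f x y : d + e = f ->
  env_deg d x -> env_nbhd m e y -> env_nbhd m f (x * y).
Proof.
move=> <- hx; elim=> [j u v hj hu hv||c u v _ IHu _ IHv].
- rewrite mulrA; apply: env_nbhdM hj _ hv.
  by rewrite -addrA; exact: env_degM.
- by rewrite mulr0; exact: env_nbhd0.
by rewrite mulrDr -env_scaleAr; exact: env_nbhdD.
Qed.

Lemma env_nbhd_mulr m d e f x y : d + e = f ->
  env_nbhd (m + `|e|) d x -> env_deg e y -> env_nbhd m f (x * y).
Proof.
move=> <- hx hy; elim: hx => [j u v hj hu hv||c u v _ IHu _ IHv].
- rewrite -mulrA; apply: (@env_nbhdM _ _ (j + e)); [lia | | exact: env_degM].
  by rewrite (_ : d + e - (j + e) = d - j) //; lia.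
- by rewrite mul0r; exact: env_nbhd0.
by rewrite mulrDl -env_scaleAl; exact: env_nbhdD.
Qed.

(* Elements of \varprojlim_m U_d / \sum_(j <= -m) U_(d-j) U_j, given by representatives. *)
Record hatU (d : int) := HatU {
  hat_seq :> nat -> env;
  hat_deg : forall m, env_deg d (hat_seq m);
  hat_coh : forall m, env_nbhd m d (hat_seq m.+1 - hat_seq m) }.

HB.instance Definition _ d := gen_eqMixin (hatU d).
HB.instance Definition _ d := gen_choiceMixin (hatU d).

Lemma hatP d (x y : hatU d) : hat_seq x =1 hat_seq y -> x = y.
Proof.
case: x y => [x hx hx'] [y hy hy'] /= /funext e; case: _ / e hy hy' => hy hy'.
by congr HatU; exact: Prop_irrelevance.
Qed.

Lemma hat_const_coh d (u : env) m : env_nbhd m d (u - u).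
Proof. by rewrite subrr; exact: env_nbhd0. Qed.

Definition hat_const d u (h : env_deg d u) : hatU d :=
  @HatU d (fun _ => u) (fun _ => h) (fun m => hat_const_coh d u m).

Section HatModule.
Variable d : int.
Implicit Types x y : hatU d.

Lemma hat_add_coh x y m : env_nbhd m d ((x m.+1 + y m.+1) - (x m + y m)).
Proof. by rewrite opprD addrACA; apply: env_nbhdDD; exact: hat_coh. Qed.
Lemma hat_opp_coh x m : env_nbhd m d (- x m.+1 - - x m).
Proof. by rewrite -opprD; apply: env_nbhdN; exact: hat_coh. Qed.
Lemma hat_scale_coh (c : k) x m : env_nbhd m d (c *: x m.+1 - c *: x m).
Proof.
rewrite -scalerBr -[_ *: _]addr0; apply: env_nbhdD; [exact: hat_coh | exact: env_nbhd0].
Qed.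

Definition hat_zero : hatU d := hat_const (env_deg0 d).
Definition hat_add x y : hatU d := @HatU d (fun m => x m + y m)
  (fun m => env_degDD (hat_deg x m) (hat_deg y m)) (hat_add_coh x y).
Definition hat_opp x : hatU d := @HatU d (fun m => - x m)
  (fun m => env_degN (hat_deg x m)) (hat_opp_coh x).
Definition hat_scale c x : hatU d := @HatU d (fun m => c *: x m)
  (fun m => env_degZ c (hat_deg x m)) (hat_scale_coh c x).

Lemma hat_addA : associative hat_add.
Proof. by move=> x y z; apply: hatP => m; exact: addrA. Qed.
Lemma hat_addC : commutative hat_add.
Proof. by move=> x y; apply: hatP => m; exact: addrC. Qed.
Lemma hat_add0 : left_id hat_zero hat_add.
Proof. by move=> x; apply: hatP => m; exact: add0r. Qed.
Lemma hat_addN : left_inverse hat_zero hat_opp hat_add.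
Proof. by move=> x; apply: hatP => m; exact: addNr. Qed.
HB.instance Definition _ :=
  GRing.isZmodule.Build (hatU d) hat_addA hat_addC hat_add0 hat_addN.

Lemma hat_scaleA a b x : hat_scale a (hat_scale b x) = hat_scale (a * b) x.
Proof. by apply: hatP => m; exact: scalerA. Qed.
Lemma hat_scale1 : left_id 1 hat_scale.
Proof. by move=> x; apply: hatP => m; exact: scale1r. Qed.
Lemma hat_scaleDr : right_distributive hat_scale +%R.
Proof. by move=> a x y; apply: hatP => m; exact: scalerDr. Qed.
Lemma hat_scaleDl x : {morph hat_scale^~ x : a b / a + b}.
Proof. by move=> a b; apply: hatP => m; exact: scalerDl. Qed.
HB.instance Definition _ := GRing.Zmodule_isLmodule.Build k (hatU d)
  hat_scaleA hat_scale1 hat_scaleDr hat_scaleDl.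
End HatModule.

Section HatMul.
Variables (d e f : int) (h : d + e = f) (x : hatU d) (y : hatU e).

(* Right multiplication by U_e maps the neighbourhood of index m + |e| into that of index m. *)
Definition hat_mul_seq (m : nat) : env := x (m + `|e|)%N * y m.

Lemma hat_mul_deg m : env_deg f (hat_mul_seq m).
Proof. by rewrite -h; apply: env_degM; exact: hat_deg. Qed.

Lemma hat_mul_coh m : env_nbhd m f (hat_mul_seq m.+1 - hat_mul_seq m).
Proof.
rewrite /hat_mul_seq addSn -(subrKA (x (m + `|e|)%N * y m.+1)) -mulrBl -mulrBr.
apply: env_nbhdDD; first exact: env_nbhd_mulr h (hat_coh x _) (hat_deg y _).
exact: env_nbhd_mull h (hat_deg x _) (hat_coh y _).
Qed.

Definition hat_mul : hatU f := HatU hat_mul_deg hat_mul_coh.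
End HatMul.

(* The two-sided ideal generated by 1_[m] - delta_(m,-1) and by the (convergent) associator
   relations. *)
Inductive hat_ideal : forall d, hatU d -> Prop :=
  | hat_ideal_vac m (x : hatU (- 1 - m)) :
      (forall i, x i = env_gen (va_vac A) m - (m == -1)%:R) -> hat_ideal x
  | hat_ideal_assoc p q a b r s (x : hatU (p%:Z + q%:Z - r - s - 2)) :
      gva_gr A p a -> gva_gr A q b ->
      (forall m, exists J0, forall J, (J0 <= J)%N ->
         env_nbhd m (p%:Z + q%:Z - r - s - 2)
           (x m - (env_gen (va_md A a r b) s
             - \sum_(j < J) (env_gen a (r - j%:Z) * env_gen b (s + j%:Z)
                 - env_gen b (r + s - j%:Z) * env_gen a j%:Z *~ sgz_pow r)
                 *~ ((-1) ^+ j * binz r j)))) ->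
      hat_ideal x
  | hat_ideal0 d : hat_ideal (0 : hatU d)
  | hat_idealD d c (x y : hatU d) : hat_ideal x -> hat_ideal y -> hat_ideal (c *: x + y)
  | hat_idealMl d e f (h : d + e = f) (x : hatU d) (y : hatU e) :
      hat_ideal y -> hat_ideal (hat_mul h x y)
  | hat_idealMr d e f (h : d + e = f) (x : hatU d) (y : hatU e) :
      hat_ideal x -> hat_ideal (hat_mul h x y).

Definition hat_closure d (x : hatU d) : Prop :=
  forall m, exists y : hatU d, hat_ideal y /\ env_nbhd m d (x m - y m).

(* The homogeneous part of degree d of the completed algebra; null sequences lie in the
   closure of the ideal, so that equality in the inverse limit is accounted for. *)
Definition calU (d : int) := lquot (@hat_closure d).
HB.instance Definition _ d := GRing.Lmodule.on (calU d).

(* The product of elements of degrees d and e; 0 unless f = d + e. *)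
Definition mulU d e f (x : calU d) (y : calU e) : calU f :=
  match d + e =P f with
  | ReflectT h => lcls _ (hat_mul h (qrep x) (qrep y))
  | ReflectF _ => 0
  end.

Lemma env_nbhd_le m p d x : (m <= p)%N -> env_nbhd p d x -> env_nbhd m d x.
Proof.
move=> le; elim=> [j u v hj hu hv||c u v _ IHu _ IHv].
- by apply: env_nbhdM hu hv; lia.
- exact: env_nbhd0.
exact: env_nbhdD.
Qed.

Lemma hat_coh_le d (x : hatU d) m p : (m <= p)%N -> env_nbhd m d (x p - x m).
Proof.
elim: p => [|p IH]; first by rewrite leqn0 => /eqP ->; rewrite subrr; exact: env_nbhd0.
rewrite leq_eqVlt => /orP[/eqP ->|]; first by rewrite subrr; exact: env_nbhd0.
rewrite ltnS => le; rewrite -(subrKA (x p)); apply: env_nbhdDD; last exact: IH.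
exact: env_nbhd_le le (hat_coh x p).
Qed.

Lemma hat_closureD d c (x y : hatU d) :
  hat_closure x -> hat_closure y -> hat_closure (c *: x + y).
Proof.
move=> hx hy m; have [x' [ix nx]] := hx m; have [y' [iy ny]] := hy m.
exists (c *: x' + y'); split; first exact: hat_idealD.
rewrite (_ : _ - _ = c *: (x m - x' m) + (y m - y' m)); first exact: env_nbhdD.
by rewrite scalerBr addrACA -opprD.
Qed.

Lemma hat_closure0 d : hat_closure (0 : hatU d).
Proof. by move=> m; exists 0; split; [exact: hat_ideal0 | rewrite subrr; exact: env_nbhd0]. Qed.

Lemma hat_closure_span d (x : hatU d) : lspan (@hat_closure d) x -> hat_closure x.
Proof.
elim=> {x} [//||x y _ hx _ hy|c x _ hx]; first exact: hat_closure0.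
  by rewrite -[x]scale1r; exact: hat_closureD.
by rewrite -[_ *: _]addr0; apply: hat_closureD => //; exact: hat_closure0.
Qed.

Lemma calU_eq d (x y : hatU d) :
  lcls (@hat_closure d) x = lcls (@hat_closure d) y <-> hat_closure (x - y).
Proof. by rewrite lcls_eq; split; [exact: hat_closure_span | exact: lspan_in]. Qed.

(* Sequences with the same limit are identified. *)
Lemma calU_null d (x y : hatU d) : (forall m, env_nbhd m d (x m - y m)) ->
  lcls (@hat_closure d) x = lcls (@hat_closure d) y.
Proof.
move=> h; apply/calU_eq => m; exists 0; split; first exact: hat_ideal0.
by rewrite (_ : _ - _ = x m - y m) //; exact: subr0.
Qed.

Lemma hat_closureMl d e f (h : d + e = f) (x : hatU d) (y : hatU e) :
  hat_closure y -> hat_closure (hat_mul h x y).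
Proof.
move=> hy m; have [y' [iy ny]] := hy m; exists (hat_mul h x y'); split.
  exact: hat_idealMl.
by rewrite /= /hat_mul_seq -mulrBr; apply: env_nbhd_mull h (hat_deg _ _) ny.
Qed.

Lemma hat_closureMr d e f (h : d + e = f) (x : hatU d) (y : hatU e) :
  hat_closure x -> hat_closure (hat_mul h x y).
Proof.
move=> hx m; have [x' [ix nx]] := hx (m + `|e|)%N; exists (hat_mul h x' y); split.
  exact: hat_idealMr.
by rewrite /= /hat_mul_seq -mulrBl; apply: env_nbhd_mulr h nx (hat_deg _ _).
Qed.

Lemma hat_mulPl d e f (h : d + e = f) c (x x' : hatU d) (y : hatU e) :
  hat_mul h (c *: x + x') y = c *: hat_mul h x y + hat_mul h x' y.
Proof. by apply: hatP => m; rewrite /= /hat_mul_seq mulrDl env_scaleAl. Qed.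

Lemma hat_mulPr d e f (h : d + e = f) c (x : hatU d) (y y' : hatU e) :
  hat_mul h x (c *: y + y') = c *: hat_mul h x y + hat_mul h x y'.
Proof. by apply: hatP => m; rewrite /= /hat_mul_seq mulrDr env_scaleAr. Qed.

Lemma mulU_cls d e f (h : d + e = f) (x : hatU d) (y : hatU e) :
  mulU f (lcls _ x) (lcls _ y) = lcls _ (hat_mul h x y).
Proof.
rewrite /mulU; case: eqP => [h'|//]; rewrite (eq_irrelevance h' h).
set x' := qrep _; set y' := qrep _.
have hx : hat_closure (x' - x) by apply/calU_eq; rewrite /lcls qrepK.
have hy : hat_closure (y' - y) by apply/calU_eq; rewrite /lcls qrepK.
apply/calU_eq; rewrite (_ : _ - _ = 1 *: hat_mul h (x' - x) y' + hat_mul h x (y' - y)).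
  by apply: hat_closureD; [exact: hat_closureMr | exact: hat_closureMl].
apply: hatP => m; rewrite scale1r /= /hat_mul_seq /=.
by rewrite mulrBl mulrBr subrKA.
Qed.

Lemma calU_rep d (x : calU d) : exists y : hatU d, x = lcls _ y.
Proof. by exists (qrep x); rewrite /lcls qrepK. Qed.

Lemma mulU_bad d e f (x : calU d) (y : calU e) : d + e <> f -> mulU f x y = 0.
Proof. by rewrite /mulU; case: eqP. Qed.

Lemma mulU_linl d e f c (x x' : calU d) (y : calU e) :
  mulU f (c *: x + x') y = c *: mulU f x y + mulU f x' y.
Proof.
have [h|h] := pselect (d + e = f); last by rewrite !mulU_bad // scaler0 addr0.
have [u ->] := calU_rep x; have [u' ->] := calU_rep x'; have [v ->] := calU_rep y.
by rewrite -lcls_linear !(mulU_cls h) hat_mulPl lcls_linear.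
Qed.

Lemma mulU_linr d e f c (x : calU d) (y y' : calU e) :
  mulU f x (c *: y + y') = c *: mulU f x y + mulU f x y'.
Proof.
have [h|h] := pselect (d + e = f); last by rewrite !mulU_bad // scaler0 addr0.
have [u ->] := calU_rep x; have [v ->] := calU_rep y; have [v' ->] := calU_rep y'.
by rewrite -lcls_linear !(mulU_cls h) hat_mulPr lcls_linear.
Qed.

Lemma mulU0 d e f (x : calU d) : mulU f x (0 : calU e) = 0.
Proof.
have E : mulU f x (1 *: 0 + 0 : calU e) = 1 *: mulU f x 0 + mulU f x 0 := mulU_linr f 1 x 0 0.
by apply: (addIr (mulU f x 0)); rewrite add0r; move: E; rewrite !scale1r addr0 => E; exact: esym E.
Qed.

Lemma mul0U d e f (y : calU e) : mulU f (0 : calU d) y = 0.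
Proof.
have E : mulU f (1 *: 0 + 0 : calU d) y = 1 *: mulU f 0 y + mulU f 0 y := mulU_linl f 1 0 0 y.
by apply: (addIr (mulU f 0 y)); rewrite add0r; move: E; rewrite !scale1r addr0 => E; exact: esym E.
Qed.

Lemma mulUBr d e f (x : calU d) (y y' : calU e) :
  mulU f x (y - y') = mulU f x y - mulU f x y'.
Proof.
have E : mulU f x (-1 *: y' + y) = -1 *: mulU f x y' + mulU f x y := mulU_linr f (-1) x y' y.
by move: E; rewrite !scaleN1r addrC => ->; rewrite addrC.
Qed.

Lemma mulUBl d e f (x x' : calU d) (y : calU e) :
  mulU f (x - x') y = mulU f x y - mulU f x' y.
Proof.
have E : mulU f (-1 *: x' + x) y = -1 *: mulU f x' y + mulU f x y := mulU_linl f (-1) x' x y.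
by move: E; rewrite !scaleN1r addrC => ->; rewrite addrC.
Qed.

Lemma mulUDr d e f (x : calU d) (y y' : calU e) :
  mulU f x (y + y') = mulU f x y + mulU f x y'.
Proof.
have E : mulU f x (1 *: y + y') = 1 *: mulU f x y + mulU f x y' := mulU_linr f 1 x y y'.
by move: E; rewrite !scale1r.
Qed.

Lemma mulUDl d e f (x x' : calU d) (y : calU e) :
  mulU f (x + x') y = mulU f x y + mulU f x' y.
Proof.
have E : mulU f (1 *: x + x') y = 1 *: mulU f x y + mulU f x' y := mulU_linl f 1 x x' y.
by move: E; rewrite !scale1r.
Qed.

Lemma mulUZr d e f c (x : calU d) (y : calU e) : mulU f x (c *: y) = c *: mulU f x y.
Proof.
have E : mulU f x (c *: y + 0) = c *: mulU f x y + mulU f x 0 := mulU_linr f c x y 0.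
by move: E; rewrite addr0 => ->; rewrite [mulU f x 0]mulU0 addr0.
Qed.

Lemma mulUZl d e f c (x : calU d) (y : calU e) : mulU f (c *: x) y = c *: mulU f x y.
Proof.
have E : mulU f (c *: x + 0) y = c *: mulU f x y + mulU f 0 y := mulU_linl f c x 0 y.
by move: E; rewrite addr0 => ->; rewrite [mulU f 0 y]mul0U addr0.
Qed.

Lemma mulUA d e f de ef def (x : calU d) (y : calU e) (z : calU f) :
  d + e = de -> e + f = ef -> mulU def x (mulU ef y z) = mulU def (mulU de x y) z.
Proof.
move=> h1 h2; have [h|h] := pselect (d + ef = def); last first.
  by rewrite !mulU_bad // => h'; apply: h; rewrite -h' -h1 -h2 addrA.
have h' : de + f = def by rewrite -h -h1 -h2 addrA.
have [u ->] := calU_rep x; have [v ->] := calU_rep y; have [w ->] := calU_rep z.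
rewrite (mulU_cls h2) (mulU_cls h1) (mulU_cls h) (mulU_cls h'); apply: calU_null => m.
rewrite /= /hat_mul_seq /= /hat_mul_seq -[X in _ - X]mulrA -mulrBl.
apply: env_nbhd_mulr h _ _; last by rewrite -h2; apply: env_degM; exact: hat_deg.
by rewrite -opprB; apply: env_nbhdN; apply: hat_coh_le; lia.
Qed.

Definition oneU : calU 0 := lcls _ (hat_const env_deg1).

(* The class of a_[m] as an element of degree d, for d = deg a - 1 - m; 0 in other degrees. *)
Definition genU (d : int) (a : V) (m : int) : calU d :=
  match pselect (env_deg d (env_gen a m)) with
  | left h => lcls _ (hat_const h)
  | right _ => 0
  end.

Definition calU_nbhd (m : nat) (d : int) (x : calU d) : Prop :=
  exists y : hatU d, lcls _ y = x /\ env_nbhd m d (y m).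

Definition calU_left (m : nat) (d : int) : calU d -> Prop :=
  lspan (fun x => exists j (y : calU (d - j)) (z : calU j),
    j <= - m%:Z - 1 /\ x = mulU d y z).

(* The closure of \sum_(j <= -m-1) U_(d-j) U_j. *)
Definition calU_left_closure (m : nat) (d : int) (x : calU d) : Prop :=
  forall p, exists y, calU_left m y /\ calU_nbhd p (x - y).

(* A_(n,m) *)
Definition mtA (n m : nat) := lquot (@calU_left_closure m (n%:Z - m%:Z)).
HB.instance Definition _ n m := GRing.Lmodule.on (mtA n m).
Definition mtA_cls n m (x : calU (n%:Z - m%:Z)) : mtA n m := lcls _ x.

Lemma lspan_lin (N : lmodType k) (P : N -> Prop) c x y :
  lspan P x -> lspan P y -> lspan P (c *: x + y).
Proof. by move=> hx hy; apply: lspanD => //; exact: lspanZ. Qed.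

Lemma calU_nbhd_lin p d c (x y : calU d) :
  calU_nbhd p x -> calU_nbhd p y -> calU_nbhd p (c *: x + y).
Proof.
move=> [x' [<- hx]] [y' [<- hy]]; exists (c *: x' + y'); split; first by rewrite lcls_linear.
exact: env_nbhdD.
Qed.

Lemma calU_nbhd0 p d : calU_nbhd p (0 : calU d).
Proof. by exists 0; split => //; exact: env_nbhd0. Qed.

Lemma calU_nbhdMl p d e f (x : calU d) (y : calU e) :
  calU_nbhd p y -> calU_nbhd p (mulU f x y).
Proof.
move=> [y' [<- hy]]; have [h|h] := pselect (d + e = f); last first.
  by rewrite mulU_bad //; exact: calU_nbhd0.
have [x' ->] := calU_rep x; exists (hat_mul h x' y'); split; first by rewrite mulU_cls.
exact: env_nbhd_mull h (hat_deg _ _) hy.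
Qed.

Lemma calU_nbhdMr p d e f (x : calU d) (y : calU e) :
  calU_nbhd (p + `|e|) x -> calU_nbhd p (mulU f x y).
Proof.
move=> [x' [<- hx]]; have [h|h] := pselect (d + e = f); last first.
  by rewrite mulU_bad //; exact: calU_nbhd0.
have [y' ->] := calU_rep y; exists (hat_mul h x' y'); split; first by rewrite mulU_cls.
exact: env_nbhd_mulr h hx (hat_deg _ _).
Qed.

Lemma calU_left_closure_span m d (x : calU d) :
  lspan (@calU_left_closure m d) x -> calU_left_closure m x.
Proof.
have h0 : calU_left_closure m (0 : calU d).
  by move=> p; exists 0; split; [exact: lspan0 | rewrite subrr; exact: calU_nbhd0].
have hD c (y z : calU d) : calU_left_closure m y -> calU_left_closure m z ->
    calU_left_closure m (c *: y + z).
  move=> hy hz p; have [y' [ly ny]] := hy p; have [z' [lz nz]] := hz p.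
  exists (c *: y' + z'); split; first exact: lspan_lin.
  rewrite (_ : _ - _ = c *: (y - y') + (z - z')); first exact: calU_nbhd_lin.
  by rewrite scalerBr addrACA -opprD.
elim=> {x} [//||x y _ hx _ hy|c x _ hx] //; first by rewrite -[x]scale1r; exact: hD.
by rewrite -[_ *: _]addr0; exact: hD.
Qed.

Lemma calU_left_closureMl m d e f (x : calU d) (y : calU e) :
  calU_left_closure m y -> calU_left_closure m (mulU f x y).
Proof.
move=> hy p; have [y' [ly ny]] := hy p; exists (mulU f x y'); split; last first.
  rewrite (_ : _ - _ = mulU f x (y - y')); first exact: calU_nbhdMl.
  by rewrite mulUBr.
have [h|h] := pselect (d + e = f); last by rewrite mulU_bad //; exact: lspan0.
elim: ly => {y hy y' ny} [y [j [u [v [hj ->]]]]||y z _ hy _ hz|c y _ hy].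
- apply: lspan_in; exists j, (mulU (f - j) x u), v; split=> //.
  by apply: mulUA; [rewrite -h addrA | rewrite subrK].
- by rewrite mulU0; exact: lspan0.
- by rewrite mulUDr; exact: lspanD.
by rewrite mulUZr; exact: lspanZ.
Qed.

Lemma calU_left_closureMr (m m' : nat) d e f (x : calU d) (y : calU e) :
  - m%:Z + e <= - m'%:Z -> calU_left_closure m x -> calU_left_closure m' (mulU f x y).
Proof.
move=> le hx p; have [x' [lx nx]] := hx (p + `|e|)%N; exists (mulU f x' y); split; last first.
  rewrite (_ : _ - _ = mulU f (x - x') y); first exact: calU_nbhdMr.
  by rewrite mulUBl.
have [h|h] := pselect (d + e = f); last by rewrite mulU_bad //; exact: lspan0.
elim: lx => {x hx x' nx} [x [j [u [v [hj ->]]]]||x z _ hx _ hz|c x _ hx].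
- have hd : d - j = f - (j + e) by rewrite -h; lia.
  apply: lspan_in; exists (j + e); case: _ / hd; exists u, (mulU (j + e) v y); split; first lia.
  by apply: esym; apply: mulUA; rewrite ?subrK.
- by rewrite mul0U; exact: lspan0.
- by rewrite mulUDl; exact: lspanD.
by rewrite mulUZl; exact: lspanZ.
Qed.

Lemma mtA_eq n m (x y : calU (n%:Z - m%:Z)) :
  mtA_cls x = mtA_cls y <-> calU_left_closure m (x - y).
Proof.
rewrite /mtA_cls lcls_eq; split; last exact: lspan_in.
exact: calU_left_closure_span.
Qed.

Lemma mtA_rep n m (x : calU (n%:Z - m%:Z)) : calU_left_closure m (qrep (mtA_cls x) - x).
Proof. by apply/mtA_eq; rewrite /mtA_cls /lcls qrepK. Qed.

Lemma mtA_ex n m (x : mtA n m) : exists y, x = mtA_cls y.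
Proof. by exists (qrep x); rewrite /mtA_cls /lcls qrepK. Qed.

Lemma mtA_lin n m c (x y : calU (n%:Z - m%:Z)) :
  mtA_cls (c *: x + y) = c *: mtA_cls x + mtA_cls y.
Proof. exact: lcls_linear. Qed.

(* The products A_(n,0) -> A_(n',0), A_(0,m) -> A_(0,m') with an element of degree e, and
   (x, y, x') |-> x (y x'); they vanish unless the degrees match. *)
Definition mtA_mull n n' e (u : calU e) (x : mtA n 0) : mtA n' 0 :=
  mtA_cls (mulU (n'%:Z - 0%:Z) u (qrep x)).
Definition mtA_mulr m m' e (y : mtA 0 m) (u : calU e) : mtA 0 m' :=
  mtA_cls (mulU (0%:Z - m'%:Z) (qrep y) u).
Definition mtA_mul3 n d d' (x : mtA n 0) (y : mtA 0 d) (x' : mtA d' 0) : mtA n 0 :=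
  mtA_cls (mulU (n%:Z - 0%:Z) (qrep x) (mulU 0 (qrep y) (qrep x'))).

Lemma mtA_mull_cls n n' e (u : calU e) (x : calU (n%:Z - 0%:Z)) :
  mtA_mull n' u (mtA_cls x) = mtA_cls (mulU (n'%:Z - 0%:Z) u x).
Proof.
by apply/mtA_eq; rewrite -mulUBr; apply: calU_left_closureMl; exact: mtA_rep.
Qed.

Lemma mtA_mulr_cls m m' e (y : calU (0%:Z - m%:Z)) (u : calU e) :
  mtA_mulr m' (mtA_cls y) u = mtA_cls (mulU (0%:Z - m'%:Z) y u).
Proof.
have [h|h] := pselect (0%:Z - m%:Z + e = 0%:Z - m'%:Z); last by rewrite /mtA_mulr !mulU_bad.
apply/mtA_eq; rewrite -mulUBl; apply: (@calU_left_closureMr m); [lia | exact: mtA_rep].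
Qed.

Lemma mtA_mul3_cls n d d' (x : calU (n%:Z - 0%:Z)) (y : calU (0%:Z - d%:Z))
    (x' : calU (d'%:Z - 0%:Z)) :
  mtA_mul3 (mtA_cls x) (mtA_cls y) (mtA_cls x') =
  mtA_cls (mulU (n%:Z - 0%:Z) x (mulU 0 y x')).
Proof.
have [h|h] := pselect (0%:Z - d%:Z + (d'%:Z - 0%:Z) = 0); last first.
  by rewrite /mtA_mul3 ![mulU 0 _ _]mulU_bad // !mulU0.
rewrite /mtA_mul3; set p := qrep _; set q := qrep _; set r := qrep _.
have hp : calU_left_closure 0 (p - x) := mtA_rep x.
have hq : calU_left_closure d (q - y) := mtA_rep y.
have hr : calU_left_closure 0 (r - x') := mtA_rep x'.
apply: (etrans (y := mtA_cls (mulU (n%:Z - 0%:Z) x (mulU 0 q r)))).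
  by apply/mtA_eq; rewrite -mulUBl; apply: calU_left_closureMr hp.
apply: (etrans (y := mtA_cls (mulU (n%:Z - 0%:Z) x (mulU 0 y r)))).
  apply/mtA_eq; rewrite -mulUBr -mulUBl; apply: calU_left_closureMl.
  by apply: calU_left_closureMr hq; lia.
by apply/mtA_eq; rewrite -mulUBr -mulUBr; do 2! apply: calU_left_closureMl.
Qed.

Record fA_gen := FAGen { fA_n : nat; fA_m : nat; fA_l : mtA fA_n 0; fA_r : mtA 0 fA_m }.

Inductive fA_rel : lexp k fA_gen -> lexp k fA_gen -> Prop :=
  | fA_linl n m c (x x' : mtA n 0) (y : mtA 0 m) : fA_rel (LGen (FAGen (c *: x + x') y))
      (LAdd (LScale c (LGen (FAGen x y))) (LGen (FAGen x' y)))
  | fA_linr n m c (x : mtA n 0) (y y' : mtA 0 m) : fA_rel (LGen (FAGen x (c *: y + y')))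
      (LAdd (LScale c (LGen (FAGen x y))) (LGen (FAGen x y')))
  | fA_balanced n m (x : calU (n%:Z - 0%:Z)) (a : calU (0%:Z - 0%:Z))
      (y : calU (0%:Z - m%:Z)) :
      fA_rel (LGen (FAGen (mtA_cls (mulU (n%:Z - 0%:Z) x a)) (mtA_cls y)))
             (LGen (FAGen (mtA_cls x) (mtA_cls (mulU (0%:Z - m%:Z) a y)))).

(* The direct sum over n, m >= 0 of A_(n,0) (x)_(A_0) A_(0,m). *)
Definition fA := pmod fA_rel.
HB.instance Definition _ := GRing.Lmodule.on fA.

Definition fA_pure n m (x : mtA n 0) (y : mtA 0 m) : fA := pgen fA_rel (FAGen x y).

Lemma fA_pure_linl n m c (x x' : mtA n 0) (y : mtA 0 m) :
  fA_pure (c *: x + x') y = c *: fA_pure x y + fA_pure x' y.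
Proof.
by rewrite [c *: fA_pure _ _]pmod_scaleE [RHS]pmod_addE; apply/pmod_eq/leqv_rel; exact: fA_linl.
Qed.

Lemma fA_pure_linr n m c (x : mtA n 0) (y y' : mtA 0 m) :
  fA_pure x (c *: y + y') = c *: fA_pure x y + fA_pure x y'.
Proof.
by rewrite [c *: fA_pure _ _]pmod_scaleE [RHS]pmod_addE; apply/pmod_eq/leqv_rel; exact: fA_linr.
Qed.

Lemma fA_pure_bal n m (x : calU (n%:Z - 0%:Z)) (a : calU (0%:Z - 0%:Z))
    (y : calU (0%:Z - m%:Z)) :
  fA_pure (mtA_cls (mulU (n%:Z - 0%:Z) x a)) (mtA_cls y) =
  fA_pure (mtA_cls x) (mtA_cls (mulU (0%:Z - m%:Z) a y)).
Proof. by apply/pmod_eq/leqv_rel; exact: fA_balanced. Qed.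

(* The summand of index (n, -m). *)
Definition fA_piece (n m : nat) : fA -> Prop :=
  lspan (fun b => exists x y, b = @fA_pure n m x y).

(* Left multiplication on the first factor and right multiplication on the second one. *)
Definition fA_mull_gen e (u : calU e) (g : fA_gen) : fA :=
  match (fA_n g)%:Z + e with
  | Posz n => @fA_pure n (fA_m g) (mtA_mull n u (fA_l g)) (fA_r g)
  | Negz _ => 0
  end.
Definition fA_mull e (u : calU e) : fA -> fA := @plift _ _ fA_rel fA (fA_mull_gen u).

Definition fA_mulr_gen e (u : calU e) (g : fA_gen) : fA :=
  match (fA_m g)%:Z - e with
  | Posz m => @fA_pure (fA_n g) m (fA_l g) (mtA_mulr m (fA_r g) u)
  | Negz _ => 0
  end.
Definition fA_mulr e (u : calU e) : fA -> fA := @plift _ _ fA_rel fA (fA_mulr_gen u).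

(* (x (x) y) * (x' (x) y') = x (y x') (x) y', which is 0 unless y x' has degree 0. *)
Definition fA_star_gen (g g' : fA_gen) : fA :=
  @fA_pure (fA_n g) (fA_m g') (mtA_mul3 (fA_l g) (fA_r g) (fA_l g')) (fA_r g').
Definition fA_star (b b' : fA) : fA :=
  @plift _ _ fA_rel fA (fun g => @plift _ _ fA_rel fA (fA_star_gen g) b') b.

Lemma fA_mull_compat e (u : calU e) x y : fA_rel x y ->
  leval (fA_mull_gen u) x = leval (fA_mull_gen u) y.
Proof.
case=> {x y} [n m c x x' y|n m c x y y'|n m x a y] /=; rewrite /fA_mull_gen /=.
- case: (n%:Z + e) => [p|p]; last by rewrite scaler0 addr0.
  have [v ->] := mtA_ex x; have [v' ->] := mtA_ex x'.
  by rewrite -mtA_lin !mtA_mull_cls mulU_linr mtA_lin fA_pure_linl.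
- by case: (n%:Z + e) => [p|p]; [rewrite fA_pure_linr | rewrite scaler0 addr0].
case h : (n%:Z + e) => [p|p] //; rewrite !mtA_mull_cls -fA_pure_bal; congr (fA_pure (mtA_cls _) _).
by apply: mulUA; lia.
Qed.

Lemma fA_mullE e (u : calU e) n m p (x : calU (n%:Z - 0%:Z)) (y : mtA 0 m) :
  n%:Z + e = p%:Z ->
  fA_mull u (fA_pure (mtA_cls x) y) = fA_pure (mtA_cls (mulU (p%:Z - 0%:Z) u x)) y.
Proof.
move=> h; rewrite /fA_mull plift_gen; last exact: fA_mull_compat.
by rewrite /fA_mull_gen /= h mtA_mull_cls.
Qed.

Lemma fA_mulr_compat e (u : calU e) x y : fA_rel x y ->
  leval (fA_mulr_gen u) x = leval (fA_mulr_gen u) y.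
Proof.
case=> {x y} [n m c x x' y|n m c x y y'|n m x a y] /=; rewrite /fA_mulr_gen /=.
- by case: (m%:Z - e) => [p|p]; [rewrite fA_pure_linl | rewrite scaler0 addr0].
- case: (m%:Z - e) => [p|p]; last by rewrite scaler0 addr0.
  have [v ->] := mtA_ex y; have [v' ->] := mtA_ex y'.
  by rewrite -mtA_lin !mtA_mulr_cls mulU_linl mtA_lin fA_pure_linr.
case h : (m%:Z - e) => [p|p] //; rewrite !mtA_mulr_cls fA_pure_bal; congr (fA_pure _ (mtA_cls _)).
by apply: mulUA; lia.
Qed.

Lemma fA_mulrE e (u : calU e) n m p (x : mtA n 0) (y : calU (0%:Z - m%:Z)) :
  m%:Z - e = p%:Z ->
  fA_mulr u (fA_pure x (mtA_cls y)) = fA_pure x (mtA_cls (mulU (0%:Z - p%:Z) y u)).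
Proof.
move=> h; rewrite /fA_mulr plift_gen; last exact: fA_mulr_compat.
by rewrite /fA_mulr_gen /= h mtA_mulr_cls.
Qed.

Lemma fA_star_compatr g x y : fA_rel x y -> leval (fA_star_gen g) x = leval (fA_star_gen g) y.
Proof.
case: g => p d z w; have [z' ->] := mtA_ex z; have [w' ->] := mtA_ex w.
case=> {x y} [n m c x x' y|n m c x y y'|n m x a y] /=; rewrite /fA_star_gen /=.
- have [v ->] := mtA_ex x; have [v' ->] := mtA_ex x'.
  by rewrite -mtA_lin !mtA_mul3_cls mulU_linr mulU_linr mtA_lin fA_pure_linl.
- exact: fA_pure_linr.
rewrite !mtA_mul3_cls -fA_pure_bal; congr (fA_pure (mtA_cls _) _).
have [h|h] := pselect (0%:Z - d%:Z + (n%:Z - 0%:Z) = 0); last first.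
  by rewrite ![mulU 0 w' _]mulU_bad // mulU0 mul0U.
apply: (etrans (y := mulU (p%:Z - 0%:Z) z' (mulU 0 (mulU 0 w' x) a))); last by apply: mulUA; lia.
by congr (mulU _ _ _); apply: mulUA; lia.
Qed.

Lemma fA_star_compatl b' x y : fA_rel x y ->
  leval (fun g => @plift _ _ fA_rel fA (fA_star_gen g) b') x =
  leval (fun g => @plift _ _ fA_rel fA (fA_star_gen g) b') y.
Proof.
rewrite -(qrepK b') => h.
have hE g : @plift _ _ fA_rel fA (fA_star_gen g) (qpi _ (qrep b')) =
    leval (fA_star_gen g) (qrep b').
  by apply: plift_pi => x' y'; exact: fA_star_compatr.
have hS z : leval (fun g => @plift _ _ fA_rel fA (fA_star_gen g) (qpi _ (qrep b'))) z =
    leval (fun g => leval (fA_star_gen g) (qrep b')) z.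
  by elim: z => /= [x0||z -> z' ->|z ->|c z ->].
rewrite !hS; elim: (qrep b') => {hE hS} [[q r v w]||e1 IH1 e2 IH2|e1 IH|c e1 IH].
- have [v' ->] := mtA_ex v.
  case: h => {x y} [n m c x x' y|n m c x y y'|n m x a y] /=; rewrite /fA_star_gen /=.
  + have [x1 ->] := mtA_ex x; have [x1' ->] := mtA_ex x'; have [y1 ->] := mtA_ex y.
    by rewrite -mtA_lin !mtA_mul3_cls mulU_linl mtA_lin fA_pure_linl.
  + have [x1 ->] := mtA_ex x; have [y1 ->] := mtA_ex y; have [y1' ->] := mtA_ex y'.
    by rewrite -mtA_lin !mtA_mul3_cls mulU_linl mulU_linr mtA_lin fA_pure_linl.
  rewrite !mtA_mul3_cls; congr (fA_pure (mtA_cls _) _).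
  apply: (etrans (y := mulU (n%:Z - 0%:Z) x (mulU (0%:Z - 0%:Z) a (mulU 0 y v')))).
    by apply: esym; apply: mulUA; lia.
  congr (mulU _ _ _); have [h|h] := pselect (0%:Z - m%:Z + (q%:Z - 0%:Z) = 0).
    by apply: mulUA; lia.
  by rewrite ![mulU 0 _ v']mulU_bad ?mulU0.
- by case: h => * /=; rewrite ?scaler0 ?addr0.
- have hA z : leval (fun g => leval (fA_star_gen g) (LAdd e1 e2)) z =
      leval (fun g => leval (fA_star_gen g) e1) z + leval (fun g => leval (fA_star_gen g) e2) z.
    elim: z => /= [x0||z -> z' ->|z ->|c z ->] //; [by rewrite addr0|by rewrite addrACA|
      by rewrite opprD|by rewrite scalerDr].
  by rewrite !hA IH1 IH2.
- have hA z : leval (fun g => leval (fA_star_gen g) (LOpp e1)) z =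
      - leval (fun g => leval (fA_star_gen g) e1) z.
    by elim: z => /= [x0||z -> z' ->|z ->|c z ->]; rewrite ?oppr0 ?opprD ?scalerN.
  by rewrite !hA IH.
have hA z : leval (fun g => leval (fA_star_gen g) (LScale c e1)) z =
    c *: leval (fun g => leval (fA_star_gen g) e1) z.
  elim: z => /= [x0||z -> z' ->|z ->|c' z ->]; rewrite ?scaler0 ?scalerDr ?scalerN //.
  by rewrite !scalerA mulrC.
by rewrite !hA IH.
Qed.

Lemma fA_starE n d d' m (x : calU (n%:Z - 0%:Z)) (y : calU (0%:Z - d%:Z))
    (x' : calU (d'%:Z - 0%:Z)) (y' : mtA 0 m) :
  fA_star (fA_pure (mtA_cls x) (mtA_cls y)) (fA_pure (mtA_cls x') y') =
  fA_pure (mtA_cls (mulU (n%:Z - 0%:Z) x (mulU 0 y x'))) y'.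
Proof.
rewrite /fA_star plift_gen; last exact: fA_star_compatl.
by rewrite plift_gen; [rewrite /fA_star_gen /= mtA_mul3_cls | exact: fA_star_compatr].
Qed.

Definition strong_identity (one : nat -> fA) : Prop :=
  one 0%N = @fA_pure 0 0 (@mtA_cls 0 0 oneU) (@mtA_cls 0 0 oneU) /\
  forall d, fA_piece d d (one d) /\
    (forall m a, fA_piece m d a -> fA_star a (one d) = a) /\
    (forall m b, fA_piece d m b -> fA_star (one d) b = b).

(* theta is the continuous anti-automorphism with the given values on the a_[j], which generate
   a dense subalgebra. *)
Record theta_anti (act : forall B : calg k, fps B -> bc V B -> bc V B) (L : moebius A act)
    (theta : forall d, calU d -> calU (- d)) : Prop := ThetaAnti {
  th_linear : forall d, linear (theta d);
  th_bij : forall d, bijective (theta d);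
  th_mul : forall d e f (x : calU d) (y : calU e), d + e = f ->
    theta f (mulU f x y) = mulU (- f) (theta e y) (theta d x);
  th_cont : forall d m, exists p, forall x : calU d, calU_nbhd p x -> calU_nbhd m (theta d x);
  th_gen : forall s a j, gva_gr A s a ->
    theta (s%:Z - 1 - j) (genU (s%:Z - 1 - j) a j) =
    \sum_(i < s.+1) (-1) ^+ s *:
      genU (- (s%:Z - 1 - j)) (mo_L1 L i a) ((2 * s)%N%:Z - j - i%:Z - 2) }.

End Enveloping.

(* Set-valued functors on A-algebras; schemes over A are among them as in Demazure and
   Gabriel: Zariski sheaves covered, on points in fields, by open affine subfunctors. *)
Record kfun (A : comPzRingType) := KFun {
  pts :> calg A -> Type;
  res : forall B C : calg A, ahom B C -> pts B -> pts C;
  res_id : forall (B : calg A) (f : ahom B B) x, f =1 id -> res f x = x;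
  res_comp : forall (B C D : calg A) (f : ahom B C) (g : ahom C D) (h : ahom B D) x,
    h =1 g \o f -> res h x = res g (res f x) }.

Definition is_field (K : comPzRingType) : Prop :=
  1 <> 0 :> K /\ forall x : K, x <> 0 -> exists y, x * y = 1.
Definition is_alg_closed (K : comPzRingType) : Prop :=
  is_field K /\ forall n (c : nat -> K), (0 < n)%N -> exists x, x ^+ n = \sum_(i < n) c i * x ^+ i.

Definition unit_ideal (C : comPzRingType) (J : C -> Prop) : Prop :=
  exists n (c d : 'I_n -> C), (forall i, J (c i)) /\ \sum_i d i * c i = 1.

(* phi exhibits C as the localization of B at f. *)
Definition is_localization (B C : comPzRingType) (f : B) (phi : B -> C) : Prop :=
  [/\ exists c, phi f * c = 1,
      forall c, exists b n, phi f ^+ n * c = phi b &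
      forall b, phi b = 0 -> exists n, f ^+ n * b = 0].

Definition surjective (S T : Type) (f : S -> T) : Prop := forall y, exists x, f x = y.
Definition nilpotent_kernel (B C : comPzRingType) (f : B -> C) : Prop :=
  exists n, forall c : 'I_n -> B, (forall i, f (c i) = 0) -> \prod_i c i = 0.
Definition square_zero_kernel (B C : comPzRingType) (f : B -> C) : Prop :=
  forall b b', f b = 0 -> f b' = 0 -> b * b' = 0.

Record nilt (C : comPzRingType) := Nilt { nval :> C; nvalP : exists n, nval ^+ n = 0 }.

Fixpoint aexp_eval (A : comPzRingType) (B : calg A) (I : Type) (y : I -> B) (e : aexp A I) : B :=
  match e with
  | AGen i => y i
  | AZero => 0
  | AOne => 1
  | AAdd e f => aexp_eval y e + aexp_eval y f
  | AOpp e => - aexp_eval y e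
  | AMul e f => aexp_eval y e * aexp_eval y f
  | AScale a e => calg_str B a * aexp_eval y e
  end.

(* D = A[x_1, ..., x_n] / (r_1, ..., r_m) *)
Definition fin_presented (A : comPzRingType) (D : calg A) : Prop :=
  exists n (x : 'I_n -> D) m (r : 'I_m -> aexp A 'I_n),
    (forall j, aexp_eval x (r j) = 0) /\
    forall (B : calg A) (y : 'I_n -> B), (forall j, aexp_eval y (r j) = 0) ->
      exists f : ahom D B, (forall i, f (x i) = y i) /\
        forall g : ahom D B, (forall i, g (x i) = y i) -> g =1 f.

Definition flat_alg (A : comPzRingType) (D : calg A) : Prop :=
  forall (M N : lmodType A) (f : {linear M -> N}), injective f ->
  forall l : seq (D * M), bc_sum [seq (x.1, f x.2) | x <- l] = 0 -> bc_sum l = 0.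

Definition module_finite (A : comPzRingType) (B E : calg A) (e : B -> E) : Prop :=
  exists n (g : 'I_n -> E), forall x, exists c : 'I_n -> B, x = \sum_i e (c i) * g i.

(* Smoothness of Spec D over Spec A. *)
Definition smooth_alg (A : comPzRingType) (D : calg A) : Prop :=
  fin_presented D /\
  forall (B C : calg A) (g : ahom B C) (f : ahom D C), surjective g -> square_zero_kernel g ->
    exists f' : ahom D B, g \o f' =1 f.

Section Functors.
Variables (A : comPzRingType) (X : kfun A).

Definition subfun := forall B : calg A, X B -> Prop.

Definition zariski_sheaf : Prop :=
  forall (B : calg A) n (f a : 'I_n -> B), \sum_i a i * f i = 1 ->
  forall (C : 'I_n -> calg A) (phi : forall i, ahom B (C i))
         (D : 'I_n -> 'I_n -> calg A) (psi : forall i j, ahom (C i) (D i j))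
         (psi' : forall i j, ahom (C j) (D i j)),
  (forall i, is_localization (f i) (phi i)) ->
  (forall i j, is_localization (f i * f j) (psi i j \o phi i) /\
               psi i j \o phi i =1 psi' i j \o phi j) ->
  forall x : forall i, X (C i), (forall i j, res (psi i j) (x i) = res (psi' i j) (x j)) ->
  exists y, (forall i, res (phi i) y = x i) /\
    forall y', (forall i, res (phi i) y' = x i) -> y' = y.

Definition is_open (U : subfun) : Prop :=
  forall (B : calg A) (x : X B), exists J : B -> Prop, forall (C : calg A) (f : ahom B C),
    U C (res f x) <-> unit_ideal (fun c => exists2 b, J b & c = f b).

(* The subfunctor U is isomorphic to Spec D. *)
Definition represents (U : subfun) (D : calg A) : Prop :=
  exists2 x : X D, (forall (B : calg A) (f : ahom D B), U B (res f x)) &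
  forall (B : calg A) (y : X B), U B y -> exists f : ahom D B, res f x = y /\
    forall g : ahom D B, res g x = y -> g =1 f.

(* A scheme with a finite cover by spectra of finitely presented A-algebras. *)
Definition fp_scheme : Prop :=
  zariski_sheaf /\ exists n (U : 'I_n -> subfun) (D : 'I_n -> calg A),
    (forall i, [/\ is_open (U i), represents (U i) (D i) & fin_presented (D i)]) /\
    forall K : calg A, is_field K -> forall x : X K, exists i, U i K x.

Definition flat_scheme : Prop :=
  forall (U : subfun) (D : calg A), is_open U -> represents U D -> flat_alg D.

(* The diagonal is a closed immersion. *)
Definition separated : Prop :=
  forall (B : calg A) (x y : X B), exists J : B -> Prop, forall (C : calg A) (f : ahom B C),
    res f x = res f y <-> forall b, J b -> f b = 0.

(* For every B, the image in Spec B of a closed subset of X x Spec B, given as the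
   complement of an open subfunctor U, is closed. *)
Definition universally_closed : Prop :=
  forall (B : calg A) (U : forall C : calg A, ahom B C -> X C -> Prop),
  (forall (C : calg A) (h : ahom B C) (x : X C), exists J : C -> Prop,
     forall (D : calg A) (f : ahom C D) (h' : ahom B D), h' =1 f \o h ->
       (U D h' (res f x) <-> unit_ideal (fun d => exists2 c, J c & d = f c))) ->
  exists J : B -> Prop, forall K : calg A, is_field K -> forall h : ahom B K,
    (forall b, J b -> h b = 0) <->
    exists (L : calg A) (g : ahom K L) (h' : ahom B L) (x : X L),
      [/\ is_field L, h' =1 g \o h & ~ U L h' x].

Definition proper : Prop := [/\ fp_scheme, separated & universally_closed].

(* Infinitesimal lifting on the subfunctor U. *)
Definition formally_smooth_on (U : subfun) : Prop :=
  forall (B C : calg A) (g : ahom B C) (y : X C), surjective g -> square_zero_kernel g ->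
    U C y -> exists x : X B, res g x = y.

(* y and z agree modulo a nilpotent ideal of C. *)
Definition inf_near (C : calg A) (y z : X C) : Prop :=
  exists (D : calg A) (g : ahom C D),
    [/\ surjective g, nilpotent_kernel g & res g y = res g z].

(* A formal coordinate at a point x of X over B, i.e. an isomorphism over B of Spf B[[t]]
   with the completion of X_B along x, sending t = 0 to x. *)
Record fcoord (B : calg A) := FCoord {
  fc : forall C : calg A, ahom B C -> nilt C -> X C;
  fc_center : X B;
  fc_nat : forall (C D : calg A) (f : ahom B C) (g : ahom C D) (h : ahom B D)
    (e : nilt C) (d : nilt D), h =1 g \o f -> nval d = g (nval e) -> fc h d = res g (fc f e);
  fc_zero : forall (C : calg A) (f : ahom B C) (e : nilt C), nval e = 0 ->
    fc f e = res f fc_center;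
  fc_inj : forall (C : calg A) (f : ahom B C) (e d : nilt C),
    fc f e = fc f d -> nval e = nval d;
  fc_near : forall (C : calg A) (f : ahom B C) (e : nilt C),
    inf_near (fc f e) (res f fc_center);
  fc_surj : forall (C : calg A) (f : ahom B C) (y : X C),
    inf_near y (res f fc_center) -> exists e, fc f e = y }.

(* The completion of X_B along x is isomorphic to Spf B[[u, v]]/(uv). *)
Definition is_node (B : calg A) (x : X B) : Prop :=
  exists eta : forall C : calg A, ahom B C -> nilt C -> nilt C -> X C,
  [/\ forall (C D : calg A) (f : ahom B C) (g : ahom C D) (h : ahom B D) (u v : nilt C)
        (u' v' : nilt D), h =1 g \o f -> nval u' = g (nval u) -> nval v' = g (nval v) ->
        nval u * nval v = 0 -> eta D h u' v' = res g (eta C f u v),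
      forall (C : calg A) (f : ahom B C) (u v : nilt C), nval u = 0 -> nval v = 0 ->
        eta C f u v = res f x,
      forall (C : calg A) (f : ahom B C) (u v u' v' : nilt C), nval u * nval v = 0 ->
        nval u' * nval v' = 0 -> eta C f u v = eta C f u' v' ->
        nval u = nval u' /\ nval v = nval v' &
      forall (C : calg A) (f : ahom B C) (y : X C), inf_near y (res f x) <->
        exists u v : nilt C, nval u * nval v = 0 /\ eta C f u v = y].

Definition section := X (calg_id A).
Definition sect_at (P : section) (B : calg A) : X B := res (str_hom B) P.
Definition sect_disjoint (P Q : section) : Prop :=
  forall B : calg A, sect_at P B = sect_at Q B -> 1 = 0 :> B.

(* The open complement of the sections P_i. *)
Definition sect_compl (I : Type) (P : I -> section) : subfun :=
  fun B x => forall i (C : calg A) (f : ahom B C), res f x = sect_at (P i) C -> 1 = 0 :> C.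

(* A smooth proper curve: smooth of relative dimension one. *)
Definition smooth_curve : Prop :=
  [/\ proper, formally_smooth_on (fun _ _ => True) &
      forall K : calg A, is_alg_closed K -> forall x : X K,
        exists c : fcoord K, fc_center c = x].

(* A flat proper curve whose geometric fibres have Q as their only singular point, which
   is an ordinary node. *)
Definition one_nodal_curve (Q : section) : Prop :=
  [/\ proper, flat_scheme &
      forall K : calg A, is_alg_closed K -> forall x : X K,
        (x = sect_at Q K /\ is_node x) \/
        (x <> sect_at Q K /\ exists c : fcoord K, fc_center c = x)].

End Functors.

Record nmap (A : comPzRingType) (X Y : kfun A) := NMap {
  nm :> forall B : calg A, X B -> Y B;
  nm_nat : forall (B C : calg A) (f : ahom B C) (x : X B), nm (res f x) = res f (nm x) }.

Definition finite_map (A : comPzRingType) (X Y : kfun A) (p : nmap X Y) : Prop :=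
  forall (B : calg A) (y : Y B), exists (E : calg A) (e : ahom B E) (x : X E),
    [/\ module_finite e, p E x = res e y &
        forall (C : calg A) (f : ahom B C) (z : X C), p C z = res f y ->
          exists g : ahom E C, [/\ g \o e =1 f, res g x = z &
            forall g' : ahom E C, g' \o e =1 f -> res g' x = z -> g' =1 g]].

(* The normalization of a curve with the single node Q, with Q' and Q'' over Q: a finite map
   from a smooth curve which is an isomorphism away from Q. *)
Record is_normalization (A : comPzRingType) (X Y : kfun A) (p : nmap X Y)
    (Q : section Y) (Q' Q'' : section X) : Prop := IsNormalization {
  nz_smooth : smooth_curve X;
  nz_finite : finite_map p;
  nz_iso : forall (B : calg A) (y : Y B), sect_compl (fun _ : unit => Q) y ->
    exists x, p B x = y /\ forall x', p B x' = y -> x' = x;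
  nz_left : p _ Q' = Q;
  nz_right : p _ Q'' = Q;
  nz_disjoint : sect_disjoint Q' Q'';
  nz_fibre : forall K : calg A, is_alg_closed K -> forall x : X K,
    p K x = sect_at Q K <-> x = sect_at Q' K \/ x = sect_at Q'' K }.

Section Smoothing.
Variables (k : fieldType) (R : calg k) (n : nat).

Record smoothing := Smoothing {
  sm_base : smooth_alg R;
  (* the nodal curve C_0 over Spec R *)
  sm_C0 : kfun R;
  sm_Q : section sm_C0;
  sm_P : 'I_n -> section sm_C0;
  sm_nodal : one_nodal_curve sm_Q;
  sm_P_disjoint : forall i j, i != j -> sect_disjoint (sm_P i) (sm_P j);
  sm_P_smooth : forall i, sect_disjoint (sm_P i) sm_Q;
  sm_affine : exists D, represents (sect_compl sm_P) D;
  (* its normalization *)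
  sm_N0 : kfun R;
  sm_nu : nmap sm_N0 sm_C0;
  sm_Qp : section sm_N0;
  sm_Qm : section sm_N0;
  sm_normalization : is_normalization sm_nu sm_Q sm_Qp sm_Qm;
  (* formal coordinates at the P_i, which lie away from the node, and at Q_+, Q_- *)
  sm_t : 'I_n -> fcoord sm_N0 (calg_id R);
  sm_tP : forall i, sm_nu _ (fc_center (sm_t i)) = sm_P i;
  sm_sp : fcoord sm_N0 (calg_id R);
  sm_sm : fcoord sm_N0 (calg_id R);
  sm_sp_center : fc_center sm_sp = sm_Qp;
  sm_sm_center : fc_center sm_sm = sm_Qm;
  (* the total family C over Spec R[[q]], with its coordinates at the marked sections *)
  sm_C : kfun (fps R);
  sm_C_proper : proper sm_C;
  sm_C_flat : flat_scheme sm_C;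
  sm_C_smooth : formally_smooth_on
    (fun (B : calg (fps R)) (_ : sm_C B) => exists b, calg_str B (fps_Xn R 1) * b = 1);
  sm_CP : 'I_n -> fcoord sm_C (calg_id (fps R));
  (* the special fibre *)
  sm_kappa : forall B : calg R, sm_C (calg_q0 B) -> sm_C0 B;
  sm_kappa_nat : forall (B C : calg R) (f : ahom B C) (x : sm_C (calg_q0 B)),
    sm_kappa (res (q0_hom f) x) = res f (sm_kappa x);
  sm_kappa_bij : forall B : calg R, bijective (@sm_kappa B);
  sm_kappa_t : forall i (B : calg R) (e : nilt B) (e' : nilt (calg_q0 B)),
    nval e = nval e' -> sm_kappa (fc (sm_CP i) (str_hom (calg_q0 B)) e') =
                        sm_nu _ (fc (sm_t i) (str_hom B) e);
  (* the completion of C along Q is s_+ s_- = q *)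
  sm_eta : forall B : calg (fps R), nilt B -> nilt B -> sm_C B;
  sm_eta_nat : forall (B C : calg (fps R)) (f : ahom B C) (u v : nilt B) (u' v' : nilt C),
    nval u * nval v = calg_str B (fps_Xn R 1) -> nval u' = f (nval u) -> nval v' = f (nval v) ->
    sm_eta u' v' = res f (sm_eta u v);
  sm_eta_inj : forall (B : calg (fps R)) (u v u' v' : nilt B),
    nval u * nval v = calg_str B (fps_Xn R 1) ->
    nval u' * nval v' = calg_str B (fps_Xn R 1) ->
    sm_eta u v = sm_eta u' v' -> nval u = nval u' /\ nval v = nval v';
  sm_eta_image : forall (B : calg (fps R)) (y : sm_C B),
    (exists u v : nilt B, nval u * nval v = calg_str B (fps_Xn R 1) /\ sm_eta u v = y) <->
    (exists (D : calg R) (g : ahom B (calg_q0 D)), [/\ surjective g, nilpotent_kernel g &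
       sm_kappa (res g y) = sect_at sm_Q D]);
  sm_eta_branchp : forall (B : calg R) (e : nilt B) (u v : nilt (calg_q0 B)),
    nval u = nval e -> nval v = 0 ->
    sm_kappa (sm_eta u v) = sm_nu _ (fc sm_sp (str_hom B) e);
  sm_eta_branchm : forall (B : calg R) (e : nilt B) (u v : nilt (calg_q0 B)),
    nval u = 0 -> nval v = nval e ->
    sm_kappa (sm_eta u v) = sm_nu _ (fc sm_sm (str_hom B) e) }.

End Smoothing.

Section ChiralSections.
Variables (k : fieldType) (V : lmodType k) (A : graded_va V).
Variables (act : forall B : calg k, fps B -> bc V B -> bc V B).
Variables (R : calg k) (X : kfun R) (U : subfun X).

(* Sections over U of (V (x) pi_* O_Aut)^{Aut O} (x) omega: functions on the torsor of
   formal coordinates with values in V, a value v at the coordinate t standing for v dt. *)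
Definition vsec := forall (B : calg R) (c : fcoord X B), U (fc_center c) -> bc V (calg_res B).

Record is_vsec (sg : vsec) : Prop := IsVSec {
  vs_natural : forall (B C : calg R) (g : ahom B C) (c : fcoord X B) (c' : fcoord X C) hU hU' l,
    (forall (D : calg R) (f : ahom C D) (h : ahom B D) (e : nilt D), h =1 f \o g ->
       fc c' f e = fc c h e) ->
    sg B c hU = bc_sum l -> sg C c' hU' = @bc_sum _ V (calg_res C) [seq (g x.1, x.2) | x <- l];
  (* c' is the coordinate t' = rho(t), where t is the coordinate c; there
     (v, t) ~ (Pi(rho)^-1 v, rho(t)) and dt' = rho_1 dt. *)
  vs_equivariant : forall (B : calg R) (c c' : fcoord X B) (rho : fps B) hU hU', is_autO rho ->
    (forall (D : calg R) (f : ahom B D) (e d : nilt D) N, nval e ^+ N = 0 ->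
       nval d = \sum_(i < N) f (rho i) * nval e ^+ i -> fc c f e = fc c' f d) ->
    sg B c hU = @act (calg_res B) rho ((rho 1%N : calg_res B) *: sg B c' hU') }.

(* e is the expansion of sg in the coordinate s of the section P given by c: the value of sg
   at the point Spec R((s)) -> X, in the coordinate s' - s there. The R[[s]]-point extending
   the infinitesimal points of c is xh. *)
Definition expansion (sg : vsec) (c : fcoord X (calg_id R))
    (e : bc V (calg_res (calg_laur R))) : Prop :=
  exists (xh : X (calg_fps R)) (cl : fcoord X (calg_laur R)) (hU : U (fc_center cl)),
  [/\ forall (C : calg R) (g : ahom (calg_fps R) C) (d : nilt C),
        nval d = g (fps_Xn R 1) -> res g xh = fc c (str_hom C) d,
      forall (C : calg R) (f : ahom (calg_laur R) C) (d : nilt C) (g : ahom (calg_fps R) C) N,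
        nval d ^+ N = 0 ->
        (forall F, g F = \sum_(i < N) f (laur_of (fhasse i F)) * nval d ^+ i) ->
        fc cl f d = res g xh &
      e = sg _ cl hU].

(* Finite sums of v (x) f(s), with v homogeneous of the degree recorded. *)
Definition vterms := seq (nat * V * laur R).
Definition vterms_hom (l : vterms) : Prop := forall x, x \in l -> gva_gr A x.1.1 x.1.2.
Definition vterms_val (l : vterms) : bc V (calg_res (calg_laur R)) :=
  \sum_(x <- l) (x.2 : calg_res (calg_laur R)) *: bc_pure _ x.1.2.

(* The span of the \sum_(i <= p) T^(i) a (x) d^(p-i) f, p > 0, for f in R((s)). *)
Definition nabla_im (e : bc V (calg_res (calg_laur R))) : Prop :=
  exists l : seq (nat * V * laur R), (forall x, x \in l -> (0 < x.1.1)%N) /\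
    e = \sum_(x <- l) \sum_(i < x.1.1.+1)
          (lhasse (x.1.1 - i) x.2 : calg_res (calg_laur R)) *: bc_pure _ (va_T A i x.1.2).

Variable L : moebius A act.

(* The coefficient of q^j in \sum_(i,j) al_(i,j) a_[deg a + i - j - 1] q^j. *)
Definition nodal_plus (s : nat) (a : V) (al : nat -> nat -> R) (j : nat) :
    bc V (calg_res (calg_laur R)) :=
  (lmono (s%:Z - j%:Z - 1) (fun i => al i j) : calg_res (calg_laur R)) *: bc_pure _ a.

(* The coefficient of q^i in - \sum_(i,j) al_(i,j) theta(a_[deg a + i - j - 1]) q^i. *)
Definition nodal_minus (s : nat) (a : V) (al : nat -> nat -> R) (i : nat) :
    bc V (calg_res (calg_laur R)) :=
  - \sum_(l < s.+1) ((-1) ^+ s * lmono (s%:Z - i%:Z - 1 - l%:Z) (fun j => al i j)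
        : calg_res (calg_laur R)) *: bc_pure _ (mo_L1 L l a).

End ChiralSections.

Section Coinvariants.
Variables (k : fieldType) (V : lmodType k) (A : graded_va V).
Variables (act : forall B : calg k, fps B -> bc V B -> bc V B) (L : moebius A act).
Variable theta : forall d, calU A d -> calU A (- d).
Variables (R : calg k) (n : nat) (S : smoothing R n).
Variables (M : 'I_n -> lmodType k) (mods : forall i, adm_module A (M i)).

(* The marked sections of the normalization: the P_i, then Q_+ (true) and Q_- (false). *)
Definition mark := ('I_n + bool)%type.
Definition mark_coord (p : mark) : fcoord (sm_N0 S) (calg_id R) :=
  match p with
  | inl i => sm_t S i
  | inr true => sm_sp S
  | inr false => sm_sm S
  end.

Definition punctured : subfun (sm_N0 S) := sect_compl (fun p => fc_center (mark_coord p)).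

(* The families of expansions, at the marked sections, of elements of the chiral Lie algebra of
   the punctured normalization. Classes modulo Im nabla are given by representatives: Im nabla
   acts by zero on every module. *)
Definition chiral (l : mark -> vterms V R) : Prop :=
  exists sg : vsec V punctured, is_vsec act sg /\
    forall p, vterms_hom A (l p) /\ expansion sg (mark_coord p) (vterms_val (l p)).

(* The generators of the chiral Lie algebra of C \ P: series \sum_m sigma_m q^m of sections
   over the punctured normalization, with prescribed expansions at Q_+ and Q_- modulo
   the image of nabla. *)
Definition chiral_nodal (l : nat -> mark -> vterms V R) : Prop :=
  (forall m, chiral (l m)) /\
  exists s a al, [/\ gva_gr A s a,
    forall j, nabla_im A (vterms_val (l j (inr true)) - nodal_plus s a al j) &
    forall i, nabla_im A (vterms_val (l i (inr false)) - nodal_minus L s a al i)].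

(* The same with q = 0. *)
Definition chiral_nodal0 (l : mark -> vterms V R) : Prop :=
  chiral l /\
  exists s a al, [/\ gva_gr A s a,
    nabla_im A (vterms_val (l (inr true)) - nodal_plus s a al 0) &
    nabla_im A (vterms_val (l (inr false)) - nodal_minus L s a al 0)].

(* y = \sum_p sigma_p u, where v (x) s^m at p acts by op p (deg v) v m. *)
Definition acts (N : lmodType R) (I : finType) (op : I -> nat -> V -> int -> N -> N)
    (l : I -> vterms V R) (u y : N) : Prop :=
  exists K0, forall K, (K0 <= K)%N ->
    y = \sum_(p : I) \sum_(x <- l p) \sum_(m < K.*2.+1)
          x.2 (m%:Z - K%:Z) *: op p x.1.1 x.1.2 (m%:Z - K%:Z) u.

Definition acts_q (N : lmodType R) (I : finType) (op : I -> nat -> V -> int -> N -> N)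
    (l : nat -> I -> vterms V R) (u y : qser N) : Prop :=
  exists z : nat -> nat -> N, (forall i j, acts op (l i) (u j) (z i j)) /\
    forall m, y m = \sum_(i < m.+1) z i (m - i)%N.

Definition modP := tens R M.
HB.instance Definition _ := GRing.Lmodule.on modP.

Definition extM (o : option 'I_n) : lmodType k :=
  match o with Some i => M i | None => fA A end.
Definition modPQ := tens R extM.
HB.instance Definition _ := GRing.Lmodule.on modPQ.

Definition opP (i : 'I_n) (s : nat) (v : V) (m : int) : modP -> modP :=
  @tens_at _ R _ M i (am_md (mods i) v m).

Definition opPQ (p : mark) (s : nat) (v : V) (m : int) : modPQ -> modPQ :=
  match p with
  | inl i => @tens_at _ R _ extM (Some i) (am_md (mods i) v m)
  | inr true => @tens_at _ R _ extM None (fA_mull (genU A (s%:Z - 1 - m) v m))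
  | inr false => @tens_at _ R _ extM None (fA_mulr (theta (genU A (s%:Z - 1 - m) v m)))
  end.

(* The coinvariants of C, C_0, the trivial extension of the normalization (whose sections are
   series in q of sections over the normalization of C_0), and the normalization of C_0. *)
Definition coinv_C := lquot (fun y : qser modP =>
  exists l u, chiral_nodal l /\ acts_q opP (fun m i => l m (inl i)) u y).
Definition coinv_C0 := lquot (fun y : modP =>
  exists l u, chiral_nodal0 l /\ acts opP (fun i => l (inl i)) u y).
Definition coinv_N := lquot (fun y : qser modPQ =>
  exists l u, (forall m, chiral (l m)) /\ acts_q opPQ l u y).
Definition coinv_N0 := lquot (fun y : modPQ =>
  exists l u, chiral l /\ acts opPQ l u y).
HB.instance Definition _ := GRing.Lmodule.on coinv_C.
HB.instance Definition _ := GRing.Lmodule.on coinv_C0.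
HB.instance Definition _ := GRing.Lmodule.on coinv_N.
HB.instance Definition _ := GRing.Lmodule.on coinv_N0.

Definition cls_C (u : qser modP) : coinv_C := lcls _ u.
Definition cls_C0 (u : modP) : coinv_C0 := lcls _ u.
Definition cls_N0 (u : modPQ) : coinv_N0 := lcls _ u.

Definition ext_pure (w : forall i, M i) (b : fA A) (o : option 'I_n) : extM o :=
  match o with Some i => w i | None => b end.

(* u |-> u (x) b *)
Definition tens_with (b : fA A) : modP -> modPQ :=
  @plift _ _ (@tens_rel _ R _ M) modPQ (fun w => @tens_pure _ R _ extM (ext_pure w b)).

Lemma ext_pure_dfwith w b i (x : M i) :
  ext_pure (dfwith w x) b = @dfwith _ extM (ext_pure w b) (Some i) x.
Proof.
apply: functional_extensionality_dep => -[j|]; last by rewrite dfwith_out.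
have [e|ne] := eqVneq i j; last by rewrite /= !dfwith_out.
by case: j / e; rewrite /= dfwith_in (@dfwith_in _ extM).
Qed.

Lemma tens_with_compat b e e' : @tens_rel _ R _ M e e' ->
  leval (fun w => @tens_pure _ R _ extM (ext_pure w b)) e =
  leval (fun w => @tens_pure _ R _ extM (ext_pure w b)) e'.
Proof.
apply: tens_lift_compat => w i a x y; rewrite !ext_pure_dfwith.
exact: (@tens_pureP _ R _ extM).
Qed.

Lemma tens_withE w b : tens_with b (tens_pure R w) = @tens_pure _ R _ extM (ext_pure w b).
Proof. by apply: plift_gen; exact: tens_with_compat. Qed.

Lemma tens_with_linear b : linear (tens_with b).
Proof. by apply: plift_linear; exact: tens_with_compat. Qed.

(* \sum_n u_n q^n |-> \sum_(n,d) (u_n (x) one_d) q^(n+d) *)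
Definition alphaq (one : nat -> fA A) (u : qser modP) : qser modPQ :=
  fun m => \sum_(i < m.+1) tens_with (one (m - i)%N) (u i).

End Coinvariants.

(* Main.v *)
(* Only the actions at Q_+ and Q_- obstruct alpha from descending to coinvariants. Write one_d for
   the strong identity element of degree d. An element x of degree e of the completed enveloping
   algebra satisfies x . one_d = one_{d+e} . x: both lie in the summand (d + e, -d) of the mode
   transition algebra, and star-multiplying them by one_{d+e} on the left, one_d on the right
   shows that they agree. For a section with sigma_{Q_+} = \sum al_(i,j) x_(i,j) q^j and
   sigma_{Q_-} = - \sum al_(i,j) theta(x_(i,j)) q^i, x_(i,j) of degree j - i, the coefficient of
   q^c in the action on \sum_d one_d q^d is therefore, using theta o theta = id,
     \sum_(i,j <= c) al_(i,j) (x_(i,j) . one_(c-j) - one_(c-i) . x_(i,j)) = 0.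
   Expansions are only prescribed up to the image of nabla, so one also needs that the action of
   V (x) R((s)) is well defined and kills this image; this is checked degree by degree. *)
Require Import Defs.
From HB Require Import structures.
From mathcomp Require Import all_boot all_order all_algebra.
From mathcomp Require Import boolp zify.
Set Implicit Arguments. Unset Strict Implicit. Unset Printing Implicit Defensive.
Import GRing.Theory.
Local Open Scope ring_scope.

(** * Maps out of quotient modules and rearrangement of finite sums *)

Lemma lspan_lift (R : pzRingType) (M : lmodType R) (N : M -> Prop) (Y : lmodType R)
    (f : {linear M -> Y}) :
  (forall x, N x -> f x = 0) -> forall x, lspan N x -> f x = 0.
Proof.
move=> h x; elim=> {x} [x /h //||x y _ IHx _ IHy|a x _ IH].
- exact: linear0.
- by rewrite linearD IHx IHy addr0.
by rewrite linearZ /= IH scaler0.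
Qed.

Lemma lquot_lift (R : pzRingType) (M : lmodType R) (N : M -> Prop) (Y : lmodType R)
    (f : {linear M -> Y}) : (forall x, N x -> f x = 0) ->
  exists g : {linear lquot N -> Y}, forall x, g (lcls N x) = f x.
Proof.
move=> h; pose g (q : lquot N) := f (qrep q).
have gE x : g (lcls N x) = f x.
  by apply/subr0_eq; rewrite -linearB; apply: lspan_lift h _ _; exact: lrep_cls.
have g_lin : linear g.
  move=> a p q; rewrite -(qrepK p) -(qrepK q) -!/(lcls N _) -lcls_linear !gE.
  by rewrite linearP.
by exists (HB.pack_for {linear lquot N -> Y} g (GRing.isLinear.Build _ _ _ _ g g_lin)).
Qed.

HB.instance Definition _ (R : pzRingType) (M : lmodType R) (N : M -> Prop) :=
  GRing.isLinear.Build R M (lquot N) *:%R (lcls N) (lcls_linear N).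

(** Both sides run over the triples (i, j, b) with i + j + b = m; the left side groups them by a = i
    + j. *)
Lemma sum_triangle (Z : zmodType) (m : nat) (W : nat -> nat -> nat -> Z) :
  \sum_(a < m.+1) \sum_(i < a.+1) W i (a - i)%N (m - a)%N =
  \sum_(i < m.+1) \sum_(j < (m - i).+1) W i j (m - i - j)%N.
Proof.
transitivity (\sum_(0 <= a < m.+1) \sum_(0 <= i < m.+1 | (i <= a)%N) W i (a - i)%N (m - a)%N).
  rewrite big_mkord; apply: eq_bigr => a _.
  by rewrite [RHS]big_mkord (big_ord_widen m.+1 (fun i => W i (a - i)%N (m - a)%N)).
rewrite (exchange_big_dep_nat predT) //= big_mkord; apply: eq_bigr => i _.
have le : (i <= m)%N by rewrite -ltnS.
rewrite -(big_nat_widenl i 0 m.+1 predT) // -{1}[i : nat]add0n big_addn subSn // big_mkord.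
by apply: eq_bigr => j _; rewrite addnK subnDA subnAC.
Qed.

Lemma sum_support (I : eqType) (Z : zmodType) (F : I -> Z) (r r' : seq I) :
  uniq r -> uniq r' -> (forall i, F i != 0 -> (i \in r) && (i \in r')) ->
  \sum_(i <- r) F i = \sum_(i <- r') F i.
Proof.
move=> ur ur' h.
have hE s : \sum_(i <- s) F i = \sum_(i <- [seq i <- s | F i != 0]) F i.
  rewrite big_filter [RHS]big_mkcond; apply: eq_bigr => i _.
  by case: eqP.
rewrite hE [RHS]hE; apply: perm_big; apply: uniq_perm; rewrite ?filter_uniq // => i.
by rewrite !mem_filter; case: eqP => //= /eqP /h /andP[-> ->].
Qed.

(** * Homogeneous components of a vector *)

Section HomogeneousParts.
Variables (k : fieldType) (V : lmodType k) (gr : nat -> V -> Prop) (H : grading gr).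

(** Components are recorded in all degrees, with 0 from some degree on, so that decompositions of
    different lengths can be added and compared. *)
Definition decomposes (x : V) (c : nat -> V) : Prop :=
  (forall s, gr s (c s)) /\
  exists n, (forall s, (n <= s)%N -> c s = 0) /\ x = \sum_(s < n) c s.

Lemma decomposes_ex x : exists c, decomposes x c.
Proof.
have [n [c [hc ->]]] := gr_span H x.
(* For s >= n, [gr_span] only makes [c s] homogeneous; these values are replaced by 0. *)
exists (fun s => if (s < n)%N then c s else 0); split=> [s|].
  by case: ifP => _; [exact: hc | exact: (gr0 H)].
exists n; split=> [s|]; first by rewrite ltnNge => ->.
by apply: eq_bigr => i _; rewrite ltn_ord.
Qed.

Lemma sum_eventually0 (Z : zmodType) (c : nat -> Z) n m : (n <= m)%N ->
  (forall s, (n <= s)%N -> c s = 0) -> \sum_(s < n) c s = \sum_(s < m) c s.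
Proof.
move=> le h; rewrite (big_ord_widen m c le) [LHS]big_mkcond.
by apply: eq_bigr => s _; case: ltnP => // /h ->.
Qed.

Lemma decomposes_lin a x y c d : decomposes x c -> decomposes y d ->
  decomposes (a *: x + y) (fun s => a *: c s + d s).
Proof.
move=> [hc [n [hn ex]]] [hd [m [hm ey]]]; split=> [s|]; first exact: (grD H).
have le1 := leq_maxl n m; have le2 := leq_maxr n m.
exists (maxn n m); split=> [s h|].
  by rewrite hn ?hm ?scaler0 ?addr0 // (leq_trans _ h).
by rewrite ex ey (sum_eventually0 le1 hn) (sum_eventually0 le2 hm) scaler_sumr -big_split.
Qed.

Lemma decomposes_eq x c d : decomposes x c -> decomposes x d -> c =1 d.
Proof.
move=> hc hd s; apply/subr0_eq.
have [hg [n [hn]]] := decomposes_lin (-1) hd hc; rewrite scaleN1r addNr => /esym e.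
rewrite addrC -scaleN1r; case: (ltnP s n) => [lt|/hn //].
exact: (gr_free H hg e lt).
Qed.

Definition hom_part (s : nat) (x : V) : V := projT1 (cid (decomposes_ex x)) s.

Lemma hom_partP x : decomposes x (hom_part^~ x).
Proof. exact: (projT2 (cid (decomposes_ex x))). Qed.

(** Decompositions are chosen for each vector separately; their uniqueness makes the choices
    compatible. *)
Lemma hom_part_linear s : linear (hom_part s).
Proof.
move=> a x y.
exact: (decomposes_eq (hom_partP _) (decomposes_lin a (hom_partP x) (hom_partP y)) s).
Qed.

HB.instance Definition _ s :=
  GRing.isLinear.Build k V V *:%R (hom_part s) (hom_part_linear s).

Lemma hom_part_gr s x : gr s (hom_part s x).
Proof. by case: (hom_partP x). Qed.

Lemma hom_part_id s x t : gr s x -> hom_part t x = if t == s then x else 0.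
Proof.
move=> h; apply: (decomposes_eq (d := fun t => if t == s then x else 0) (hom_partP x)).
split=> [r|]; first by case: eqP => [->|_] //; exact: (gr0 H).
exists s.+1; split=> [r lt|]; first by rewrite gtn_eqF.
rewrite big_ord_recr /= eqxx big1 ?add0r // => i _.
by rewrite ltn_eqF.
Qed.

End HomogeneousParts.

(** * Modes in the completed enveloping algebra *)

Section Generators.
Variables (k : fieldType) (V : lmodType k) (A : graded_va V).

Lemma va_T_linear n : linear (va_T A n).
Proof. move=> c x y; exact: (va_bilin A).1. Qed.

HB.instance Definition _ n :=
  GRing.isLinear.Build k V V *:%R (va_T A n) (va_T_linear n).

Lemma va_T_gr s n a : gva_gr A s a -> gva_gr A (s + n) (va_T A n a).
Proof.
move=> h; have := gva_deg (-1 - n%:Z) h (gva_vac A).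
by rewrite (_ : s%:Z + 0%:Z - 1 - (-1 - n%:Z) = (s + n)%N%:Z) //; lia.
Qed.

Lemma agen_linear : linear (agen (@env_rel k V A)).
Proof.
move=> c x y; rewrite [c *: agen _ _]palg_scaleE [RHS]palg_addE.
by apply/palg_eq/aeqv_rel; exact: env_linear.
Qed.

HB.instance Definition _ := GRing.isLinear.Build k (lieV A) (env A) *:%R
  (agen (@env_rel k V A)) agen_linear.

Lemma loop_gen_linear m c (a b : V) :
  loop_gen (c *: a + b) m = c *: loop_gen a m + loop_gen b m.
Proof.
rewrite [c *: loop_gen a m]pmod_scaleE [RHS]pmod_addE.
by apply/pmod_eq/leqv_rel; exact: loop_relE.
Qed.

Lemma env_gen_linear m c (a b : V) :
  env_gen A (c *: a + b) m = c *: env_gen A a m + env_gen A b m.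
Proof. by rewrite /env_gen /lie_gen loop_gen_linear 2!linearP. Qed.

(** The sum is the image under the linear map [agen] of a relator of [lieV]. *)
Lemma env_gen_nabla p a m : (0 < p)%N ->
  \sum_(i < p.+1) env_gen A (va_T A i a) (m - (p - i)%N%:Z) *~ binz m (p - i) = 0.
Proof.
move=> p_gt0; pose x := \sum_(i < p.+1)
  loop_gen (va_T A i a) (m - (p - i)%N%:Z) *~ binz m (p - i).
have x0 : lcls (@loop_der k V A) x = 0.
  by apply/lcls_eq; rewrite subr0; apply: lspan_in; exists p, a, m.
have := congr1 (agen (@env_rel k V A)) x0; rewrite linear0 => e; rewrite -[RHS]e.
rewrite /x !linear_sum; apply: eq_bigr => i _.
by rewrite !raddfMz.
Qed.

Lemma env_gen_deg d s a m : gva_gr A s a -> d = s%:Z - 1 - m -> env_deg d (env_gen A a m).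
Proof. by move=> h ->; exact: env_deg_gen. Qed.

(* The class of x in degree d, with the junk value 0 when x is not of degree d. *)
Definition clsU (d : int) (x : env A) : calU A d :=
  match pselect (env_deg d x) with
  | left h => lcls _ (hat_const h)
  | right _ => 0
  end.

Lemma clsUE d x (h : env_deg d x) : clsU d x = lcls _ (hat_const h).
Proof.
by rewrite /clsU; case: pselect => // h'; congr (lcls _ (hat_const _)); exact: Prop_irrelevance.
Qed.

Lemma clsU_lin d c x y : env_deg d x -> env_deg d y ->
  clsU d (c *: x + y) = c *: clsU d x + clsU d y.
Proof.
move=> hx hy; rewrite (clsUE hx) (clsUE hy) (clsUE (env_degD c hx hy)) -lcls_linear.
by congr (lcls _ _); exact: hatP.
Qed.

Lemma clsU0 d : clsU d 0 = 0.
Proof.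
have := clsU_lin 1 (env_deg0 A d) (env_deg0 A d); rewrite !scale1r addr0 => e.
by apply: (addrI (clsU d 0)); rewrite addr0 -e.
Qed.

Lemma clsU_sum d I (r : seq I) (c : I -> k) (F : I -> env A) : (forall i, env_deg d (F i)) ->
  clsU d (\sum_(i <- r) c i *: F i) = \sum_(i <- r) c i *: clsU d (F i).
Proof.
move=> h; suff [] : env_deg d (\sum_(i <- r) c i *: F i) /\
  clsU d (\sum_(i <- r) c i *: F i) = \sum_(i <- r) c i *: clsU d (F i) by [].
elim: r => [|i r [IH1 IH2]]; first by rewrite !big_nil clsU0; split=> //; exact: env_deg0.
by rewrite !big_cons clsU_lin // IH2; split=> //; exact: env_degD.
Qed.

Lemma genUE d a m : genU A d a m = clsU d (env_gen A a m).
Proof. by []. Qed.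

(** [genU] defaults to 0 when the mode is not of degree d, so linearity is stated for vectors of one
    degree s with d = s - 1 - m. *)
Lemma genU_lin d s m c a b : gva_gr A s a -> gva_gr A s b -> d = s%:Z - 1 - m ->
  genU A d (c *: a + b) m = c *: genU A d a m + genU A d b m.
Proof.
by move=> ha hb e; rewrite !genUE env_gen_linear clsU_lin //; exact: env_gen_deg e.
Qed.

Lemma genU_scale d s m c a : gva_gr A s a -> d = s%:Z - 1 - m ->
  genU A d (c *: a) m = c *: genU A d a m.
Proof.
move=> ha e; have h0 := gr0 (gva_grading A) s.
rewrite -[c *: a]addr0 (genU_lin _ ha h0 e); rewrite -[RHS]addr0; congr (_ + _).
rewrite genUE (_ : env_gen A 0 m = 0) ?clsU0 //.
by have := env_gen_linear m (-1) 0 0; rewrite scaler0 addr0 scaleN1r addNr.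
Qed.

Lemma genU_nabla d s p a m : gva_gr A s a -> (0 < p)%N -> d = (s + p)%N%:Z - 1 - m ->
  \sum_(i < p.+1) genU A d (va_T A i a) (m - (p - i)%N%:Z) *~ binz m (p - i) = 0.
Proof.
move=> ha p_gt0 e; rewrite -[RHS](clsU0 d) -(env_gen_nabla a m p_gt0).
under [in RHS]eq_bigr do rewrite -scaler_int.
rewrite clsU_sum => [|i]; first by apply: eq_bigr => i _; rewrite scaler_int.
(* Term i has degree (s + i) - 1 - (m - (p - i)) = d, independently of i. *)
have := ltn_ord i => lt; apply: (env_gen_deg (va_T_gr i ha)); lia.
Qed.

End Generators.

(** * The action of V (x) R((s)), one degree at a time *)

Lemma laur_constE (A : comPzRingType) (a : A) (g : laur A) (m : int) :
  (laur_of (fps_const a) * g) m = a * g m.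
Proof.
have [N [F ->]] := laur_rep g; rewrite [_ * _]laur_mulE /= /lfrom_coef.
case: (m + _) => [i|i]; last by rewrite mulr0.
rewrite fps_mulE big_ord_recl /= subn0 big1 ?addr0 // => j _.
by rewrite /fps_const /= mul0r.
Qed.

HB.instance Definition _ (A : comPzRingType) (V : lmodType A) (B : calg A) :=
  GRing.isLinear.Build A V (bc V B) (calg_str B \; *:%R) (@bc_pure A V B) (@bc_pureP A V B).

Section Pairing.
Variables (k : fieldType) (V : lmodType k) (A : graded_va V) (R : calg k) (N : lmodType R).
Variables (e : int) (G : {linear calU A e -> N | calg_str R \; *:%R}).

Let B : calg k := calg_res (calg_laur R).
Implicit Types (f g : B) (v : V) (x y : bc V B).

(* The part of degree e of the action of v (x) g, for v homogeneous of degree s. *)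
Definition coef_gen (g : B) (s : nat) (v : V) : N :=
  (g : laur R) (s%:Z - 1 - e) *: G (genU A e v (s%:Z - 1 - e)).

Lemma coef_gen_lin g s c v w : gva_gr A s v -> gva_gr A s w ->
  coef_gen g s (c *: v + w) = calg_str R c *: coef_gen g s v + coef_gen g s w.
Proof.
move=> hv hw; rewrite /coef_gen (genU_lin c hv hw); last by lia.
by rewrite linearP /= scalerDr !scalerA mulrC.
Qed.

Lemma coef_gen_add g s v w : gva_gr A s v -> gva_gr A s w ->
  coef_gen g s (v + w) = coef_gen g s v + coef_gen g s w.
Proof. by move=> hv hw; rewrite -[v in LHS]scale1r coef_gen_lin // rmorph1 scale1r. Qed.

Lemma coef_gen0 g s : coef_gen g s 0 = 0.
Proof.
have h := gr0 (gva_grading A) s.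
by apply: (addrI (coef_gen g s 0)); rewrite -coef_gen_add // !addr0.
Qed.

Lemma coef_gen_scale g s c v : gva_gr A s v ->
  coef_gen g s (c *: v) = calg_str R c *: coef_gen g s v.
Proof.
move=> hv; have h0 := gr0 (gva_grading A) s.
by rewrite -[c *: v]addr0 coef_gen_lin // coef_gen0 addr0.
Qed.

Lemma coef_genD f g s v : coef_gen (f + g) s v = coef_gen f s v + coef_gen g s v.
Proof. exact: scalerDl. Qed.

Lemma coef_gen_str c g s v : coef_gen (calg_str B c * g) s v = calg_str R c *: coef_gen g s v.
Proof. by rewrite /coef_gen [X in X *: _]laur_constE scalerA. Qed.

Section Truncation.
Variable K : nat.

(* N is only an R-module, so the Laurent coefficient met on the way to a generator is carried
   along in g; truncating the sum over degrees at K makes the pairing exactly additive. *)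
Fixpoint coef_exp (g : B) (z : lexp B V) : N :=
  match z with
  | LGen v => \sum_(s < K) coef_gen g s (hom_part (gva_grading A) s v)
  | LZero => 0
  | LAdd z z' => coef_exp g z + coef_exp g z'
  | LOpp z => - coef_exp g z
  | LScale f z => coef_exp (f * g) z
  end.

Lemma coef_expD f g z : coef_exp (f + g) z = coef_exp f z + coef_exp g z.
Proof.
elim: z f g => [v||z IH z' IH'|z IH|h z IH] f g /=.
- by rewrite -big_split; apply: eq_bigr => s _; exact: coef_genD.
- by rewrite addr0.
- by rewrite IH IH' addrACA.
- by rewrite IH opprD.
by rewrite mulrDr IH.
Qed.

(** The scaling rules move coefficients into g, so the induction needs the claim for all g at
    once. *)
Lemma coef_exp_leqv z z' : leqv (@bc_rel k V B) z z' -> forall g, coef_exp g z = coef_exp g z'.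
Proof.
elim=> {z z'} //=.
- move=> _ _ [v w|c v] g /=.
    rewrite -big_split; apply: eq_bigr => s _; rewrite linearD.
    by rewrite coef_gen_add //; exact: hom_part_gr.
  apply: eq_bigr => s _; rewrite linearZ /= coef_gen_scale; last exact: hom_part_gr.
  by rewrite coef_gen_str.
- by move=> z1 z2 z3 _ IH _ IH' g; rewrite IH IH'.
- by move=> z1 z1' z2 z2' _ IH _ IH' g; rewrite IH IH'.
- by move=> z z' _ IH g; rewrite IH.
- by move=> z1 z2 z3 g; rewrite addrA.
- by move=> z1 z2 g; rewrite addrC.
- by move=> z g; rewrite add0r.
- by move=> z g; rewrite addNr.
- by move=> a b z g; rewrite mulrA (mulrC b).
- by move=> z g; rewrite mul1r.
- by move=> z a b g; rewrite mulrDl coef_expD.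
Qed.

Definition pairing (x : bc V B) : N := coef_exp 1 (qrep x).

Lemma pairing_pi z : pairing (qpi _ z) = coef_exp 1 z.
Proof. exact: coef_exp_leqv (pmod_rep _ _) _. Qed.

Lemma pairing_zmod : zmod_morphism pairing.
Proof.
move=> x y; rewrite -(qrepK x) -(qrepK y) [- _]pmod_oppE [_ + _ in LHS]pmod_addE.
by rewrite !pairing_pi.
Qed.

HB.instance Definition _ := GRing.isZmodMorphism.Build (bc V B) N pairing pairing_zmod.

Lemma pairingE g v :
  pairing (g *: bc_pure B v) = \sum_(s < K) coef_gen g s (hom_part (gva_grading A) s v).
Proof. by rewrite [_ *: _]pmod_scaleE pairing_pi /= mulr1. Qed.

Lemma pairing_hom g t v : gva_gr A t v -> (t < K)%N ->
  pairing (g *: bc_pure B v) = coef_gen g t v.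
Proof.
move=> h lt; rewrite pairingE (bigD1 (Ordinal lt)) //= (hom_part_id _ _ h) eqxx big1 ?addr0 //.
move=> i; rewrite -val_eqE /= => ne; rewrite (hom_part_id _ _ h) (negbTE ne).
exact: coef_gen0.
Qed.

End Truncation.

(** With m = t + p - 1 - e, term i reads the divided derivative at m - (p - i), where its
    coefficient is f m times binom(m, p - i). The factor f m is common to all terms, and what
    remains is G of the relation [genU_nabla]. *)
Lemma coef_gen_nabla (f : laur R) t p v : gva_gr A t v -> (0 < p)%N ->
  \sum_(i < p.+1) coef_gen (lhasse (p - i) f : B) (t + i) (va_T A i v) = 0.
Proof.
move=> hv p_gt0; pose m : int := (t + p)%N%:Z - 1 - e.
transitivity (f m *: G (\sum_(i < p.+1)
    genU A e (va_T A i v) (m - (p - i)%N%:Z) *~ binz m (p - i))); last first.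
  by rewrite (genU_nabla hv p_gt0) ?linear0 ?scaler0 // /m; lia.
rewrite linear_sum scaler_sumr; apply: eq_bigr => i _; have lt := ltn_ord i.
rewrite /coef_gen (_ : (t + i)%N%:Z - 1 - e = m - (p - i)%N%:Z); last by rewrite /m; lia.
by rewrite raddfMz /= subrK -[X in _ = f m *: X]scaler_int scalerA mulrzr.
Qed.

Lemma pairing_nabla x : nabla_im A x -> exists K0, forall K, (K0 <= K)%N -> pairing K x = 0.
Proof.
move=> [l [hl ->]]; elim: l hl => [|[[p v] f] l IH] hl.
  by exists 0%N => K _; rewrite big_nil raddf0.
have [|K1 h1] := IH; first by move=> y hy; apply: hl; rewrite inE hy orbT.
have p_gt0 : (0 < p)%N by apply: (hl (p, v, f)); rewrite inE eqxx.
have [hg [n [hn ev]]] := hom_partP (gva_grading A) v.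
(* The components of v lie in degrees below n and T^(i) raises degrees by i <= p, so the truncation
   at K loses nothing. *)
exists (K1 + n + p)%N => K le; rewrite big_cons raddfD /= h1; last by lia.
rewrite addr0 raddf_sum.
transitivity (\sum_(i < p.+1) \sum_(t < n)
    coef_gen (lhasse (p - i) f : B) (t + i) (va_T A i (hom_part (gva_grading A) t v))).
  apply: eq_bigr => i _; rewrite {1}ev !linear_sum raddf_sum /=.
  apply: eq_bigr => t _; apply: pairing_hom; first exact: va_T_gr.
  by have := ltn_ord i; have := ltn_ord t; lia.
by rewrite exchange_big big1 // => t _; exact: coef_gen_nabla.
Qed.

Definition degree_sum (l : vterms V R) : N := \sum_(x <- l) coef_gen (x.2 : laur R) x.1.1 x.1.2.

Lemma pairing_vterms l : vterms_hom A l ->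
  exists K0, forall K, (K0 <= K)%N -> pairing K (vterms_val l) = degree_sum l.
Proof.
rewrite /vterms_val /degree_sum; elim: l => [|[[t v] f] l IH] hl.
  by exists 0%N => K _; rewrite !big_nil raddf0.
have [|K1 h1] := IH; first by move=> y hy; apply: hl; rewrite inE hy orbT.
have hv : gva_gr A t v by apply: (hl (t, v, f)); rewrite inE eqxx.
exists (K1 + t.+1)%N => K le; rewrite !big_cons raddfD /= h1; last by lia.
by congr (_ + _); apply: pairing_hom => //; lia.
Qed.

(** For K large both sums are values of the additive map [pairing K], which kills the given element
    of the nabla image. Hence the representative of an expansion does not matter. *)
Lemma degree_sum_nabla l l' : vterms_hom A l -> vterms_hom A l' ->
  nabla_im A (vterms_val l - vterms_val l') -> degree_sum l = degree_sum l'.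
Proof.
move=> /pairing_vterms[K h] /pairing_vterms[K' h'] /pairing_nabla[K'' h''].
apply/subr0_eq; rewrite -(h (K + K' + K'')%N) -?(h' (K + K' + K'')%N); try by lia.
by rewrite -raddfB; apply: h''; lia.
Qed.

End Pairing.

(** * From sums over modes to sums over degrees *)

Lemma sum_int_window (Z : zmodType) (F : int -> Z) (h h' : nat -> int) (n n' : nat) :
  injective h -> injective h' ->
  (forall m, F m != 0 -> (exists2 t, (t < n)%N & m = h t) /\
                         (exists2 t, (t < n')%N & m = h' t)) ->
  \sum_(t < n) F (h t) = \sum_(t < n') F (h' t).
Proof.
move=> hi hi' hF; rewrite -(big_mkord predT (F \o h)) -(big_mkord predT (F \o h')).
rewrite -[LHS](big_map h predT F) -[RHS](big_map h' predT F).
(* Each window lists its integers without repetition and contains the support of F. *)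
apply: sum_support; rewrite ?map_inj_uniq ?iota_uniq // => m /hF[[t lt ->] [t' lt' e]].
by apply/andP; split; [apply: map_f | rewrite e; apply: map_f]; rewrite mem_index_iota.
Qed.

Section ActionSums.
Variables (k : fieldType) (V : lmodType k) (A : graded_va V) (R : calg k) (N : lmodType R).
Variable G : forall e, {linear calU A e -> N | calg_str R \; *:%R}.
Variable Bd : nat.
Hypothesis G_bounded : forall e x, e < - Bd%:Z -> G e x = 0.

Lemma action_sum_by_degree (l : vterms V R) :
  exists K0, forall K, (K0 <= K)%N ->
  \sum_(x <- l) \sum_(m < K.*2.+1) x.2 (m%:Z - K%:Z) *:
     G (x.1.1%:Z - 1 - (m%:Z - K%:Z)) (genU A _ x.1.2 (m%:Z - K%:Z)) =
  \sum_(t < (K + Bd).+1) degree_sum (G (K%:Z - t%:Z)) l.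
Proof.
elim: l => [|[[s v] f] l [K1 h1]].
  by exists 0%N => K _; rewrite big_nil big1 // => t _; rewrite /degree_sum big_nil.
have [M hM] := lbounded f.
(* Nonzero contributions need -M <= m, where f starts, and m <= s - 1 + Bd, as larger modes have
   degree below -Bd. For such K both windows contain this range. *)
exists (K1 + M + s + Bd)%N => K le; rewrite big_cons h1 /=; last by lia.
under [RHS]eq_bigr do rewrite /degree_sum big_cons.
rewrite big_split /=; congr (_ + _).
pose F (m : int) := f m *: G (s%:Z - 1 - m) (genU A _ v m).
transitivity (\sum_(t < (K + Bd).+1) F (s%:Z - 1 - (K%:Z - t%:Z))); last first.
  by apply: eq_bigr => t _; rewrite /F /coef_gen /= subKr.
apply: (sum_int_window (F := F) (h := fun m => m%:Z - K%:Z)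
  (h' := fun t => s%:Z - 1 - (K%:Z - t%:Z))) => [t t'|t t'|m nz]; try by lia.
have m1 : - M%:Z <= m.
  by apply: contraNT nz => lt; rewrite /F hM ?scale0r //; lia.
have m2 : m <= s%:Z - 1 + Bd%:Z.
  by apply: contraNT nz => lt; rewrite /F G_bounded ?scaler0 //; lia.
split; first by exists (absz (m + K%:Z)); lia.
by exists (absz (m - s%:Z + 1 + K%:Z)); lia.
Qed.

(** Single terms of l may have poles of any order; only their total in each degree is known to
    vanish above j. Regrouping by degree therefore comes first, and then the window can be cut down
    from K to j. *)
Lemma action_sum (l : vterms V R) (j : nat) :
  (forall e, j%:Z < e -> degree_sum (G e) l = 0) ->
  exists K0, forall K, (K0 <= K)%N ->
  \sum_(x <- l) \sum_(m < K.*2.+1) x.2 (m%:Z - K%:Z) *: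
     G (x.1.1%:Z - 1 - (m%:Z - K%:Z)) (genU A _ x.1.2 (m%:Z - K%:Z)) =
  \sum_(t < (j + Bd).+1) degree_sum (G (j%:Z - t%:Z)) l.
Proof.
move=> hj; have [K0 h] := action_sum_by_degree l; exists (K0 + j)%N => K le.
rewrite h; last by lia.
apply: (sum_int_window (F := fun e => degree_sum (G e) l) (h := fun t => K%:Z - t%:Z)
  (h' := fun t => j%:Z - t%:Z)) => [t t'|t t'|e nz]; try by lia.
have e1 : e <= j%:Z by apply: contraNT nz => lt; rewrite hj //; lia.
have e2 : - Bd%:Z <= e.
  apply: contraNT nz => lt; rewrite /degree_sum big1 // => x _.
  by rewrite /coef_gen G_bounded ?scaler0 //; lia.
by split; [exists (absz (K%:Z - e)) | exists (absz (j%:Z - e))]; lia.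
Qed.

End ActionSums.

(** * Actions and star product on the mode transition algebra *)

Lemma linear_sub (R : pzRingType) (M Y : lmodType R) (f g : M -> Y) :
  linear f -> linear g -> exists d : {linear M -> Y}, forall x, d x = f x - g x.
Proof.
move=> hf hg; pose d x := f x - g x.
have d_lin : linear d by move=> c x y; rewrite /d hf hg opprD scalerBr addrACA.
by exists (HB.pack_for {linear M -> Y} d (GRing.isLinear.Build R M Y *:%R d d_lin)).
Qed.

Lemma lspan_eq (R : pzRingType) (M Y : lmodType R) (P : M -> Prop) (f g : M -> Y) :
  linear f -> linear g -> (forall x, P x -> f x = g x) -> forall x, lspan P x -> f x = g x.
Proof.
move=> hf hg h x Px; have [D hD] := linear_sub hf hg.
apply: subr0_eq; rewrite -hD; apply: (lspan_lift (f := D) _ Px) => y /h.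
by rewrite hD => ->; rewrite subrr.
Qed.

(** Gives linearity in a parameter of the generator map, such as the acting element, with the
    argument fixed as an expression. *)
Lemma leval_gen_lin (R : comPzRingType) (X : Type) (Y : lmodType R) (c : R) (g g' g'' : X -> Y) z :
  (forall x, g x = c *: g' x + g'' x) -> leval g z = c *: leval g' z + leval g'' z.
Proof.
move=> h; elim: z => /= [x|| z -> z' ->|z ->|a z ->] //.
- by rewrite scaler0 addr0.
- by rewrite scalerDr addrACA.
- by rewrite scalerN opprD.
by rewrite scalerDr !scalerA mulrC.
Qed.

Section ModeTransition.
Variables (k : fieldType) (V : lmodType k) (A : graded_va V).
Notation fA := (fA A).
Notation calU := (calU A).

Lemma fA_mull_linear e (u : calU e) : linear (fA_mull u).
Proof. by apply: plift_linear; exact: fA_mull_compat. Qed.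
HB.instance Definition _ e (u : calU e) :=
  GRing.isLinear.Build k fA fA *:%R (fA_mull u) (fA_mull_linear u).

Lemma fA_mulr_linear e (u : calU e) : linear (fA_mulr u).
Proof. by apply: plift_linear; exact: fA_mulr_compat. Qed.
HB.instance Definition _ e (u : calU e) :=
  GRing.isLinear.Build k fA fA *:%R (fA_mulr u) (fA_mulr_linear u).

Lemma fA_star_linearl b : linear (fun x : fA => fA_star x b).
Proof. by apply: plift_linear; exact: fA_star_compatl. Qed.

Lemma fA_star_linear (b : fA) : linear (fA_star b).
Proof.
move=> c x y; rewrite -(qrepK b) /fA_star !plift_pi; last by move=> *; exact: fA_star_compatl.
all: try by move=> *; exact: fA_star_compatl.
by apply: leval_gen_lin => g; apply: plift_linear; exact: fA_star_compatr.
Qed.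

Lemma fA_mull_linearu e c (u u' : calU e) b :
  fA_mull (c *: u + u') b = c *: fA_mull u b + fA_mull u' b.
Proof.
rewrite -(qrepK b) /fA_mull !plift_pi; try by move=> *; exact: fA_mull_compat.
apply: leval_gen_lin => -[n m x y]; rewrite /fA_mull_gen /=.
case: (n%:Z + e) => [p|p]; last by rewrite scaler0 addr0.
have [v ->] := mtA_ex x.
by rewrite !mtA_mull_cls mulU_linl mtA_lin fA_pure_linl.
Qed.

Lemma fA_mulr_linearu e c (u u' : calU e) b :
  fA_mulr (c *: u + u') b = c *: fA_mulr u b + fA_mulr u' b.
Proof.
rewrite -(qrepK b) /fA_mulr !plift_pi; try by move=> *; exact: fA_mulr_compat.
apply: leval_gen_lin => -[n m x y]; rewrite /fA_mulr_gen /=.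
case: (m%:Z - e) => [p|p]; last by rewrite scaler0 addr0.
have [v ->] := mtA_ex y.
by rewrite !mtA_mulr_cls mulU_linr mtA_lin fA_pure_linr.
Qed.

Lemma fA_mull_piece e (u : calU e) n m p b : n%:Z + e = p%:Z ->
  fA_piece n m b -> fA_piece p m (fA_mull u b).
Proof.
move=> h; elim=> {b} [_ [x [y ->]]||x y _ IHx _ IHy|c x _ IH].
- have [v ->] := mtA_ex x; rewrite (fA_mullE _ _ _ h); apply: lspan_in.
  by eexists; eexists.
- by rewrite linear0; exact: lspan0.
- by rewrite linearD; exact: lspanD.
by rewrite linearZ; exact: lspanZ.
Qed.

Lemma fA_mulr_piece e (u : calU e) n m p b : m%:Z - e = p%:Z ->
  fA_piece n m b -> fA_piece n p (fA_mulr u b).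
Proof.
move=> h; elim=> {b} [_ [x [y ->]]||x y _ IHx _ IHy|c x _ IH].
- have [v ->] := mtA_ex y; rewrite (fA_mulrE _ _ _ h); apply: lspan_in.
  by eexists; eexists.
- by rewrite linear0; exact: lspan0.
- by rewrite linearD; exact: lspanD.
by rewrite linearZ; exact: lspanZ.
Qed.

Lemma fA_mull0 e (u : calU e) n m b : n%:Z + e < 0 -> fA_piece n m b -> fA_mull u b = 0.
Proof.
move=> h; apply: lspan_lift => _ [x [y ->]].
rewrite [LHS]plift_gen; last exact: fA_mull_compat.
by rewrite /fA_mull_gen /=; case: (n%:Z + e) h.
Qed.

Lemma fA_mulr0 e (u : calU e) n m b : m%:Z - e < 0 -> fA_piece n m b -> fA_mulr u b = 0.
Proof.
move=> h; apply: lspan_lift => _ [x [y ->]].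
rewrite [LHS]plift_gen; last exact: fA_mulr_compat.
by rewrite /fA_mulr_gen /=; case: (m%:Z - e) h.
Qed.

(** On pure tensors both sides are x (y u x') (x) y', up to associativity in [calU]; both are linear
    in b and in b'. *)
Lemma fA_star_assoc e (u : calU e) n d d' m b b' : d%:Z + e = d'%:Z ->
  fA_piece n d' b -> fA_piece d m b' ->
  fA_star (fA_mulr u b) b' = fA_star b (fA_mull u b').
Proof.
move=> h hb hb'.
have h' : d'%:Z - e = d%:Z by lia.
apply: (lspan_eq (f := fun b => fA_star (fA_mulr u b) b') (g := fun b => fA_star b _) _ _ _ hb).
- by move=> c x y; rewrite linearP fA_star_linearl.
- exact: fA_star_linearl.
move=> _ [x [y ->]].
apply: (lspan_eq (g := fun b' => fA_star _ (fA_mull u b')) _ _ _ hb').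
- exact: fA_star_linear.
- by move=> c z z'; rewrite linearP fA_star_linear.
move=> _ [x' [y' ->]].
have [v ->] := mtA_ex x; have [w ->] := mtA_ex y; have [v' ->] := mtA_ex x'.
rewrite (fA_mulrE _ _ _ h') (fA_mullE _ _ _ h) !fA_starE.
congr (fA_pure (mtA_cls _) _); congr (mulU _ _ _).
by apply: esym; apply: mulUA; lia.
Qed.

Lemma strong_identity_comm (one : nat -> fA) : strong_identity one ->
  forall e (u : calU e) n m, m%:Z + e = n%:Z -> fA_mull u (one m) = fA_mulr u (one n).
Proof.
move=> [_ h1] e u n m h.
have [pm [_ idm]] := h1 m; have [pn [idn _]] := h1 n.
have h' : n%:Z - e = m%:Z by lia.
rewrite -[LHS](proj2 (proj2 (h1 n)) m); last exact: fA_mull_piece h pm.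
(* Moves u from the right factor of the star product to the left one, where [one m] can be
   absorbed. *)
rewrite -(fA_star_assoc u h pn pm).
by apply: (proj1 (proj2 (h1 m)) n); exact: fA_mulr_piece h' pn.
Qed.

End ModeTransition.

(** * The anti-automorphism theta is an involution on modes *)

Section Theta.
Variables (k : fieldType) (V : lmodType k) (A : graded_va V).
Variables (act : forall B : calg k, fps B -> bc V B -> bc V B) (L : moebius A act).
Variable theta : forall d, calU A d -> calU A (- d).
Hypothesis Htheta : theta_anti L theta.

HB.instance Definition _ d :=
  GRing.isLinear.Build k (calU A d) (calU A (- d)) *:%R (@theta d) (th_linear Htheta (d := d)).

Lemma mo_L1_gr s l a : gva_gr A s a -> (l <= s)%N -> gva_gr A (s - l) (mo_L1 L l a).
Proof. by move=> h le; have := mo_L1_deg L l h; rewrite subzn. Qed.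

Lemma theta_genU s a m d : gva_gr A s a -> d = s%:Z - 1 - m ->
  theta (genU A d a m) = \sum_(i < s.+1) (-1) ^+ s *:
    genU A (- d) (mo_L1 L i a) (s%:Z - i%:Z - 1 + d).
Proof.
move=> h ->; rewrite (th_gen Htheta _ h); apply: eq_bigr => i _.
by congr (_ *: genU _ _ _ _); lia.
Qed.

(** The second theta meets L_1^(i) a of degree s - i, and L_1^(l) L_1^(i) = C(i + l, i) L_1^(i + l).
    The coefficient of L_1^(N) a is then the alternating sum of the C(N, i), that is (1 - 1)^N. The
    degree is written [- - d] because the left side has that type. *)
Lemma theta_theta_genU s a m d : gva_gr A s a -> d = s%:Z - 1 - m ->
  theta (theta (genU A d a m)) = genU A (- - d) a m.
Proof.
move=> h e; rewrite (theta_genU h e) linear_sum.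
pose D := - - d.
pose f N := genU A D (mo_L1 L N a) (m - N%:Z).
pose c i l : k := (-1) ^+ i * 'C(i + l, i)%:R.
transitivity (\sum_(i < s.+1) \sum_(l < (s - i).+1) c i l *: f (i + l)%N).
  apply: eq_bigr => i _; have := ltn_ord i; rewrite ltnS => le.
  have hi := mo_L1_gr h le.
  rewrite linearZ /= (theta_genU hi); last by lia.
  rewrite scaler_sumr; apply: eq_bigr => l _; have := ltn_ord l; rewrite ltnS => le'.
  have hl : gva_gr A (s - (i + l)) (mo_L1 L (i + l) a) by apply: mo_L1_gr h _; lia.
  rewrite scalerA mo_L1_L1 addnC -[_ *+ _]scaler_nat (genU_scale _ hl); last by lia.
  rewrite scalerA; congr (_ *: genU _ _ _ _); last by lia.
  (* The sign is (-1)^(s + (s - i)) = (-1)^i. *)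
  rewrite -exprD -signr_odd oddD oddB // addbA addbb addFb signr_odd.
  by rewrite /c addnC.
have -> : genU A D a m = f 0%N by rewrite /f mo_L1_0 subr0.
(* Regroups the double sum by N = i + l; only N = 0 survives. *)
have := sum_triangle s (fun i l _ => c i l *: f (i + l)%N).
move=> /= <-; rewrite big_ord_recl big_ord1 /= {1}/c mul1r bin0 scale1r big1 ?addr0 // => N _.
transitivity (\sum_(i < (bump 0 N).+1) c i (bump 0 N - i)%N *: f (bump 0 N)).
  by apply: eq_bigr => i _; have := ltn_ord i; rewrite ltnS => le; rewrite subnKC.
rewrite -scaler_suml (_ : \sum_(i < _) _ = (1 - 1) ^+ (bump 0 N)); last first.
  rewrite exprBn; apply: eq_bigr => i _; have := ltn_ord i; rewrite ltnS => le.
  by rewrite /c subnKC // !expr1n !mulr1 mulr_natr.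
by rewrite subrr expr0n /= scale0r.
Qed.

End Theta.

(** * Tensoring with an element of the mode transition algebra *)

Lemma pmod_ext (R : pzRingType) (X : Type) (rel : lexp R X -> lexp R X -> Prop)
    (Y : lmodType R) (f g : pmod rel -> Y) :
  linear f -> linear g -> (forall x, f (pgen rel x) = g (pgen rel x)) -> f =1 g.
Proof.
move=> hf hg h p; have [D hD] := linear_sub hf hg.
apply: subr0_eq; rewrite -hD -(qrepK p).
elim: (qrep p) => [x||e IHe e' IHe'|e IH|c e IH].
- by rewrite -/(pgen rel x) hD h subrr.
- exact: (linear0 D).
- rewrite (_ : qpi _ _ = (qpi _ e : pmod rel) + qpi _ e'); last exact/esym/pmod_addE.
  by rewrite linearD IHe IHe' addr0.
- rewrite (_ : qpi _ _ = - (qpi _ e : pmod rel)); last exact/esym/pmod_oppE.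
  by rewrite linearN IH oppr0.
rewrite (_ : qpi _ _ = c *: (qpi _ e : pmod rel)); last exact/esym/pmod_scaleE.
by rewrite linearZ IH /= scaler0.
Qed.

Section TensorWith.
Variables (k : fieldType) (V : lmodType k) (A : graded_va V) (R : calg k) (n : nat).
Variable M : 'I_n -> lmodType k.
Notation modP := (modP R M).
Notation modPQ := (modPQ A R M).
Implicit Types (b : fA A) (u : modP).

HB.instance Definition _ b :=
  GRing.isLinear.Build R modP modPQ *:%R (@tens_with k V A R n M b)
    (@tens_with_linear k V A R n M b).

Lemma dfwith_ext_pure (w : forall i, M i) b b' :
  dfwith (ext_pure w b) (b' : extM A M None) = ext_pure w b'.
Proof.
apply: functional_extensionality_dep => -[i|]; last by rewrite dfwith_in.
by rewrite dfwith_out.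
Qed.

Lemma tens_with_linearb c b b' u :
  tens_with (c *: b + b') u = calg_str R c *: tens_with b u + tens_with b' u :> modPQ.
Proof.
rewrite -(qrepK u) /tens_with !plift_pi; try by move=> *; exact: tens_with_compat.
refine (@leval_gen_lin R _ modPQ (calg_str R c) _ _ _ (qrep u) _) => w.
(* Exhibits each third factor as an update of the slot [None] of one fixed family, the form required
   by [tens_pureP]. *)
rewrite -(dfwith_ext_pure w 0 (c *: b + b')) -(dfwith_ext_pure w 0 b) -(dfwith_ext_pure w 0 b').
exact (@tens_pureP k R _ (extM A M) (ext_pure w 0) None c b b').
Qed.

Lemma tens_with0 u : tens_with 0 u = 0 :> modPQ.
Proof.
have := tens_with_linearb 1 0 0 u; rewrite rmorph1 !scale1r addr0 => e.
by apply: (addrI (tens_with 0 u)); rewrite addr0 -e.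
Qed.

Lemma tens_with_at b i (f : M i -> M i) u : linear f ->
  tens_with b (tens_at f u) =
  @tens_at k R _ (extM A M) (Some i) f (tens_with b u) :> modPQ.
Proof.
move=> hf; move: u; apply: pmod_ext.
- by move=> c x y; rewrite tens_at_linear // linearP.
- by move=> c x y; rewrite linearP (@tens_at_linear k R _ (extM A M) (Some i)).
move=> w; rewrite -/(tens_pure R w) tens_atE // !tens_withE.
by rewrite (@tens_atE k R _ (extM A M) (Some i)) // ext_pure_dfwith.
Qed.

Lemma tens_at_with b (h : fA A -> fA A) u : linear h ->
  @tens_at k R _ (extM A M) None h (tens_with b u) = tens_with (h b) u :> modPQ.
Proof.
move=> hh; move: u; apply: pmod_ext.
- by move=> c x y; rewrite linearP (@tens_at_linear k R _ (extM A M) None).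
- by move=> c x y; rewrite linearP.
move=> w; rewrite -/(tens_pure R w) !tens_withE.
by rewrite (@tens_atE k R _ (extM A M) None) // dfwith_ext_pure.
Qed.

(** The action at Q_+ as a function of the acting element, so that it can be paired with
    expansions. *)
Definition left_mode b u e (x : calU A e) : modPQ := tens_with (fA_mull x b) u.

Lemma left_mode_linear b u e : linear_for (calg_str R \; *:%R) (@left_mode b u e).
Proof. by move=> c x y; rewrite /left_mode fA_mull_linearu tens_with_linearb. Qed.

HB.instance Definition _ b u e := GRing.isLinear.Build k (calU A e) modPQ
  (calg_str R \; *:%R) (@left_mode b u e) (@left_mode_linear b u e).

Definition left_modes b u e : {linear calU A e -> modPQ | calg_str R \; *:%R} :=
  @left_mode b u e.

End TensorWith.

(** * The actions at Q_+ and Q_- of a section of prescribed nodal form *)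

Lemma lmonoE (A : comPzRingType) (e m : int) (F : fps A) (i : nat) :
  m - e = i%:Z -> lmono e F m = F i.
Proof. by rewrite /= => ->. Qed.

Lemma lmono_lt (A : comPzRingType) (e m : int) (F : fps A) : m < e -> lmono e F m = 0.
Proof. by move=> lt /=; case E : (m - e) => [i|i] //; lia. Qed.

Lemma laur_signE (A : comPzRingType) (s : nat) (f : laur A) (m : int) :
  ((-1) ^+ s * f) m = (-1) ^+ s * f m.
Proof.
rewrite -(laur_constE ((-1) ^+ s) f); congr (lcoef (_ * f) m).
by rewrite !rmorphXn !rmorphN1.
Qed.

Lemma laur_oppE (A : comPzRingType) (f : laur A) (m : int) : (- f) m = - f m.
Proof. by []. Qed.

Section NodalActions.
Variables (k : fieldType) (V : lmodType k) (A : graded_va V).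
Variables (act : forall B : calg k, fps B -> bc V B -> bc V B) (L : moebius A act).
Variable theta : forall d, calU A d -> calU A (- d).
Hypothesis Htheta : theta_anti L theta.
Variables (R : calg k) (n : nat).
Variables (M : 'I_n -> lmodType k) (mods : forall i, adm_module A (M i)).
Notation modP := (modP R M).
Notation modPQ := (modPQ A R M).
Implicit Types (b : fA A) (u : modP).

Definition right_mode b u e (x : calU A e) : modPQ := tens_with (fA_mulr (theta x) b) u.

Lemma right_mode_linear b u e : linear_for (calg_str R \; *:%R) (@right_mode b u e).
Proof.
by move=> c x y; rewrite /right_mode (th_linear Htheta) fA_mulr_linearu tens_with_linearb.
Qed.

HB.instance Definition _ b u e := GRing.isLinear.Build k (calU A e) modPQ
  (calg_str R \; *:%R) (@right_mode b u e) (@right_mode_linear b u e).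

Lemma opPQ_left s v m b u : opPQ theta mods (inr true) s v m (tens_with b u) =
  left_mode b u (genU A (s%:Z - 1 - m) v m).
Proof. exact: tens_at_with (fA_mull_linear _). Qed.

Lemma opPQ_right s v m b u : opPQ theta mods (inr false) s v m (tens_with b u) =
  right_mode b u (genU A (s%:Z - 1 - m) v m).
Proof. exact: tens_at_with (fA_mulr_linear _). Qed.

Lemma opPQ_marked i s v m b u : opPQ theta mods (inl i) s v m (tens_with b u) =
  tens_with b (opP mods i s v m u).
Proof. by rewrite /opP tens_with_at // => c x y; exact: (am_bilin (mods i)).2. Qed.

Definition right_modes b u e : {linear calU A e -> modPQ | calg_str R \; *:%R} :=
  @right_mode b u e.

(** Degree by degree, l may be replaced by the one-term list l'. Its part of degree j - t carries
    [al t j]; there is none above degree j, and degrees below -d kill b. *)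
Lemma nodal_plus_sum (l : vterms V R) s a al j d b u : vterms_hom A l -> gva_gr A s a ->
  nabla_im A (vterms_val l - nodal_plus s a al j) -> fA_piece d d b ->
  exists K0, forall K, (K0 <= K)%N ->
  \sum_(x <- l) \sum_(m < K.*2.+1) x.2 (m%:Z - K%:Z) *:
     opPQ theta mods (inr true) x.1.1 x.1.2 (m%:Z - K%:Z) (tens_with b u) =
  \sum_(t < (j + d).+1) al t j *:
     tens_with (fA_mull (genU A (j%:Z - t%:Z) a (s%:Z - 1 - (j%:Z - t%:Z))) b) u.
Proof.
move=> hl ha hn hb.
pose l' : vterms V R := [:: (s, a, lmono (s%:Z - j%:Z - 1) (fun i => al i j))].
have hl' : vterms_hom A l' by move=> x; rewrite inE => /eqP ->.
have El e : degree_sum (left_modes b u e) l =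
    degree_sum (left_modes b u e) l'.
  by apply: degree_sum_nabla => //; rewrite /vterms_val big_seq1.
have [||K0 h] := @action_sum _ _ _ _ _ (left_modes b u) d _ l j.
- by move=> e x lt; rewrite /= /left_mode (fA_mull0 _ _ hb) ?tens_with0 //; lia.
- by move=> e lt; rewrite El /degree_sum big_seq1 /coef_gen lmono_lt ?scale0r //=; lia.
exists K0 => K /h E; under eq_bigr do under eq_bigr do rewrite opPQ_left.
rewrite E; apply: eq_bigr => t _; rewrite El /degree_sum big_seq1 /coef_gen.
by rewrite (@lmonoE _ _ _ _ t) //=; lia.
Qed.

Lemma nodal_minus_terms s a (al : nat -> nat -> R) i :
  nodal_minus L s a al i = vterms_val [seq ((s - l)%N, mo_L1 L l a,
    - ((-1) ^+ s * lmono (s%:Z - i%:Z - 1 - l%:Z) (fun j => al i j)) : laur R)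
    | l <- index_iota 0 s.+1].
Proof.
rewrite /vterms_val big_map big_mkord /nodal_minus -sumrN.
by apply: eq_bigr => l _; rewrite -scaleNr.
Qed.

(** The prescribed expansion is minus theta of modes of a, and [right_mode] applies theta once more;
    the two cancel by [theta_theta_genU]. *)
Lemma nodal_minus_degree s a (al : nat -> nat -> R) (i : nat) (t : nat) b u : gva_gr A s a ->
  degree_sum (right_modes b u (i%:Z - t%:Z)) [seq ((s - l)%N, mo_L1 L l a,
    - ((-1) ^+ s * lmono (s%:Z - i%:Z - 1 - l%:Z) (fun j => al i j)) : laur R)
    | l <- index_iota 0 s.+1] =
  - (al i t *: tens_with (fA_mulr (genU A (t%:Z - i%:Z) a (s%:Z - 1 - (t%:Z - i%:Z))) b) u).
Proof.
move=> ha; rewrite /degree_sum big_map big_mkord.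
transitivity (- (al i t *: right_modes b u (i%:Z - t%:Z) (\sum_(l < s.+1) (-1) ^+ s *:
    genU A (i%:Z - t%:Z) (mo_L1 L l a) (s%:Z - l%:Z - 1 - (i%:Z - t%:Z))))).
  rewrite linear_sum scaler_sumr -sumrN; apply: eq_bigr => l _.
  have := ltn_ord l; rewrite ltnS => le; rewrite /coef_gen [_.1.1]/= [_.2]/=.
  rewrite (_ : (s - l)%N%:Z - 1 - (i%:Z - t%:Z) = s%:Z - l%:Z - 1 - (i%:Z - t%:Z)); last by lia.
  rewrite laur_oppE laur_signE (@lmonoE _ _ _ _ t); last by lia.
  rewrite scaleNr; congr (- _).
  by rewrite linearZ /= !scalerA rmorphXn rmorphN1 mulrC.
congr (- (_ *: _)); rewrite /= /right_mode.
(* Reading i - t as - (t - i) turns the sum into theta of a mode of degree t - i. *)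
rewrite -(opprB t%:Z i%:Z); set d := t%:Z - i%:Z.
have e : d = s%:Z - 1 - (s%:Z - 1 - d) by lia.
have := theta_theta_genU Htheta ha e; rewrite (theta_genU Htheta ha e).
under [in X in _ -> X]eq_bigr do rewrite opprK.
by move=> ->; rewrite opprK.
Qed.

Lemma nodal_minus_sum (l : vterms V R) s a al i d b u : vterms_hom A l -> gva_gr A s a ->
  nabla_im A (vterms_val l - nodal_minus L s a al i) -> fA_piece d d b ->
  exists K0, forall K, (K0 <= K)%N ->
  \sum_(x <- l) \sum_(m < K.*2.+1) x.2 (m%:Z - K%:Z) *:
     opPQ theta mods (inr false) x.1.1 x.1.2 (m%:Z - K%:Z) (tens_with b u) =
  - \sum_(t < (i + d).+1) al i t *:
     tens_with (fA_mulr (genU A (t%:Z - i%:Z) a (s%:Z - 1 - (t%:Z - i%:Z))) b) u.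
Proof.
move=> hl ha; rewrite nodal_minus_terms; set l' := map _ _ => hn hb.
have hl' : vterms_hom A l'.
  move=> x /mapP[r]; rewrite mem_index_iota ltnS => /andP[_ le] -> /=.
  exact: mo_L1_gr.
have El e : degree_sum (right_modes b u e) l = degree_sum (right_modes b u e) l'.
  exact: degree_sum_nabla.
have [||K0 h] := @action_sum _ _ _ _ _ (right_modes b u) d _ l i.
(* theta reverses degrees, so right multiplication by theta x would bring the second index to d + e
   < 0. *)
- by move=> e x lt; rewrite /= /right_mode (fA_mulr0 _ _ hb) ?tens_with0 //; lia.
- move=> e lt; rewrite El /degree_sum big_map big_seq big1 // => r.
  rewrite mem_index_iota ltnS => /andP[_ le].
  by rewrite /coef_gen laur_oppE laur_signE lmono_lt ?mulr0 ?oppr0 ?scale0r //=; lia.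
exists K0 => K /h E; under eq_bigr do under eq_bigr do rewrite opPQ_right.
rewrite E -sumrN; apply: eq_bigr => t _.
by rewrite El nodal_minus_degree.
Qed.

End NodalActions.

(** * Descent of alpha to the coinvariants of the smoothing *)

Section Gluing.
Variables (k : fieldType) (V : lmodType k) (A : graded_va V).
Variables (act : forall B : calg k, fps B -> bc V B -> bc V B) (L : moebius A act).
Variable theta : forall d, calU A d -> calU A (- d).
Hypothesis Htheta : theta_anti L theta.
Variable one : nat -> fA A.
Hypothesis Hone : strong_identity one.
Variables (R : calg k) (n : nat) (S : smoothing R n).
Variables (M : 'I_n -> lmodType k) (mods : forall i, adm_module A (M i)).
Notation modP := (modP R M).
Notation modPQ := (modPQ A R M).
Notation coinv_N0 := (coinv_N0 act theta S mods).
Notation cls_N0 := (cls_N0 act theta S mods).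

HB.instance Definition _ :=
  GRing.isLinear.Build R modPQ coinv_N0 *:%R cls_N0 (@lcls_linear _ _ _).

(* The contribution of al_(t,i) to the coefficient of q^c in the action at Q_+. That at Q_- is
   - node_term c t i for al_(i,t), so the two families cancel when summed over i, t <= c. *)
Definition node_term s a (al : nat -> nat -> R) (u : modP) (c i t : nat) : modPQ :=
  al t i *: tens_with (fA_mull (genU A (i%:Z - t%:Z) a (s%:Z - 1 - (i%:Z - t%:Z)))
                               (one (c - i))) u.

Lemma one_piece d : fA_piece d d (one d).
Proof. by case: (Hone.2 d). Qed.

(** The section l acts by zero on the class of u (x) [one (c - i)]. Its action at the P-sections
    gives z (x) [one (c - i)], which is thus minus the contributions of Q_+ and Q_-. *)
Lemma node_relation (l : mark n -> vterms V R) s a al i c u z :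
  chiral A act S l -> gva_gr A s a -> (i <= c)%N ->
  nabla_im A (vterms_val (l (inr true)) - nodal_plus s a al i) ->
  nabla_im A (vterms_val (l (inr false)) - nodal_minus L s a al i) ->
  acts (opP mods) (fun p => l (inl p)) u z ->
  cls_N0 (tens_with (one (c - i)) z) =
  \sum_(t < c.+1) (cls_N0 (node_term s a al u c t i) - cls_N0 (node_term s a al u c i t)).
Proof.
move=> hl ha le hp hm [K0 hz].
have [sg [_ hsg]] := hl.
have [Kp hKp] := nodal_plus_sum theta mods u (hsg (inr true)).1 ha hp (one_piece (c - i)).
have [Km hKm] := nodal_minus_sum Htheta mods u (hsg (inr false)).1 ha hm (one_piece (c - i)).
(* The choice d = c - i makes both sums range over t <= c, for every i. *)
rewrite subnKC // in hKp hKm.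
(* P is the contribution of Q_+, and - Q will be that of Q_-. *)
pose P := \sum_(t < c.+1) node_term s a al u c i t.
pose Q := \sum_(t < c.+1) node_term s a al u c t i.
suff /lcls_eq e : lspan (fun y : modPQ =>
    exists l u, chiral A act S l /\ acts (opPQ theta mods) l u y)
    (tens_with (one (c - i)) z - (Q - P)).
  rewrite sumrB [LHS]e -!linear_sum -linearB.
  by [].
apply: lspan_in; exists l, (tens_with (one (c - i)) u); split=> //.
exists (K0 + Kp + Km)%N => K leK.
rewrite big_sumType big_bool hKp ?hKm; try by lia.
rewrite opprB (hz K); last by lia.
congr (_ + (_ - _)).
  rewrite linear_sum; apply: eq_bigr => p _; rewrite linear_sum; apply: eq_bigr => x _.
  rewrite linear_sum; apply: eq_bigr => m _.
  by rewrite linearZ /= -(opPQ_marked theta).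
(* The mode has degree t - i, so it passes from the right of [one (c - i)] to the left of
   [one (c - t)]; t <= c keeps this subtraction exact. *)
apply: eq_bigr => t _; have := ltn_ord t; rewrite ltnS => let'.
rewrite /node_term (@strong_identity_comm _ _ _ _ Hone _ _ (c - i) (c - t)) //; lia.
Qed.

Lemma node_relation_sum (l : nat -> mark n -> vterms V R) c u (z : nat -> modP) :
  chiral_nodal L S l ->
  (forall i, acts (opP mods) (fun p => l i (inl p)) u (z i)) ->
  \sum_(i < c.+1) cls_N0 (tens_with (one (c - i)) (z i)) = 0.
Proof.
move=> [hl [s [a [al [ha hp hm]]]]] hz.
under eq_bigr => i _.
  rewrite (node_relation (hl i) ha _ (hp i) (hm i) (hz i)); last by rewrite -ltnS.
  rewrite sumrB.
  over.
by rewrite sumrB exchange_big subrr.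
Qed.

Definition cls_alphaq (u : qser modP) : qser coinv_N0 := fun m => cls_N0 (alphaq one u m).

Lemma cls_alphaqE u m :
  cls_alphaq u m = \sum_(i < m.+1) cls_N0 (tens_with (one (m - i)) (u i)).
Proof. by rewrite /cls_alphaq /alphaq linear_sum. Qed.

Lemma cls_alphaq_linear : linear cls_alphaq.
Proof.
move=> f u v; apply: funext => m.
rewrite -[RHS]/(conv f (cls_alphaq u) m + cls_alphaq v m) !cls_alphaqE.
rewrite -[f *: u + v]/((fun i => conv f u i + v i) : qser modP).
under eq_bigr do rewrite linearD [cls_N0 _]linearD.
rewrite big_split /=; congr (_ + _).
transitivity (\sum_(a < m.+1) \sum_(i < a.+1)
  f i *: cls_N0 (tens_with (one (m - a)) (u (a - i)%N))).
  apply: eq_bigr => a _; rewrite /conv !linear_sum.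
  by apply: eq_bigr => i _; rewrite !linearZ.
(* Once i is fixed, the inner sum is the coefficient m - i of [cls_alphaq u]. *)
rewrite (sum_triangle m (fun i j b => f i *: cls_N0 (tens_with (one b) (u j)))).
apply: eq_bigr => i _; rewrite cls_alphaqE scaler_sumr.
by [].
Qed.

HB.instance Definition _ := GRing.isLinear.Build (fps R) (qser modP) (qser coinv_N0) *:%R
  cls_alphaq cls_alphaq_linear.

(** Here [z i j] is the action of the coefficient i of the section on [u j]. For fixed j, the sum
    over i vanishes by [node_relation_sum] with c = m - j. *)
Lemma cls_alphaq_nodal l u y : chiral_nodal L S l ->
  acts_q (opP mods) (fun m i => l m (inl i)) u y -> cls_alphaq y = 0.
Proof.
move=> hl [z [hz hy]]; apply: funext => m; rewrite cls_alphaqE.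
pose W i j b := cls_N0 (tens_with (one b) (z i j)).
transitivity (\sum_(a < m.+1) \sum_(i < a.+1) W i (a - i)%N (m - a)%N).
  by apply: eq_bigr => a _; rewrite hy !linear_sum.
(* Reverses the inner sum so that [sum_triangle] brings j outside. *)
transitivity (\sum_(a < m.+1) \sum_(j < a.+1) W (a - j)%N j (m - a)%N).
  apply: eq_bigr => a _; rewrite (reindex_inj rev_ord_inj) /=.
  by apply: eq_bigr => i _; rewrite subSS subKn // -ltnS.
rewrite (sum_triangle m (fun j i b => W i j b)) big1 // => j _.
rewrite /W; have := node_relation_sum (m - j) hl (fun i => hz i j).
by [].
Qed.

End Gluing.

(** * Restriction to q = 0 *)

Section SpecialFibre.
Variables (k : fieldType) (V : lmodType k) (A : graded_va V).
Variables (act : forall B : calg k, fps B -> bc V B -> bc V B) (L : moebius A act).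
Variable theta : forall d, calU A d -> calU A (- d).
Hypothesis Htheta : theta_anti L theta.
Variable one : nat -> fA A.
Hypothesis Hone : strong_identity one.
Variables (R : calg k) (n : nat) (S : smoothing R n).
Variables (M : 'I_n -> lmodType k) (mods : forall i, adm_module A (M i)).
Notation modP := (modP R M).
Notation cls_N0 := (cls_N0 act theta S mods).

(** For c = i = 0 the only index in [node_relation] is t = 0, and its two terms are equal. *)
Lemma cls_tens_with_nodal0 l (u y : modP) : chiral_nodal0 L S l ->
  acts (opP mods) (fun i => l (inl i)) u y -> cls_N0 (tens_with (one 0) y) = 0.
Proof.
move=> [hl [s [a [al [ha hp hm]]]]] hy.
rewrite (node_relation Htheta Hone (c := 0) (i := 0) hl ha _ hp hm hy) //.
by rewrite big_ord1 subrr.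
Qed.

(** The coefficient [l 0] of a generator satisfies the q = 0 prescription with the same [al], and a
    scalar f acts on constant terms through [f 0]. *)
Lemma lspan_at0 (y : qser modP) :
  lspan (fun y : qser modP =>
    exists l u, chiral_nodal L S l /\ acts_q (opP mods) (fun m i => l m (inl i)) u y) y ->
  lspan (fun y : modP =>
    exists l u, chiral_nodal0 L S l /\ acts (opP mods) (fun i => l (inl i)) u y) (y 0%N).
Proof.
elim=> {y} [y [l [u [[hl [s [a [al [ha hp hm]]]]] [z [hz hy]]]]]||x y _ IHx _ IHy|f x _ IH].
- apply: lspan_in; exists (l 0%N), (u 0%N); split.
    by split=> //; exists s, a, al.
  by rewrite hy big_ord1 subnn.
- exact: lspan0.
- exact: lspanD.
rewrite -[(f *: x) 0%N]/(conv f x 0%N) /conv big_ord1; exact: lspanZ.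
Qed.

End SpecialFibre.

Theorem corollary9p9
  (k : closedFieldType) (V : lmodType k) (A : graded_va V)
  (act : forall B : calg k, fps B -> bc V B -> bc V B)
  (Hact : is_autO_action A act) (L : moebius A act)
  (theta : forall d, calU A d -> calU A (- d)) (Htheta : theta_anti L theta)
  (one : nat -> fA A) (Hone : strong_identity one)
  (R : calg k) (n : nat) (S : smoothing R n)
  (M : 'I_n -> lmodType k) (mods : forall i, adm_module A (M i))
  (Hcoh : coherent (coinv_N act theta S mods)) :
  exists (alpha : {linear coinv_C L S mods -> qser (coinv_N0 act theta S mods)})
         (alpha0 : {linear coinv_C0 L S mods -> coinv_N0 act theta S mods})
         (left : coinv_C L S mods -> coinv_C0 L S mods)
         (right : qser (coinv_N0 act theta S mods) -> coinv_N0 act theta S mods),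
    [/\ (forall u m, alpha (cls_C L S mods u) m = cls_N0 act theta S mods (alphaq one u m)),
        (forall w, alpha0 (cls_C0 L S mods w)
           = cls_N0 act theta S mods (tens_with (one 0%N) w)),
        (forall u, left (cls_C L S mods u) = cls_C0 L S mods (u 0%N)) /\
        (forall y, right y = y 0%N),
        surjective left /\ surjective right &
        forall x, right (alpha x) = alpha0 (left x)].
Proof.
pose f : {linear qser (modP R M) -> qser (coinv_N0 act theta S mods)} :=
  @cls_alphaq _ _ _ _ _ one _ _ S _ mods.
have [|alpha halpha] := @lquot_lift _ _ (fun y : qser (modP R M) =>
    exists l u, chiral_nodal L S l /\ acts_q (opP mods) (fun m i => l m (inl i)) u y) _ f.
  by move=> y [l [u [hl hy]]]; exact: (cls_alphaq_nodal Htheta Hone hl hy).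
pose f0 : {linear modP R M -> coinv_N0 act theta S mods} :=
  (@cls_N0 _ _ _ act theta _ _ S _ mods) \o tens_with (one 0%N).
have [|alpha0 halpha0] := @lquot_lift _ _ (fun y : modP R M =>
    exists l u, chiral_nodal0 L S l /\ acts (opP mods) (fun i => l (inl i)) u y) _ f0.
  by move=> y [l [u [hl hy]]]; exact: (cls_tens_with_nodal0 Htheta Hone hl hy).
(* The base ring changes from R[[q]] to R, outside the scope of [lquot_lift]; a representative is
   chosen, and [lspan_at0] gives independence of it. *)
pose left (x : coinv_C L S mods) : coinv_C0 L S mods := cls_C0 L S mods (qrep x 0%N).
have leftE u : left (cls_C L S mods u) = cls_C0 L S mods (u 0%N).
  apply/lcls_eq; apply: (lspan_at0 (y := qrep (cls_C L S mods u) - u)).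
  exact: lrep_cls.
exists alpha, alpha0, left, (fun y => y 0%N); split=> //.
- by move=> u m; rewrite [alpha _]halpha.
(* The witnesses are series with all coefficients equal; only the value at q = 0 matters. *)
- split=> [w|w]; last by exists (fun=> w).
  exists (cls_C L S mods (fun=> qrep w)); rewrite leftE.
  exact: qrepK.
(* Both composites send the class of u to that of [u 0] (x) [one 0]. *)
move=> x; rewrite -(qrepK x) -[qpi _ _]/(cls_C L S mods _) leftE.
by rewrite [alpha _]halpha [alpha0 _]halpha0 /= /cls_alphaq /alphaq big_ord1.
Qed.
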